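(* Let $t=k+is$ with $k\in\mathbb{Z}_{>0}$, $s\in\mathbb{R}$. Let $U\subseteq\mathcal{T}$ be open and $\psi:U\times\mathcal{A}_0^{\mathbb{C}}\to\mathbb{C}$ a smooth family of polarised functions (i.e. for each $\tau\in U$, $\psi(\tau,\cdot)$ is constant along $P_\tau$) such that for every $\tau\in U$: (a) $\psi|_{Q_\tau}$ lies in the domain of all two-fold compositions of the ladder operators (i.e. $\psi$ and all functions obtained from $\psi|_{Q_\tau}$ by applying at most two operators among $q_j$, $\partial/\partial q_j$, $1\le j\le 2r$, are in $L^2(Q_\tau)$); (b) $\frac{\delta\psi}{\delta\tau}$ and $\frac{\delta\psi}{\delta\overline\tau}$ restrict to $L^2$ functions on $Q_\tau$, and $\mathcal{B}_\tau\big(\frac{\delta\psi}{\delta\tau}\big)=\frac{\delta\mathcal{B}_\tau(\psi)}{\delta\tau}$, $\mathcal{B}_\tau\big(\frac{\delta\psi}{\delta\overline\tau}\big)=\frac{\delta\mathcal{B}_\tau(\psi)}{\delta\overline\tau}$. Then the Bargmann transforms intertwine the lifted Hitchin–Witten and the lifted complexified Hitchin connections on $\psi$: for $\partial\in\{\frac{\partial}{\partial\tau},\frac{\partial}{\partial\overline\tau}\}$, $$\mathcal{B}_\tau\Big(\mathrm{Ext}_\tau\big(\nabla^{\mathrm{HW}}_{\partial}(\psi\rho_\tau|_{\mathcal{A}_0})\big)\Big|_{Q_\tau}\Big)=\nabla^{\mathbb{C}}_{\partial}\big(\mathcal{B}_\tau(\psi|_{Q_\tau})\big).$$ Moreover the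 family of Bargmann transforms is mapping class group equivariant: for $f\in\Gamma=\mathrm{SL}(2,\mathbb{Z})$, $\tau\in\mathcal{T}$ and $\psi\in L^2(Q_\tau)$, $\mathcal{B}_{f\cdot\tau}(f\cdot\psi)=f\cdot\mathcal{B}_\tau(\psi)$.
   Context: Basic data. $K$ is a compact connected simply-connected Lie group, $T\subseteq K$ a maximal torus with Lie algebra $\mathfrak{t}$, $r=\dim\mathfrak{t}$, $\mathfrak{t}^{\mathbb{C}}=\mathfrak{t}\otimes\mathbb{C}$. $\langle\cdot,\cdot\rangle$ is the positive-definite inner product on $\mathfrak{t}$ (extended complex-bilinearly) given by restricting a multiple of the Cartan–Killing form of $\mathrm{Lie}(K)$, normalised so that the class of the canonical 3-form on $K$ lies in $H^3(K,2\pi\mathbb{Z})$; $(T_1,\dots,T_r)$ is an orthonormal basis of $\mathfrak{t}$. $\Sigma=\mathbb{R}^2/\mathbb{Z}^2$ with coordinates $(x,y)$. $\mathcal{A}_0$ and $\mathcal{A}_0^{\mathbb{C}}$ are the real vector spaces of constant-coefficient 1-forms on $\Sigma$ with values in $\mathfrak{t}$, resp. $\mathfrak{t}^{\mathbb{C}}$. $\omega^{\mathbb{C}}(A,B)=\int_\Sigma\langle A\wedge B\rangle$, $\omega=\omega^{\mathbb{C}}|_{\mathcal{A}_0}$, $\omega_t=\mathrm{Re}(t\omega^{\mathbb{C}})$ (restricting to $k\omega$ on $\mathcal{A}_0$). Kähler structures. Teichmüller space $\mathcal{T}$ is the upper half-plane with points $\tau=\tau_1+i\tau_2$; $*_\tau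 dx=\frac1{\tau_2}(\tau_1dx+|\tau|^2dy)$, $*_\tau dy=-\frac1{\tau_2}(dx+\tau_1dy)$. $I_\tau=*_\tau$ on $\mathcal{A}_0$, $g_\tau=\omega(\cdot,I_\tau\cdot)$. On $\mathcal{A}_0^{\mathbb{C}}$: $J$ is multiplication by $i$, $I_\tau^{\mathbb{C}}(A+iB)=*_\tau A-i*_\tau B$ ($A,B\in\mathcal{A}_0$), $K_\tau=I^{\mathbb{C}}_\tau J$, $I_{\tau,t}=\frac1{|t|}(kI^{\mathbb{C}}_\tau+sK_\tau)$, $g_\tau^{\mathbb{C}}=|t|^{-1}\omega_t(\cdot,I_{\tau,t}\cdot)$. Tildes $\widetilde g_\tau,\widetilde g_\tau^{\mathbb{C}}$ denote the inverse bivectors. Coordinates. With $\zeta_\tau=x+\tau y$, put $X_j=\frac{T_j}{\sqrt{2\tau_2}}d\zeta_\tau$, $X_{j+r}=JX_j$ for $1\le j\le r$, and $Y_j=I_{\tau,t}X_j$ for $1\le j\le 2r$. This is a real basis of $\mathcal{A}_0^{\mathbb{C}}$; $(\bm p,\bm q)\in\mathbb{R}^{2r}\times\mathbb{R}^{2r}$ are the ($\tau$-dependent) coordinates with respect to $X_j$ and $Y_j$, $\bm z=\bm p+i\bm q$. $P_\tau=\mathrm{span}(X_1,\dots,X_{2r})$ and $Q_\tau=\mathrm{span}(Y_1,\dots,Y_{2r})$; $L^2(Q_\tau)$ is with respect to $d\bm q$. One has $\omega_t=|t|\sum_j dp_j\wedge dq_j$ and $\mathcal{A}_0^{\mathbb{C}}=\mathcal{A}_0\oplus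 P_\tau$. $\frac{\delta}{\delta\tau},\frac{\delta}{\delta\overline\tau}$ denote derivatives in $\tau,\overline\tau$ with the coordinates $(\bm p,\bm q)$ held fixed; $\frac{\partial}{\partial\tau},\frac{\partial}{\partial\overline\tau}$ are derivatives with the point of $\mathcal{A}_0^{(\mathbb{C})}$ held fixed. Prequantum data. Trivial line bundles over $\mathcal{A}_0$, $\mathcal{A}_0^{\mathbb{C}}$ with connection $(\nabla_X\phi)(A)=X[\phi](A)-\frac i2\omega_t(A,X)\phi(A)$. $\rho_\tau=\exp(-\frac{i|t|}{2}\bm p\cdot\bm q)$ is a $P_\tau$-polarised (covariantly constant along $P_\tau$) frame on $\mathcal{A}_0^{\mathbb{C}}$, equal to $1$ on $Q_\tau$. For a function $\eta$ on $\mathcal{A}_0$, $\mathrm{Ext}_\tau(\eta)$ is the unique $P_\tau$-polarised section on $\mathcal{A}_0^{\mathbb{C}}$ restricting to $\eta$. Bargmann transform. $\mathcal{B}_\tau$ maps $L^2(Q_\tau)$ to $L^2$ $I_{\tau,t}$-holomorphic sections on $\mathcal{A}_0^{\mathbb{C}}$: $$(\mathcal{B}_\tau\psi)(\bm z)=\int_{\mathbb{R}^{2r}}\psi(\bm q')B(\bm q',\bm z)\,d\bm q',\quad B(\bm q',\bm z)=\Big(\frac{|t|^3}{4\pi^3}\Big)^{r/2}e^{-\frac{|t|}{2}|\bm q-\bm q'|^2}e^{-\frac{i|t|}2\bm p\cdot(2\bm q'-\bm q)}.$$ For $\psi$ defined on $\mathcal{A}_0^{\mathbb{C}}$, $\mathcal{B}_\tau(\psi)$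 means $\mathcal{B}_\tau(\psi|_{Q_\tau})$. Connections. For constant tensors, $\Delta_{\sum G^{ab}e_a\otimes e_b}=\sum G^{ab}\nabla_{e_a}\nabla_{e_b}$. Lifted Hitchin–Witten connection, on families of smooth functions on $\mathcal{A}_0$: $\nabla^{\mathrm{HW}}_V=V-\frac12\big(\frac1{\overline t}\Delta_{\overline G(V)}-\frac1t\Delta_{G(V)}\big)$, where $-V[\widetilde g_\tau]=G(V)+\overline G(V)$ is the decomposition into parts of type $(2,0)$ and $(0,2)$ for $I_\tau$. Lifted complexified Hitchin connection, on families of holomorphic sections on $\mathcal{A}_0^{\mathbb{C}}$: $\nabla_V^{\mathbb{C}}=V+\frac1{4|t|}\Delta_{G^{\mathbb{C}}(V)}$, where $G^{\mathbb{C}}(V)$ is the $(2,0)$-part of $-V[\widetilde g_\tau^{\mathbb{C}}]$ for $I_{\tau,t}$. Everything is extended complex-linearly in $V$. Mapping class group. $f\in\mathrm{SL}(2,\mathbb{Z})$ acts on $\Sigma$ linearly, on constant 1-forms by $(f^{-1})^*$ (mapping $Q_\tau$ to $Q_{f\cdot\tau}$), on $\mathcal{T}$ so that $*_{f\cdot\tau}=(f^{-1})^*\circ *_\tau\circ f^*$, and on functions by $(f\cdot\phi)(A)=\phi(f^*A)$.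
   Formalization: The intertwining part additionally assumes that (τ,A) ↦ B_τ(ψ)(A) is jointly differentiable on U×A_0^C; without it the derivative ∂/∂τ of B_τ(ψ) at a fixed point, used in the complexified Hitchin connection, need not exist under (a) and (b). *)

(* Defs.v *)
From HB Require Import structures.
From mathcomp Require Import all_boot all_order all_algebra.
From mathcomp Require Import sesquilinear.
From mathcomp Require Import complex.
From mathcomp Require Import all_classical all_reals all_analysis.

Set Implicit Arguments.
Unset Strict Implicit.
Unset Printing Implicit Defensive.

Import Order.TTheory GRing.Theory Num.Theory.
Import numFieldNormedType.Exports.

Local Open Scope classical_set_scope.
Local Open Scope ring_scope.
Local Open Scope complex_scope.

Local Notation Rec := (@complex.Re _).
Local Notation Imc := (@complex.Im _).

(* Lebesgue measure on R^n (as n.-tuple R with the product sigma-algebra), by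
   recursion: the image of lebesgue_measure \x (measure on R^n) under cons. *)
Section LebesgueTuple.
Context {R : realType}.

Definition cons_pair n (x : R * n.-tuple R) : n.+1.-tuple R :=
  [tuple of x.1 :: x.2].

Lemma measurable_cons_pair n : measurable_fun [set: R * n.-tuple R]
  (@cons_pair n).
Proof. exact: measurable_cons. Qed.

Section Succ.
Context (n : nat) (mu : {sigma_finite_measure set (n.-tuple R) -> \bar R}).
Local Open Scope ereal_scope.

Definition lebesgue_cons : set (n.+1.-tuple R) -> \bar R :=
  pushforward (@lebesgue_measure R \x mu) (@cons_pair n).

Let lebesgue_cons0 : lebesgue_cons set0 = 0.
Proof. by rewrite /lebesgue_cons /pushforward preimage_set0 measure0. Qed.

Let lebesgue_cons_ge0 A : 0 <= lebesgue_cons A.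
Proof. exact: (measure_ge0 (@lebesgue_measure R \x mu)). Qed.

Let lebesgue_cons_sigma_additive : semi_sigma_additive lebesgue_cons.
Proof.
move=> F mF tF mUF; rewrite /lebesgue_cons /pushforward preimage_bigcup.
apply: measure_semi_sigma_additive.
- by move=> i; rewrite -[X in measurable X]setTI; exact: measurable_cons_pair.
- apply/trivIsetP => /= i j _ _ ij; rewrite -preimage_setI.
  by move/trivIsetP : tF => /(_ _ _ _ _ ij) ->//; rewrite preimage_set0.
- rewrite -preimage_bigcup -[X in measurable X]setTI.
  exact: measurable_cons_pair.
Qed.

HB.instance Definition _ := isMeasure.Build _ _ _ lebesgue_cons
  lebesgue_cons0 lebesgue_cons_ge0 lebesgue_cons_sigma_additive.

Let lebesgue_cons_sigma_finite : sigma_finite setT lebesgue_cons.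
Proof.
have /sigma_finiteP[F [FT ndF Foo]] := sigma_finiteT (@lebesgue_measure R).
have /sigma_finiteP[G [GT ndG Goo]] := sigma_finiteT mu.
pose g (v : n.+1.-tuple R) : R * n.-tuple R := (thead v, [tuple of behead v]).
have gK x : g (cons_pair x) = x.
  case: x => a v; rewrite /g /cons_pair /= theadE; congr pair.
  exact: val_inj.
have mg : measurable_fun setT g.
  apply: measurable_fun_pair; last exact: measurable_behead.
  exact: (@measurable_tnth _ R _ ord0).
exists (fun i => g @^-1` (F i `*` G i)).
  apply/esym/seteqP; split=> // v _.
  have [i _ Fi] : (\bigcup_i F i) (g v).1 by rewrite -FT.
  have [j _ Gj] : (\bigcup_i G i) (g v).2 by rewrite -GT.
  exists (maxn i j) => //; split.
    by move: Fi; apply/subsetPset/ndF/leq_maxl.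
  by move: Gj; apply/subsetPset/ndG/leq_maxr.
move=> i; have [mFi Fioo] := Foo i; have [mGi Gioo] := Goo i; split.
  by rewrite -[X in measurable X]setTI; apply: mg => //; exact: measurableX.
suff -> : lebesgue_cons (g @^-1` (F i `*` G i))
    = lebesgue_measure (F i) * mu (G i).
  by rewrite lte_mul_pinfty// ge0_fin_numE.
rewrite -product_measure1E// /lebesgue_cons /pushforward.
congr (product_measure1 _ _ _).
rewrite -comp_preimage (_ : g \o @cons_pair n = id) ?preimage_id//.
by apply/funext => x; exact: gK.
Qed.

HB.instance Definition _ := Measure_isSigmaFinite.Build _ _ _ lebesgue_cons
  lebesgue_cons_sigma_finite.

End Succ.

Fixpoint lebesgue_tuple n : {sigma_finite_measure set (n.-tuple R) -> \bar R} :=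
  match n with
  | 0 => \d_[tuple]
  | n'.+1 => lebesgue_cons (lebesgue_tuple n')
  end.

End LebesgueTuple.

Section ComplexValued.
Context {R : realType}.

Definition cexp (z : R[i]) : R[i] :=
  (expR (Rec z))%:C * (cos (Imc z) +i* sin (Imc z)).

Section Calculus.
Context {W : normedModType R}.

Definition derivableC (f : W -> R[i]) (x v : W) :=
  derivable (Rec \o f) x v /\ derivable (Imc \o f) x v.

Definition deriveC (v : W) (f : W -> R[i]) (x : W) : R[i] :=
  'D_v (Rec \o f) x +i* 'D_v (Imc \o f) x.

Definition differentiableC (f : W -> R[i]) (x : W) :=
  differentiable (Rec \o f) x /\ differentiable (Imc \o f) x.

(* C^oo on D (meant for D open in a finite-dimensional W): every iterated
   directional derivative is differentiable at every point of D. *)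
Definition smooth_on (D : set W) (f : W -> R[i]) :=
  forall (vs : seq W) (x : W), D x ->
    differentiable (foldr (fun v g => 'D_v g) (Rec \o f) vs) x /\
    differentiable (foldr (fun v g => 'D_v g) (Imc \o f) vs) x.

End Calculus.

Section Integration.
Context {n : nat}.

Definition L2 (f : n.-tuple R -> R[i]) :=
  [/\ measurable_fun setT (Rec \o f), measurable_fun setT (Imc \o f) &
      (\int[@lebesgue_tuple R n]_q (Rec (f q) ^+ 2 + Imc (f q) ^+ 2)%:E
         < +oo)%E].

Definition integralC (f : n.-tuple R -> R[i]) : R[i] :=
  Rintegral (@lebesgue_tuple R n) setT (Rec \o f)
  +i* Rintegral (@lebesgue_tuple R n) setT (Imc \o f).

End Integration.

Definition dot n (u v : n.-tuple R) : R := \sum_(j < n) tnth u j * tnth v j.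

Definition tuple0 n : n.-tuple R := [tuple 0 | _ < n].

End ComplexValued.

Section Tensors.
Context {R : realType} {W : normedModType R}.

(* (nabla_v phi)(A) = v[phi](A) - (i/2) om(A, v) phi(A) *)
Definition nabla (om : W -> W -> R) (v : W) (phi : W -> R[i]) : W -> R[i] :=
  fun A => deriveC v phi A - (0 +i* (om A v / 2)) * phi A.

Context {n : nat}.

(* A constant bivector with complex coefficients, \sum_ab G_ab e_a (x) e_b in
   a fixed basis e, is given by the matrix G. *)
Definition laplacian (om : W -> W -> R) (e : 'I_n -> W) (G : 'M[R[i]]_n)
    (phi : W -> R[i]) (A : W) : R[i] :=
  \sum_a \sum_b G a b * nabla om (e a) (nabla om (e b) phi) A.

Definition inv_bivector (g : W -> W -> R) (e : 'I_n -> W) : 'M[R]_n :=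
  invmx (\matrix_(a, b) g (e a) (e b)).

(* Matrix of an endomorphism I in the basis with coordinate functions co. *)
Definition endo_mx (e : 'I_n -> W) (co : W -> 'I_n -> R) (I : W -> W)
    : 'M[R]_n :=
  \matrix_(a, b) co (I (e b)) a.

(* Projections (1 -/+ i I)/2 of the complexification onto vectors of type
   (1,0) (I = i) and (0,1) (I = -i) for the complex structure with matrix M;
   the (2,0) and (0,2) parts of a bivector. *)
Definition proj10 (M : 'M[R]_n) : 'M[R[i]]_n :=
  \matrix_(a, b) (((a == b)%:R / 2) +i* (- (M a b / 2))).
Definition proj01 (M : 'M[R]_n) : 'M[R[i]]_n :=
  \matrix_(a, b) (((a == b)%:R / 2) +i* (M a b / 2)).
Definition part20 (M : 'M[R]_n) (G : 'M[R[i]]_n) : 'M[R[i]]_n :=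
  proj10 M *m G *m (proj10 M)^T.
Definition part02 (M : 'M[R]_n) (G : 'M[R[i]]_n) : 'M[R[i]]_n :=
  proj01 M *m G *m (proj01 M)^T.

End Tensors.

(* Teichmueller space: tau = tau_1 + i tau_2 is the pair (tau_1, tau_2). *)
Section Teichmueller.
Context {R : realType}.

Definition teich : set (R * R) := [set tau | 0 < tau.2].

(* Complexified constant tangent vectors c_1 d/dtau_1 + c_2 d/dtau_2. *)
Definition Dtau (V : R[i] * R[i]) (F : R * R -> R[i]) (tau : R * R) : R[i] :=
  V.1 * deriveC ((1, 0) : R * R) F tau + V.2 * deriveC ((0, 1) : R * R) F tau.

Definition d_tau : R[i] * R[i] := (2^-1 +i* 0, 0 +i* (- 2^-1)).
Definition d_taubar : R[i] * R[i] := (2^-1 +i* 0, 0 +i* 2^-1).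

(* The constant 1-form a dx + b dy with values in U is the pair (a, b). *)
Definition hodge {U : lmodType R} (tau : R * R) (A : U * U) : U * U :=
  (tau.2^-1 *: (tau.1 *: A.1 - A.2),
   tau.2^-1 *: ((tau.1 ^+ 2 + tau.2 ^+ 2) *: A.1 - tau.1 *: A.2)).

(* f^* for the linear map (x, y) |-> (f_00 x + f_01 y, f_10 x + f_11 y). *)
Definition pullback {U : zmodType} (f : 'M[int]_2) (A : U * U) : U * U :=
  (A.1 *~ f 0 0 + A.2 *~ f 1 0, A.1 *~ f 0 1 + A.2 *~ f 1 1).

(* The point f.tau, determined by its Hodge star on scalar 1-forms. *)
Definition mcg_act (f : 'M[int]_2) (tau : R * R) : R * R :=
  xget tau [set sigma | teich sigma /\ forall A : R * R,
    hodge (U := R^o) sigma A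
    = pullback (invmx f) (hodge (U := R^o) tau (pullback f A))].

End Teichmueller.

(* The Lie algebra of the maximal torus enters only as a Euclidean space E with
   inner product ip and orthonormal basis T_0, ..., T_(r-1). *)
Definition euclidean_basis (R : realType) (E : normedModType R)
    (ip : {dot E for idfun}) (r : nat) (T : 'I_r -> E) :=
  [/\ forall x, `|x| ^+ 2 = ip x x,
      forall i j, ip (T i) (T j) = (i == j)%:R &
      forall x, exists c : 'I_r -> R, x = \sum_j c j *: T j].

(* E-valued constant forms, and E^C-valued constant forms A + i B as pairs
   (A, B). *)
Notation forms E := (E * E)%type (only parsing).
Notation formsC E := ((E * E) * (E * E))%type (only parsing).

Section Quantisation.
Context {R : realType} {E : normedModType R} (ip : {dot E for idfun}).
Context {r : nat} (T : 'I_r -> E) (k : nat) (s : R).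

Local Notation A0 := (forms E).
Local Notation AC := (formsC E).

Definition level : R[i] := k%:R +i* s.
Definition abs_level : R := Num.sqrt (k%:R ^+ 2 + s ^+ 2).

(* The complex-bilinear extension of ip, on E^C = E + i E. *)
Definition ipC (u v : E * E) : R[i] :=
  (ip u.1 v.1 - ip u.2 v.2) +i* (ip u.1 v.2 + ip u.2 v.1).

(* <A /\ B> is a constant multiple of dx /\ dy, of total mass 1 on Sigma. *)
Definition omega (A B : A0) : R := ip A.1 B.2 - ip A.2 B.1.
Definition omegaC (A B : AC) : R[i] :=
  ipC (A.1.1, A.2.1) (B.1.2, B.2.2) - ipC (A.1.2, A.2.2) (B.1.1, B.2.1).
Definition omega_t (A B : AC) : R := Rec (level * omegaC A B).
Definition omega_t0 (A B : A0) : R := omega_t (A, 0) (B, 0).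

Definition multi (A : AC) : AC := (- A.2, A.1).
Definition hodgeC (tau : R * R) (A : AC) : AC :=
  (hodge tau A.1, - hodge tau A.2).
Definition cplx_K (tau : R * R) (A : AC) : AC := hodgeC tau (multi A).
Definition cplx_I (tau : R * R) (A : AC) : AC :=
  abs_level^-1 *: (k%:R *: hodgeC tau A + s *: cplx_K tau A).

Definition metric (tau : R * R) (A B : A0) : R := omega A (hodge tau B).
Definition metricC (tau : R * R) (A B : AC) : R :=
  abs_level^-1 * omega_t A (cplx_I tau B).

(* tau-independent real bases of the spaces of forms, with coordinates: those
   of A0 are T_j dx, T_j dy; those of AC are these and their i-multiples. *)
Definition basis0 (a : 'I_(r + r)) : A0 :=
  match fintype.split a with inl j => (T j, 0) | inr j => (0, T j) end.
Definition coord0 (A : A0) (a : 'I_(r + r)) : R :=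
  match fintype.split a with inl j => ip A.1 (T j) | inr j => ip A.2 (T j) end.
Definition basisC (a : 'I_((r + r) + (r + r))) : AC :=
  match fintype.split a with
  | inl b => (basis0 b, 0) | inr b => (0, basis0 b)
  end.
Definition coordC (A : AC) (a : 'I_((r + r) + (r + r))) : R :=
  match fintype.split a with
  | inl b => coord0 A.1 b | inr b => coord0 A.2 b
  end.

(* T_j dzeta_tau / sqrt(2 tau_2), where dzeta_tau = dx + tau dy *)
Definition frame_half (tau : R * R) (j : 'I_r) : AC :=
  (Num.sqrt (2 * tau.2))^-1 *:
    ((T j, tau.1 *: T j), (0, tau.2 *: T j)).
Definition frameX (tau : R * R) (j : 'I_(r + r)) : AC :=
  match fintype.split j with
  | inl j' => frame_half tau j' | inr j' => multi (frame_half tau j')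
  end.
Definition frameY (tau : R * R) (j : 'I_(r + r)) : AC :=
  cplx_I tau (frameX tau j).

Local Notation tup := ((r + r).-tuple R).

Definition ptP (tau : R * R) (p : tup) : AC := \sum_j tnth p j *: frameX tau j.
Definition ptQ (tau : R * R) (q : tup) : AC := \sum_j tnth q j *: frameY tau j.

(* The coordinates (p, q) of A in the real basis (X_j), (Y_j) *)
Definition coords (tau : R * R) (A : AC) : tup * tup :=
  xget (tuple0 _, tuple0 _)
    [set pq | A = ptP tau pq.1 + ptQ tau pq.2].

(* V acting in tau with (p, q) held fixed *)
Definition delta (V : R[i] * R[i]) (psi : R * R -> AC -> R[i]) (tau : R * R)
    (A : AC) : R[i] :=
  let pq := coords tau A in
  Dtau V (fun sigma => psi sigma (ptP sigma pq.1 + ptQ sigma pq.2)) tau.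

Definition polarised (tau : R * R) (phi : AC -> R[i]) :=
  forall A p, phi (A + ptP tau p) = phi A.

Definition polarised_section (tau : R * R) (phi : AC -> R[i]) :=
  forall A p, derivableC phi A (ptP tau p) /\
    nabla omega_t (ptP tau p) phi A = 0.

Definition rho (tau : R * R) (A : AC) : R[i] :=
  let pq := coords tau A in
  cexp (0 +i* (- (abs_level / 2 * dot pq.1 pq.2))).

Definition Ext (tau : R * R) (eta : A0 -> R[i]) : AC -> R[i] :=
  xget (fun=> 0) [set phi | polarised_section tau phi /\
    forall A : A0, phi (A, 0) = eta A].

(* Functions on Q_tau are given by functions on all of AC; only the restriction
   to Q_tau matters in L2Q and bargmann. *)
Definition L2Q (tau : R * R) (phi : AC -> R[i]) :=
  L2 (fun q => phi (ptQ tau q)).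

Definition bargmann_kernel (q' : tup) (pq : tup * tup) : R[i] :=
  ((abs_level ^+ 3 / (4 * pi ^+ 3)) `^ (r%:R / 2))%:C *
  cexp (- (abs_level / 2 *
           \sum_j (tnth pq.2 j - tnth q' j) ^+ 2)
        +i* - (abs_level / 2 *
           \sum_j tnth pq.1 j * (2 * tnth q' j - tnth pq.2 j))).

Definition bargmann (tau : R * R) (psi : AC -> R[i]) (A : AC) : R[i] :=
  integralC (fun q' => psi (ptQ tau q') * bargmann_kernel q' (coords tau A)).

(* inl j is multiplication by q_j, inr j is d/dq_j *)
Definition ladder (tau : R * R) (o : 'I_(r + r) + 'I_(r + r))
    (phi : AC -> R[i]) : AC -> R[i] :=
  match o with
  | inl j => fun A => (tnth (coords tau A).2 j)%:C * phi A
  | inr j => deriveC (frameY tau j) phi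
  end.

(* -V[g~] for the inverse bivector g~ of g *)
Definition variation {W : normedModType R} {n : nat} (V : R[i] * R[i])
    (g : R * R -> W -> W -> R) (e : 'I_n -> W) (tau : R * R) : 'M[R[i]]_n :=
  \matrix_(a, b)
    - Dtau V (fun sigma => (inv_bivector (g sigma) e a b)%:C) tau.

Definition HW_G (V : R[i] * R[i]) (tau : R * R) : 'M[R[i]]_(r + r) :=
  part20 (endo_mx basis0 coord0 (hodge tau)) (variation V metric basis0 tau).
Definition HW_Gbar (V : R[i] * R[i]) (tau : R * R) : 'M[R[i]]_(r + r) :=
  part02 (endo_mx basis0 coord0 (hodge tau)) (variation V metric basis0 tau).
Definition hitchin_GC (V : R[i] * R[i]) (tau : R * R)
    : 'M[R[i]]_((r + r) + (r + r)) :=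
  part20 (endo_mx basisC coordC (cplx_I tau)) (variation V metricC basisC tau).

Definition hitchin_witten (V : R[i] * R[i]) (eta : R * R -> A0 -> R[i])
    (tau : R * R) (A : A0) : R[i] :=
  Dtau V (fun sigma => eta sigma A) tau
  - 2^-1 * ((level^*)^-1 * laplacian omega_t0 basis0 (HW_Gbar V tau) (eta tau) A
            - level^-1 * laplacian omega_t0 basis0 (HW_G V tau) (eta tau) A).

Definition hitchin_complexified (V : R[i] * R[i]) (phi : R * R -> AC -> R[i])
    (tau : R * R) (A : AC) : R[i] :=
  Dtau V (fun sigma => phi sigma A) tau
  + ((4 * abs_level)^-1)%:C
    * laplacian omega_t basisC (hitchin_GC V tau) (phi tau) A.

End Quantisation.

(* f^* on E^C-valued forms, and the induced action on functions *)
Definition pullbackC {R : realType} {E : normedModType R} (f : 'M[int]_2)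
    (A : formsC E) : formsC E := (pullback f A.1, pullback f A.2).

Definition act_fun {R : realType} {E : normedModType R} (f : 'M[int]_2)
    (phi : formsC E -> R[i]) : formsC E -> R[i] :=
  fun A => phi (pullbackC f A).

(* Submission.v *)
(** Put eta = 1 for d/dtau, eta = -1 for d/dtaubar, and t_eta = k + i eta s.  In
    the basis dx, dy the inverse metric on A_0 varies by -V[g~] = c v (x) v with
    v = (1, tau_1 - i eta tau_2) of pure type.  On the Hitchin-Witten side the
    section psi rho and its derivatives are determined by the q-coordinates, and
    its covariant derivative at the real point with coordinates q is rho times
      delta psi + (4 tau_2)^-1 sum_j [q_j d_j' - q_j' d_j
        + (i t_eta / 2) (kappa^-2 (d_j + i eta d_j')^2 + (q_j + i eta q_j')^2)] psi
    with j' = j + r and kappa = |t|; since rho is the polarised frame equal to 1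
    on Q_tau, the extension to Q_tau just drops the factor rho.  On the
    complexified side, differentiating the Gaussian kernel under the integral
    expresses the connection term through the moments of psi against the kernel,
    and integrating the displayed expression by parts gives the same moments.

    For f = (a b; c d) in SL(2, Z), f^* multiplies p_j + i p_j' and q_j + i q_j'
    by the same phase |d - c tau| / (d - c tau).  Such a rotation preserves the
    kernel, and Lebesgue measure because it is a product of shears. *)

Require Import Defs.
From HB Require Import structures.
From mathcomp Require Import all_boot all_order all_algebra.
From mathcomp Require Import sesquilinear.
From mathcomp Require Import complex.
From mathcomp Require Import all_classical all_reals all_analysis.
From mathcomp Require Import measurable_realfun.
From mathcomp Require Import ring lra.
Import Order.TTheory GRing.Theory Num.Theory.
Import numFieldNormedType.Exports.
Set Implicit Arguments.
Unset Strict Implicit.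
Unset Printing Implicit Defensive.
Local Open Scope classical_set_scope.
Local Open Scope ring_scope.
Local Open Scope complex_scope.
Local Notation Rec := (@complex.Re _).
Local Notation Imc := (@complex.Im _).

(** Each Laplacian reduces to the square of one complex direction. On A_0 this is v. On A_0^C the
    (1,0)-projection of I_{tau,t}, restricted to the range of the variation, is a 2 by 2 projection
    of rank one, w w^T / (2 |t| (|t| + k)), so the direction is w (x) v. In both cases the
    coordinates at j and j + r are in the ratio 1 : i eta, which is a null vector; this kills the
    terms produced by differentiating coefficients. The factor t_eta has two origins: on A_0 the
    squared q-coordinate of v carries t_eta^2, and the connection divides by t_eta; on A_0^C it
    comes from (|t| + t)^2 = 2 (|t| + k) t. The analysis rests on square integrability alone.
    Boundary terms in the integrations by parts vanish because an integrable function takes small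
    values arbitrarily far out, and differentiation under the integral is dominated by squares:
    |Re(z w)| is at most (|z|^2 + |w|^2) / 2, where the kernel is bounded by a Gaussian of half the
    exponent. Since [coords], [Ext] and [mcg_act] are defined by choice, each is identified through
    an explicit witness together with a uniqueness argument. *)

Lemma complex_ext (R : rcfType) (z w : R[i]) :
  complex.Re z = complex.Re w -> complex.Im z = complex.Im w -> z = w.
Proof. by case: z w => [? ?] [? ?] /= -> ->. Qed.

(** * Integration over R^n *)

Section TupleIntegral.
Context {R : realType}.
Local Notation mu := (@lebesgue_measure R).
Local Notation lam := (@lebesgue_tuple R).
Local Open Scope ereal_scope.

Lemma ge0_integral_lebesgue_cons n (f : n.+1.-tuple R -> \bar R) :
  measurable_fun [set: n.+1.-tuple R] f -> (forall q, 0 <= f q) ->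
  \int[lam n.+1]_q f q = \int[mu \x lam n]_z f (cons_pair z).
Proof.
move=> mf f0 /=; rewrite ge0_integral_pushforward//.
exact: measurable_cons_pair.
Qed.

Lemma ge0_integral_consE n (f : n.+1.-tuple R -> \bar R) :
  measurable_fun [set: n.+1.-tuple R] f -> (forall q, 0 <= f q) ->
  \int[lam n.+1]_q f q = \int[mu]_x \int[lam n]_v f (cons_pair (x, v)).
Proof.
move=> mf f0; rewrite ge0_integral_lebesgue_cons//.
have H := @fubini_tonelli1 _ _ _ _ _ mu (lam n) (fun z => f (cons_pair z)).
by apply: H => //; apply: measurableT_comp mf (measurable_cons_pair (n := n)).
Qed.

Lemma ge0_integral_consC n (f : n.+1.-tuple R -> \bar R) :
  measurable_fun [set: n.+1.-tuple R] f -> (forall q, 0 <= f q) ->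
  \int[lam n.+1]_q f q = \int[lam n]_v \int[mu]_x f (cons_pair (x, v)).
Proof.
move=> mf f0; rewrite ge0_integral_consE//.
have H := @fubini_tonelli _ _ _ _ _ mu (lam n) (fun z => f (cons_pair z)).
by apply: H => //; apply: measurableT_comp mf (measurable_cons_pair (n := n)).
Qed.

Lemma integrable_cons n (f : n.+1.-tuple R -> \bar R) :
  (lam n.+1).-integrable setT f ->
  (mu \x lam n).-integrable setT (fun z => f (cons_pair z)).
Proof.
move=> /integrableP[mf foo]; apply/integrableP; split.
  by apply: measurableT_comp => //; exact: measurable_cons_pair.
by rewrite -(ge0_integral_lebesgue_cons (f := fun q => `|f q|))//;
  exact: measurableT_comp.
Qed.

Lemma integral_lebesgue_cons n (f : n.+1.-tuple R -> \bar R) :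
  (lam n.+1).-integrable setT f ->
  \int[lam n.+1]_q f q = \int[mu \x lam n]_z f (cons_pair z).
Proof.
move=> fi; have mf := measurable_int _ fi; have fi' := integrable_cons fi.
by rewrite /= integral_pushforward//; exact: measurable_cons_pair.
Qed.

Lemma measurable_shift (c : R) :
  measurable_fun [set: R] (fun x : R => (x + c)%R : measurableTypeR R).
Proof. exact: measurable_funD. Qed.

Lemma lebesgue_measure_shift (c : R) (A : set R) : measurable A ->
  pushforward mu (fun x : R => (x + c)%R : measurableTypeR R) A = mu A.
Proof.
move=> mA.
apply/esym; apply: lebesgue_measure_unique => //=; first exact: measurable_shift.
move=> msh _ [[a b]] _ <-.
rewrite /pushforward /=.
rewrite (_ : _ @^-1` _ = `](a - c)%R, (b - c)%R]%classic); last first.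
  by apply/seteqP; split=> x /=; rewrite !in_itv/= ltrBlDr lerBrDr.
rewrite !lebesgue_measure_itv/= !lte_fin ltrD2r; case: ifP => // _.
by rewrite -!EFinB; congr EFin; lra.
Qed.

Lemma ge0_integral_shift (c : R) (f : R -> \bar R) :
  measurable_fun [set: R] f -> (forall x, 0 <= f x) ->
  \int[mu]_x f (x + c)%R = \int[mu]_x f x.
Proof.
move=> mf f0.
transitivity (\int[pushforward mu
    (fun x : R => (x + c)%R : measurableTypeR R)]_x f x).
  rewrite ge0_integral_pushforward//; exact: measurable_shift.
apply: eq_measure_integral => //=; first exact: measurable_shift.
by move=> msh A mA _; exact: lebesgue_measure_shift.
Qed.
End TupleIntegral.

(** * Invariance of Lebesgue measure under shears *)

Section Shear.
Context {R : realType}.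
Local Notation mu := (@lebesgue_measure R).
Local Notation lam := (@lebesgue_tuple R).
Local Open Scope ereal_scope.

(** The maps [upd q i] parametrise the lines parallel to the i-th axis; shears and partial
    derivatives on R^n are both expressed through them. *)
Definition upd n (q : n.-tuple R) (i : 'I_n) (x : R) : n.-tuple R :=
  [tuple if j == i then x else tnth q j | j < n].

Lemma tnth_upd n (q : n.-tuple R) i x j :
  tnth (upd q i x) j = if j == i then x else tnth q j.
Proof. by rewrite tnth_mktuple. Qed.

Lemma tnth_cons_pairS n (z : R * n.-tuple R) i :
  tnth (cons_pair z) (lift ord0 i) = tnth z.2 i.
Proof. exact: tnthS. Qed.

Lemma upd_cons0 n (z : R * n.-tuple R) y :
  upd (cons_pair z) ord0 y = cons_pair (y, z.2).
Proof.
apply: eq_from_tnth => j; rewrite tnth_upd.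
by case: (unliftP ord0 j) => [k|] -> //=; rewrite !tnth_cons_pairS.
Qed.

Lemma upd_consS n (z : R * n.-tuple R) i y :
  upd (cons_pair z) (lift ord0 i) y = cons_pair (z.1, upd z.2 i y).
Proof.
apply: eq_from_tnth => j; rewrite tnth_upd.
case: (unliftP ord0 j) => [k|] -> //=.
by rewrite !tnth_cons_pairS tnth_upd (inj_eq lift_inj).
Qed.

Lemma measurable_upd n (i : 'I_n) (g : n.-tuple R -> R) :
  measurable_fun [set: n.-tuple R] g ->
  measurable_fun [set: n.-tuple R] (fun q : n.-tuple R => upd q i (g q)).
Proof.
move=> mg; apply/measurable_fun_tnthP => j.
rewrite (_ : _ \o _ = fun q => if j == i then g q else tnth q j); last first.
  by apply/funext => q /=; rewrite tnth_upd.
by case: eqP => // _; exact: measurable_tnth.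
Qed.

Lemma measurable_cons_pair1 n (x : R) :
  measurable_fun [set: n.-tuple R] (fun v : n.-tuple R => cons_pair (x, v)).
Proof.
by apply: (measurable_cons (f := fun=> x) (g := id)) => //; exact: measurable_cst.
Qed.

Lemma measurable_cons_pair2 n (v : n.-tuple R) :
  measurable_fun [set: R] (fun x : R => cons_pair (x, v)).
Proof.
by apply: (measurable_cons (f := id) (g := fun=> v)) => //; exact: measurable_cst.
Qed.

Lemma measurable_comp_cons1 d (U : measurableType d) n (x : R)
    (f : n.+1.-tuple R -> U) :
  measurable_fun [set: n.+1.-tuple R] f ->
  measurable_fun [set: n.-tuple R] (fun v : n.-tuple R => f (cons_pair (x, v))).
Proof. by move=> mf; apply: (measurableT_comp mf); exact: measurable_cons_pair1. Qed.

Lemma measurable_comp_cons2 d (U : measurableType d) n (v : n.-tuple R)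
    (f : n.+1.-tuple R -> U) :
  measurable_fun [set: n.+1.-tuple R] f ->
  measurable_fun [set: R] (fun x : R => f (cons_pair (x, v))).
Proof. by move=> mf; apply: (measurableT_comp mf); exact: measurable_cons_pair2. Qed.

(** On each line parallel to the i-th axis [h] is constant, so the shear acts there as a
    translation. The induction peels off first coordinates until the sheared one comes first;
    Tonelli then integrates it innermost. *)
Lemma ge0_integral_shear n (i : 'I_n) (h : n.-tuple R -> R)
    (f : n.-tuple R -> \bar R) :
  measurable_fun [set: n.-tuple R] h -> (forall q y, h (upd q i y) = h q) ->
  measurable_fun [set: n.-tuple R] f -> (forall q, 0 <= f q) ->
  \int[lam n]_q f (upd q i (tnth q i + h q)%R) = \int[lam n]_q f q.
Proof.
elim: n i h f => [[]//|n IH] i h f mh hi mf f0.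
have mg : measurable_fun [set: n.+1.-tuple R]
    (fun q : n.+1.-tuple R => f (upd q i (tnth q i + h q)%R)).
  apply: (measurableT_comp mf); apply: measurable_upd.
  by apply: measurable_funD => //; exact: measurable_tnth.
case: (unliftP ord0 i) => [j|] ij; subst i; last first.
  rewrite !ge0_integral_consC//; apply: eq_integral => v _.
  (* The value 0 is arbitrary: by [hi], [h] is constant in this coordinate. *)
  pose c := h (cons_pair (0%R, v)).
  rewrite -[RHS](ge0_integral_shift c (f := fun x => f (cons_pair (x, v))))//;
    last exact: (measurable_comp_cons2 v mf).
  apply: eq_integral => x _; rewrite upd_cons0; congr (f (cons_pair (_, _))).
  by rewrite /c -(hi (cons_pair (x, v)) 0%R) upd_cons0.
rewrite !ge0_integral_consE//; apply: eq_integral => x _.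
rewrite -[RHS](IH j (fun v => h (cons_pair (x, v)))) //.
- by apply: eq_integral => v _; rewrite tnth_cons_pairS upd_consS.
- exact: (measurable_comp_cons1 x mh).
- by move=> v y; rewrite -(hi (cons_pair (x, v)) y) upd_consS.
- exact: (measurable_comp_cons1 x mf).
Qed.
End Shear.

Section Preserving.
Context {R : realType} {n : nat}.
Local Notation lam := (@lebesgue_tuple R n).
Local Notation tup := (n.-tuple R).

(** Stated through integrals of nonnegative functions, the form in which shears provide it and in
    which it composes; signed integrals follow by splitting into positive and negative parts. *)
Definition preserving (F : tup -> tup) :=
  measurable_fun [set: tup] F /\
  forall f : tup -> \bar R, measurable_fun [set: tup] f ->
    (forall q, 0 <= f q)%E -> (\int[lam]_q f (F q) = \int[lam]_q f q)%E.

Lemma preserving_comp F G : preserving F -> preserving G -> preserving (F \o G).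
Proof.
move=> [mF HF] [mG HG]; split; first exact: measurableT_comp.
move=> f mf f0; rewrite -(HF f)//.
by rewrite -(HG (fun q => f (F q)))//; exact: (measurableT_comp mf mF).
Qed.

Lemma preserving_id : preserving id.
Proof. by split => //; exact: measurable_id. Qed.

Lemma preserving_shear (i : 'I_n) (h : tup -> R) :
  measurable_fun [set: tup] h -> (forall q y, h (upd q i y) = h q) ->
  preserving (fun q => upd q i (tnth q i + h q)).
Proof.
move=> mh hi; split; last by move=> f mf f0; exact: ge0_integral_shear.
by apply: measurable_upd; apply: measurable_funD => //; exact: measurable_tnth.
Qed.

Lemma preserving_integral F (f : tup -> R) : preserving F ->
  measurable_fun [set: tup] f ->
  (\int[lam]_q (f (F q))%:E = \int[lam]_q (f q)%:E)%E.
Proof.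
move=> [mF HF] mf; rewrite integralE [RHS]integralE.
have mf' : measurable_fun [set: tup] (EFin \o f) by exact/measurable_EFinP.
have Hp := HF (EFin \o f)^\+%E (measurable_funepos mf') (fun q => funepos_ge0 _ q).
have Hn := HF (EFin \o f)^\-%E (measurable_funeneg mf') (fun q => funeneg_ge0 _ q).
rewrite -[in RHS]/(EFin \o f) -Hp -Hn; congr (_ - _)%E.
- by apply: eq_integral => q _; rewrite !funeposE.
- by apply: eq_integral => q _; rewrite !funenegE.
Qed.

Lemma preserving_integralC F (f : tup -> R[i]) : preserving F ->
  measurable_fun setT (Rec \o f) -> measurable_fun setT (Imc \o f) ->
  integralC (fun q => f (F q)) = integralC f.
Proof.
move=> pF mR mI; rewrite /integralC /Rintegral /=.
rewrite (preserving_integral (f := fun q => Rec (f q)))//.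
by rewrite (preserving_integral (f := fun q => Imc (f q))).
Qed.

Lemma preserving_L2 F (f : tup -> R[i]) : preserving F -> L2 f ->
  L2 (fun q => f (F q)).
Proof.
move=> pF; have [mF HF] := pF; move=> [mR mI foo]; split.
- exact: (measurableT_comp mR mF).
- exact: (measurableT_comp mI mF).
rewrite (preserving_integral (f := fun q => Rec (f q) ^+ 2 + Imc (f q) ^+ 2))//.
by apply: measurable_funD; apply: measurable_funX.
Qed.

End Preserving.

(** * Rotations of the pairs of coordinates (j, j + r) *)

Section Rotation.
Context {R : realType} {r : nat}.
Local Notation tup := ((r + r).-tuple R).

Section MultiShear.
Variables (t u : 'I_r -> 'I_(r + r)) (a : R).
Hypotheses (tI : injective t) (tu : forall j k, t j != u k).

Definition multi_shear (l : seq 'I_r) (q : tup) : tup :=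
  foldr (fun j q => upd q (t j) (tnth q (t j) + a * tnth q (u j))) q l.

Lemma preserving_multi_shear l : preserving (multi_shear l).
Proof.
elim: l => [|j l IH]; first exact: preserving_id.
apply: (preserving_comp (F := fun q => upd q (t j) (tnth q (t j) + a * tnth q (u j))) _ IH).
apply: preserving_shear.
  by apply: measurable_funM => //; exact: measurable_tnth.
by move=> q y; rewrite tnth_upd eq_sym (negbTE (tu _ _)).
Qed.

Lemma tnth_multi_shear_u l q k : tnth (multi_shear l q) (u k) = tnth q (u k).
Proof.
by elim: l => //= j l IH; rewrite tnth_upd eq_sym (negbTE (tu _ _)).
Qed.

Lemma tnth_multi_shear_t l q k : uniq l -> tnth (multi_shear l q) (t k) =
  tnth q (t k) + (if k \in l then a * tnth q (u k) else 0).
Proof.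
elim: l => [|j l IH] /=; first by rewrite addr0.
move=> /andP[jl /IH {}IH]; rewrite tnth_upd in_cons (inj_eq tI).
by case: eqVneq => [kj|//] /=; rewrite -kj IH kj (negbTE jl) addr0
  tnth_multi_shear_u.
Qed.
End MultiShear.

Definition rotation (c s : R) (q : tup) : tup :=
  [tuple match fintype.split i with
         | inl j => c * tnth q (lshift r j) - s * tnth q (rshift r j)
         | inr j => s * tnth q (lshift r j) + c * tnth q (rshift r j)
         end | i < r + r].

Lemma tnth_rotation_l c s q j : tnth (rotation c s q) (lshift r j) =
  c * tnth q (lshift r j) - s * tnth q (rshift r j).
Proof. by rewrite tnth_mktuple -[lshift r j]/(unsplit (inl j)) unsplitK. Qed.

Lemma tnth_rotation_r c s q j : tnth (rotation c s q) (rshift r j) =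
  s * tnth q (lshift r j) + c * tnth q (rshift r j).
Proof. by rewrite tnth_mktuple -[rshift r j]/(unsplit (inr j)) unsplitK. Qed.

Lemma eq_tuple_split (p q : tup) :
  (forall j, tnth p (lshift r j) = tnth q (lshift r j)) ->
  (forall j, tnth p (rshift r j) = tnth q (rshift r j)) -> p = q.
Proof.
by move=> pl pr; apply: eq_from_tnth => i; rewrite -(splitK i); case: fintype.split.
Qed.

(* For s != 0 a rotation is a product of three shears. *)
Lemma preserving_rotation_neq0 c s : c ^+ 2 + s ^+ 2 = 1 -> s != 0 ->
  preserving (rotation c s).
Proof.
(* For the angle theta this is -tan(theta/2). The factors are (1 a; 0 1), (1 0; s 1), (1 a; 0 1),
   each applied to all pairs (j, j + r) at once. *)
move=> cs s0; pose a := (c - 1) / s.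
have lr (j k : 'I_r) : lshift r j != rshift r k by rewrite eq_lrshift.
have rl (j k : 'I_r) : rshift r j != lshift r k by rewrite eq_rlshift.
have p1 := preserving_multi_shear a lr (enum 'I_r).
have p2 := preserving_multi_shear s rl (enum 'I_r).
have as1 : a * s = c - 1 by rewrite /a divfK.
have ac : a * (c + 1) = - s.
  apply: (mulIf s0); rewrite mulrAC as1; transitivity (c ^+ 2 - 1); first ring.
  by rewrite -cs; ring.
have := preserving_comp p1 (preserving_comp p2 p1).
congr preserving; apply/funext => q /=; apply: eq_tuple_split => j.
- rewrite tnth_rotation_l !(tnth_multi_shear_t, tnth_multi_shear_u,
    mem_enum, enum_uniq, inE)//=; try exact: lshift_inj; try exact: rshift_inj.
  transitivity ((a * s + 1) * tnth q (lshift r j)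
    + (a * s * a + a + a) * tnth q (rshift r j)); first ring.
  have -> : a * s * a + a + a = - s by rewrite -ac as1; ring.
  by rewrite as1; ring.
- rewrite tnth_rotation_r !(tnth_multi_shear_t, tnth_multi_shear_u,
    mem_enum, enum_uniq, inE)//=; try exact: lshift_inj; try exact: rshift_inj.
  transitivity (s * tnth q (lshift r j)
    + (a * s + 1) * tnth q (rshift r j)); first ring.
  by rewrite as1; ring.
Qed.

Lemma preserving_rotation c s : c ^+ 2 + s ^+ 2 = 1 ->
  preserving (rotation c s).
Proof.
have [->|s0] := eqVneq s 0 => cs; last exact: preserving_rotation_neq0.
have /orP[/eqP->|/eqP->] : (c == 1) || (c == -1).
- by rewrite -eqf_sqr expr1n -cs expr0n addr0.
- rewrite (_ : rotation 1 0 = id); first exact: preserving_id.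
  apply/funext => q; apply: eq_tuple_split => j.
    by rewrite tnth_rotation_l; ring.
  by rewrite tnth_rotation_r; ring.
(* The half turn has s = 0, so it is obtained as the square of the quarter turn. *)
- have p : preserving (rotation 0 1).
    by apply: preserving_rotation_neq0; rewrite ?oner_neq0//; ring.
  rewrite (_ : rotation (-1) 0 = rotation 0 1 \o rotation 0 1).
    exact: preserving_comp.
  apply/funext => q; apply: eq_tuple_split => j /=.
    by rewrite !(tnth_rotation_l, tnth_rotation_r); ring.
  by rewrite !(tnth_rotation_l, tnth_rotation_r); ring.
Qed.
End Rotation.

(** * Complex-valued integrals and square-integrable functions *)

Section IntegralC.
Context {R : realType} {n : nat}.
Local Notation lam := (@lebesgue_tuple R n).
Local Notation tup := (n.-tuple R).
Implicit Types f g : tup -> R[i].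

Definition measurableC f :=
  measurable_fun [set: tup] (Rec \o f) /\ measurable_fun [set: tup] (Imc \o f).

Definition integrableC f :=
  lam.-integrable [set: tup] (EFin \o (Rec \o f)) /\
  lam.-integrable [set: tup] (EFin \o (Imc \o f)).

Lemma integrableC_add f g : integrableC f -> integrableC g ->
  integrableC (fun q => f q + g q).
Proof.
move=> [fR fI] [gR gI]; split.
- rewrite (_ : _ \o _ = (fun q => (Rec (f q))%:E + (Rec (g q))%:E)%E).
    exact: integrableD.
  by apply/funext => q /=; case: (f q) (g q) => [? ?] [? ?].
- rewrite (_ : _ \o _ = (fun q => (Imc (f q))%:E + (Imc (g q))%:E)%E).
    exact: integrableD.
  by apply/funext => q /=; case: (f q) (g q) => [? ?] [? ?].
Qed.

Lemma integralC_add f g : integrableC f -> integrableC g ->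
  integralC (fun q => f q + g q) = integralC f + integralC g.
Proof.
move=> [fR fI] [gR gI]; rewrite /integralC.
apply: complex_ext => /=.
- by rewrite -RintegralD//; apply: eq_Rintegral => q _ /=;
    case: (f q) (g q) => [? ?] [? ?].
- by rewrite -RintegralD//; apply: eq_Rintegral => q _ /=;
    case: (f q) (g q) => [? ?] [? ?].
Qed.

Lemma integrable_lin (u v : tup -> R) (a b : R) :
  lam.-integrable [set: tup] (EFin \o u) ->
  lam.-integrable [set: tup] (EFin \o v) ->
  lam.-integrable [set: tup] (EFin \o (fun q => a * u q + b * v q)).
Proof.
move=> iu iv.
rewrite (_ : _ \o _ = (fun q => a%:E * (u q)%:E + b%:E * (v q)%:E)%E).
  by apply: integrableD => //; apply: integrableZl.
by apply/funext => q /=; rewrite EFinD !EFinM.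
Qed.

Lemma Rintegral_lin (u v : tup -> R) (a b : R) :
  lam.-integrable [set: tup] (EFin \o u) ->
  lam.-integrable [set: tup] (EFin \o v) ->
  Rintegral lam setT (fun q => a * u q + b * v q) =
  a * Rintegral lam setT u + b * Rintegral lam setT v.
Proof.
move=> iu iv; rewrite RintegralD//; last 2 first.
- by rewrite (_ : _ \o _ = (fun q => a%:E * (u q)%:E)%E)//; exact: integrableZl.
- by rewrite (_ : _ \o _ = (fun q => b%:E * (v q)%:E)%E)//; exact: integrableZl.
by rewrite !RintegralZl.
Qed.

Lemma integralC_scale (c : R[i]) f : integrableC f ->
  integralC (fun q => c * f q) = c * integralC f.
Proof.
move=> [fR fI]; case: c => a b; rewrite /integralC.
apply: complex_ext => /=.
- rewrite -mulNr -Rintegral_lin//; apply: eq_Rintegral => q _ /=.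
  by case: (f q) => [x y] /=; rewrite mulNr.
- rewrite -Rintegral_lin//; apply: eq_Rintegral => q _ /=.
  by case: (f q) => [x y].
Qed.

Lemma integrableC0 : integrableC (fun=> 0).
Proof. by split; exact: integrable0. Qed.

Lemma integralC0 : integralC (fun _ : tup => 0) = 0 :> R[i].
Proof.
have := integralC_scale 0 integrableC0.
by rewrite !mul0r.
Qed.

Lemma integrableC_sum (I : Type) (s : seq I) (F : I -> tup -> R[i]) :
  (forall i, integrableC (F i)) -> integrableC (fun q => \sum_(i <- s) F i q).
Proof.
move=> iF; elim: s => [|i s IH].
  by under eq_fun do rewrite big_nil; exact: integrableC0.
by under eq_fun do rewrite big_cons; exact: integrableC_add.
Qed.

Lemma integralC_sum (I : Type) (s : seq I) (F : I -> tup -> R[i]) :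
  (forall i, integrableC (F i)) ->
  integralC (fun q => \sum_(i <- s) F i q) = \sum_(i <- s) integralC (F i).
Proof.
move=> iF; elim: s => [|i s IH].
  by under eq_fun do rewrite big_nil; rewrite big_nil integralC0.
under eq_fun do rewrite big_cons.
by rewrite big_cons integralC_add ?IH//; exact: integrableC_sum.
Qed.

Lemma measurableC_mul f g : measurableC f -> measurableC g ->
  measurableC (fun q => f q * g q).
Proof.
move=> [fR fI] [gR gI]; split.
- rewrite (_ : _ \o _ = fun q => Rec (f q) * Rec (g q) - Imc (f q) * Imc (g q)).
    by apply: measurable_funB; apply: measurable_funM.
  by apply/funext => q /=; case: (f q) (g q) => [? ?] [? ?].
- rewrite (_ : _ \o _ = fun q => Rec (f q) * Imc (g q) + Imc (f q) * Rec (g q)).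
    by apply: measurable_funD; apply: measurable_funM.
  by apply/funext => q /=; case: (f q) (g q) => [? ?] [? ?].
Qed.

Lemma measurableC_add f g : measurableC f -> measurableC g ->
  measurableC (fun q => f q + g q).
Proof.
move=> [fR fI] [gR gI]; split.
- rewrite (_ : _ \o _ = fun q => Rec (f q) + Rec (g q)).
    exact: measurable_funD.
  by apply/funext => q /=; case: (f q) (g q) => [? ?] [? ?].
- rewrite (_ : _ \o _ = fun q => Imc (f q) + Imc (g q)).
    exact: measurable_funD.
  by apply/funext => q /=; case: (f q) (g q) => [? ?] [? ?].
Qed.

Lemma measurableC_cst (c : R[i]) : measurableC (fun=> c).
Proof. by split; exact: measurable_cst. Qed.

Definition abs2 (z : R[i]) : R := Rec z ^+ 2 + Imc z ^+ 2.

Lemma abs2_ge0 z : 0 <= abs2 z.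
Proof. by rewrite addr_ge0// sqr_ge0. Qed.

Lemma abs2M z w : abs2 (z * w) = abs2 z * abs2 w.
Proof. by case: z w => [a b] [c d]; rewrite /abs2 /=; ring. Qed.

Lemma L2P f : L2 f <-> measurableC f /\ lam.-integrable [set: tup] (EFin \o (abs2 \o f)).
Proof.
split=> [[mR mI foo]|[[mR mI] /integrableP[_ foo]]].
  split => //; apply/integrableP; split.
    apply/measurable_EFinP; rewrite /abs2.
    by apply: measurable_funD; apply: measurable_funX.
  under eq_integral do rewrite /= ger0_norm ?abs2_ge0//.
  exact: foo.
split=> //.
by under eq_integral do rewrite /= -[X in X%:E]ger0_norm ?abs2_ge0//.
Qed.

Lemma L2_add f g : L2 f -> L2 g -> L2 (fun q => f q + g q).
Proof.
move=> /L2P[mf fi] /L2P[mg gi]; apply/L2P; split; first exact: measurableC_add.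
have [sR sI] := measurableC_add mf mg.
have i2 := integrable_lin 2 2 fi gi; apply: (le_integrable measurableT _ _ i2).
  apply/measurable_EFinP; rewrite /abs2.
  by apply: measurable_funD; apply: measurable_funX.
move=> q _ /=; rewrite lee_fin [leLHS]ger0_norm ?abs2_ge0// [leRHS]ger0_norm; last first.
  by rewrite addr_ge0// mulr_ge0 ?ler0n ?abs2_ge0.
case: (f q) (g q) => [a b] [c d]; rewrite /abs2 /=.
rewrite -subr_ge0 (_ : _ - _ = (a - c) ^+ 2 + (b - d) ^+ 2); last ring.
by rewrite addr_ge0// sqr_ge0.
Qed.

Lemma L2_scale (c : R[i]) f : L2 f -> L2 (fun q => c * f q).
Proof.
move=> /L2P[mf fi]; apply/L2P; split.
  by apply: measurableC_mul => //; exact: measurableC_cst.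
rewrite (_ : _ \o _ = EFin \o (fun q => abs2 c * abs2 (f q) + 0 * abs2 (f q))).
  exact: integrable_lin.
by apply/funext => q /=; rewrite abs2M mul0r addr0.
Qed.

Lemma L20 : L2 (fun _ : tup => 0 : R[i]).
Proof.
apply/L2P; split; first exact: measurableC_cst.
by rewrite (_ : _ \o _ = cst 0%E) ?integrable0//; apply/funext => q; rewrite /= /abs2 /= expr0n addr0.
Qed.

Lemma L2_sum (I : Type) (s : seq I) (F : I -> tup -> R[i]) :
  (forall i, L2 (F i)) -> L2 (fun q => \sum_(i <- s) F i q).
Proof.
move=> iF; elim: s => [|i s IH].
  by under eq_fun do rewrite big_nil; exact: L20.
by under eq_fun do rewrite big_cons; exact: L2_add.
Qed.

(** Real and imaginary part of the product are dominated by |f|^2 + |g|^2. *)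
Lemma L2_mul_integrable f g : L2 f -> L2 g -> integrableC (fun q => f q * g q).
Proof.
move=> /L2P[mf fi] /L2P[mg gi]; have [mR mI] := measurableC_mul mf mg.
have i2 := integrable_lin 1 1 fi gi.
split; apply: (le_integrable measurableT _ _ i2).
- exact/measurable_EFinP.
- move=> q _ /=; rewrite lee_fin [leRHS]ger0_norm ?addr_ge0 ?mul1r ?abs2_ge0//.
  case: (f q) (g q) => [a b] [c d]; rewrite /abs2 /= ler_norml.
  apply/andP; split; rewrite -subr_ge0.
    rewrite (_ : _ - _ = ((a + c) ^+ 2 + (b - d) ^+ 2
      + (a ^+ 2 + b ^+ 2 + c ^+ 2 + d ^+ 2)) / 2); last by field.
    by rewrite divr_ge0 ?ler0n// !addr_ge0 ?sqr_ge0.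
  rewrite (_ : _ - _ = ((a - c) ^+ 2 + (b + d) ^+ 2
    + (a ^+ 2 + b ^+ 2 + c ^+ 2 + d ^+ 2)) / 2); last by field.
  by rewrite divr_ge0 ?ler0n// !addr_ge0 ?sqr_ge0.
- exact/measurable_EFinP.
- move=> q _ /=; rewrite lee_fin [leRHS]ger0_norm ?addr_ge0 ?mul1r ?abs2_ge0//.
  case: (f q) (g q) => [a b] [c d]; rewrite /abs2 /= ler_norml.
  apply/andP; split; rewrite -subr_ge0.
    rewrite (_ : _ - _ = ((a + d) ^+ 2 + (b + c) ^+ 2
      + (a ^+ 2 + b ^+ 2 + c ^+ 2 + d ^+ 2)) / 2); last by field.
    by rewrite divr_ge0 ?ler0n// !addr_ge0 ?sqr_ge0.
  rewrite (_ : _ - _ = ((a - d) ^+ 2 + (b - c) ^+ 2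
    + (a ^+ 2 + b ^+ 2 + c ^+ 2 + d ^+ 2)) / 2); last by field.
  by rewrite divr_ge0 ?ler0n// !addr_ge0 ?sqr_ge0.
Qed.

End IntegralC.

(** * Vanishing of integrals of derivatives *)

Section DerivativeIntegral.
Context {R : realType}.
Local Notation mu := (@lebesgue_measure R).

Lemma integrable_opp (f : R -> R) :
  mu.-integrable [set: R] (EFin \o f) ->
  mu.-integrable [set: R] (EFin \o (fun x => f (- x))).
Proof.
have mN : measurable_fun [set: R] (-%R : R -> measurableTypeR R).
  exact: oppr_measurable.
move=> /integrableP[mf foo]; pose fN x := f (- x).
rewrite -/fN; apply/integrableP; split; first exact: (measurableT_comp mf mN).
have <- : (\int[mu]_x `|(EFin \o f) x| =
   \int[mu]_x `|(EFin \o fN) x|)%E; last exact: foo.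
transitivity (\int[pushforward mu (-%R : R -> measurableTypeR R)]_x
    `|(EFin \o f) x|)%E.
  apply: eq_measure_integral => A mA _; apply/esym; exact: lebesgue_measureN.
by rewrite ge0_integral_pushforward//; exact: measurableT_comp.
Qed.

(** Otherwise |d| would be at least e on the half-line from x0, whose measure is infinite. *)
Lemma integrable_small (d : R -> R) (x0 e : R) : 0 < e ->
  mu.-integrable [set: R] (EFin \o d) -> exists x, x0 <= x /\ `|d x| <= e.
Proof.
move=> e0 /integrableP[md doo]; apply: contrapT => /forallNP nx.
have ed x : x0 <= x -> e <= `|d x|.
  move=> x0x; rewrite leNgt; apply/negP => dx; apply: (nx x).
  by split => //; exact: ltW.
suff : (+oo <= \int[mu]_x `|(EFin \o d) x|)%E by rewrite leye_eq => /eqP doo'; rewrite doo' in doo.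
have <- : (\int[mu]_(x in `[x0, +oo[) e%:E = +oo)%E.
  rewrite integral_cst//= lebesgue_measure_itv/= ltry addye// mulry gtr0_sg// mul1e.
  done.
apply: (@le_trans _ _ (\int[mu]_(x in `[x0, +oo[) `|(EFin \o d) x|)%E).
  apply: ge0_le_integral => //.
  - by move=> x _; rewrite lee_fin ltW.
  - by apply: measurableT_comp => //; apply: measurable_funS md.
  - by move=> x /=; rewrite in_itv/= andbT lee_fin => /ed.
by apply: ge0_subset_integral => //; apply: measurableT_comp.
Qed.

(** Over [-x, x] the integral of g is d(x) = f(x) - f(-x). Integrability of f makes d integrable,
    hence small along some sequence tending to infinity, and dominated convergence along that
    sequence gives the whole integral. *)
Lemma integral_derive_eq0 (f g : R -> R) :
  (forall x : R, is_derive x 1 f (g x)) -> continuous g ->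
  mu.-integrable [set: R] (EFin \o f) -> mu.-integrable [set: R] (EFin \o g) ->
  (\int[mu]_x (g x)%:E = 0)%E.
Proof.
move=> fg cg fi gi.
pose d x := f x - f (- x).
have di : mu.-integrable [set: R] (EFin \o d).
  rewrite (_ : _ \o _ = (fun x => (f x)%:E - (f (- x))%:E)%E)//.
  by apply: integrableB => //; exact: (integrable_opp fi).
have ftc (x : R) : 0 < x -> (\int[mu]_(y in `[(- x)%R, x]) (g y)%:E = (d x)%:E)%E.
  move=> x0.
  have cf : continuous f.
    by move=> y; apply/differentiable_continuous/derivable1_diffP; case: (fg y).
  rewrite (@continuous_FTC2 _ g f)//.
  - by rewrite gtrN.
  - exact: continuous_subspaceT.
  - split; first by move=> y _; case: (fg y).
      by apply: cvg_at_right_filter; exact: cf.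
    by apply: cvg_at_left_filter; exact: cf.
  - by move=> y _; rewrite derive1E; have [_ ->] := fg y.
(* The points satisfy u_n >= n + 1 and |d(u_n)| <= 1 / (n + 1), so the intervals [-u_n, u_n] exhaust
   the line while the boundary terms tend to 0. *)
have /choice[u uP] n : exists x, n.+1%:R <= x /\ `|d x| <= n.+1%:R^-1.
  exact: integrable_small.
have u0 n : 0 < u n by have [+ _] := uP n; apply: lt_le_trans.
pose gn n x := (g x * \1_`[(- u n), u n]%classic x)%:E.
have mg : measurable_fun [set: R] (EFin \o g) by exact: measurable_int gi.
have mgn n : measurable_fun [set: R] (gn n).
  apply/measurable_EFinP; apply: measurable_funM; first exact/measurable_EFinP.
  exact: measurable_indic.
have uy : u n @[n --> \oo] --> +oo.
  apply/cvgryPge => A; near=> n; have [+ _] := uP n; apply: le_trans.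
  near: n; exists (Num.trunc `|A|) => // n /=  An.
  rewrite (le_trans (ler_norm A))// ltW// (lt_le_trans (truncnS_gt _))//.
  by rewrite ler_nat ltnS.
have gnE n : (\int[mu]_x gn n x = (d (u n))%:E)%E.
  rewrite -ftc// [RHS]integral_mkcond; apply: eq_integral => x _.
  by rewrite /gn patchE indicE; case: ifPn => _; rewrite ?mulr1 ?mulr0.
have ae1 : {ae mu, forall x, [set: R] x -> gn^~ x @ \oo --> (EFin \o g) x}.
  apply: aeW => x _; apply: cvg_near_cst.
  move/cvgryPge : uy => /(_ `|x|); apply: filterS => n xn.
  rewrite /gn indicE mem_set ?mulr1//= in_itv/=.
  by rewrite -ler_norml.
have ae2 : {ae mu, forall x n, [set: R] x -> (`|gn n x| <= `|(g x)%:E|)%E}.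
  apply: aeW => x n _; rewrite /gn !abse_EFin lee_fin normrM ler_piMr//.
  by rewrite indicE; case: (_ \in _); rewrite ?normr1 ?normr0.
have [_ _ cv] := @dominated_convergence _ _ _ mu [set: R] measurableT gn
  (EFin \o g) (fun x => `|(g x)%:E|)%E mgn mg ae1 (integrable_abse gi) ae2.
apply: (@cvg_unique _ (@ereal_hausdorff R) _ _ _ _ cv).
rewrite (_ : [sequence _]_n = EFin \o (d \o u)); last exact/funext.
apply: cvg_EFin; first exact: nearW.
apply: norm_cvg0; apply: (@squeeze_cvgr _ _ _ _ (cst 0) (fun n => n.+1%:R^-1)).
- by apply: nearW => n /=; rewrite normr_ge0; have [] := uP n.
- exact: cvg_cst.
- exact: cvg_harmonic.
Unshelve. all: by end_near. Qed.
End DerivativeIntegral.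

Section TupleDerivative.
Context {R : realType}.
Local Notation mu := (@lebesgue_measure R).
Local Notation lam := (@lebesgue_tuple R).

(** By Fubini, F and G are integrable on almost every line parallel to the i-th axis, where the
    one-variable statement applies. The induction brings that axis to the first position. *)
Lemma integral_partial_eq0 n (i : 'I_n) (F G : n.-tuple R -> R) :
  (forall q (x : R), is_derive x 1 (fun y => F (upd q i y)) (G (upd q i x))) ->
  (forall q, continuous (fun y : R => G (upd q i y))) ->
  (lam n).-integrable [set: n.-tuple R] (EFin \o F) ->
  (lam n).-integrable [set: n.-tuple R] (EFin \o G) ->
  (\int[lam n]_q (G q)%:E = 0)%E.
Proof.
elim: n i F G => [[]//|n IH] i F G FG cG Fi Gi.
have Fi' := integrable_cons Fi; have Gi' := integrable_cons Gi.
rewrite (integral_lebesgue_cons Gi).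
case: (unliftP ord0 i) => [j|] ij; subst i; last first.
  rewrite -(@integral21_prod_meas1 _ _ _ _ _ mu (lam n) _ Gi').
  rewrite -[RHS](@integral0 _ _ _ (lam n) [set: n.-tuple R]).
  apply: ae_eq_integral => //.
    exact: (measurable_fubini_G Gi').
  have aF := @ae_integrable2 _ _ _ _ _ mu (lam n) _ Fi'.
  have aG := @ae_integrable2 _ _ _ _ _ mu (lam n) _ Gi'.
  apply: filterS2 aF aG => v iF iG _.
  apply: (@integral_derive_eq0 _ (fun x => F (cons_pair (x, v)))) => //.
  - move=> x; have := FG (cons_pair (0, v)) x.
    by under eq_fun do rewrite upd_cons0; rewrite upd_cons0.
  - have := cG (cons_pair (0, v)).
    by under [X in continuous X -> _]eq_fun do rewrite upd_cons0.
rewrite -(@integral12_prod_meas1 _ _ _ _ _ mu (lam n) _ Gi').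
rewrite -[RHS](@integral0 _ _ _ mu [set: R]).
apply: ae_eq_integral => //.
  exact: (measurable_fubini_F Gi').
have aF := @ae_integrable1 _ _ _ _ _ mu (lam n) _ Fi'.
have aG := @ae_integrable1 _ _ _ _ _ mu (lam n) _ Gi'.
apply: filterS2 aF aG => x iF iG _.
apply: (IH j (fun v => F (cons_pair (x, v)))) => //.
- move=> v y; have := FG (cons_pair (x, v)) y.
  by under eq_fun do rewrite upd_consS; rewrite upd_consS.
- move=> v; have := cG (cons_pair (x, v)).
  by under [X in continuous X -> _]eq_fun do rewrite upd_consS.
Qed.

Lemma integral_gauss_lty (c a : R) : 0 < c ->
  (\int[mu]_x (expR (- (c * (x - a) ^+ 2)))%:E < +oo)%E.
Proof.
(* With variance 1 / (2 c) the normal density has exponent -c (x - a)^2. *)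
move=> c0; pose s := Num.sqrt (2 * c)^-1.
have s2 : s ^+ 2 = (2 * c)^-1 by rewrite sqr_sqrtr// invr_ge0 mulr_ge0// ltW.
have s0 : s != 0 by rewrite gt_eqF// sqrtr_gt0 invr_gt0 mulr_gt0.
have /integrableP[mf] := integrable_normal_pdf a s.
have p0 := normal_peak_gt0 s0.
have E x : expR (- (c * (x - a) ^+ 2)) = (normal_peak s)^-1 * normal_pdf a s x.
  rewrite normal_pdfE// mulKf ?gt_eqF// /normal_fun; congr expR.
  rewrite s2 mulNr; congr (- _); rewrite -mulr_natl; field.
  by rewrite gt_eqF.
move=> foo.
under eq_integral do rewrite E EFinM.
rewrite ge0_integralZl//; last 2 first.
- by move=> x _; rewrite lee_fin normal_pdf_ge0.
- by rewrite lee_fin invr_ge0 ltW.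
by rewrite integral_normal_pdf mule1 ltry.
Qed.

Lemma integral_gauss_tuple_lty n (c : R) (a : n.-tuple R) : 0 < c ->
  (\int[lam n]_q (expR (- (c * \sum_j (tnth q j - tnth a j) ^+ 2)))%:E < +oo)%E.
Proof.
move=> c0.
have mg m (b : m.-tuple R) : measurable_fun [set: m.-tuple R]
    (fun q : m.-tuple R => (expR (- (c * \sum_j (tnth q j - tnth b j) ^+ 2)))%:E).
  apply/measurable_EFinP; apply: measurableT_comp => //.
  apply: measurableT_comp => //; apply: measurable_funM => //.
  apply: measurable_sum => j; apply: measurable_funX.
  by apply: measurable_funB => //; exact: measurable_tnth.
elim: n a => [|n IH] a.
  rewrite /= integral_dirac//; last exact: (mg 0%N a).
  by rewrite diracE mem_set// mul1e ltry.
rewrite ge0_integral_consE//.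
pose a' := [tuple of behead a].
pose I := (\int[lam n]_v
  (expR (- (c * \sum_j (tnth v j - tnth a' j) ^+ 2)))%:E)%E.
have -> : (\int[mu]_x \int[lam n]_v
    (expR (- (c * \sum_j (tnth (cons_pair (x, v)) j - tnth a j) ^+ 2)))%:E =
  \int[mu]_x ((expR (- (c * (x - thead a) ^+ 2)))%:E * I))%E.
  apply: eq_integral => x _.
  rewrite -ge0_integralZl//; [|exact: (mg n a')].
  apply: eq_integral => v _; rewrite -EFinM -expRD; congr (expR _)%:E.
  rewrite big_ord_recl mulrDr opprD; congr (- (c * _) - c * _).
  apply: eq_bigr => i _.
  by rewrite tnth_cons_pairS {1}(tuple_eta a) tnthS.
rewrite ge0_integralZr//; last 2 first.
- apply/measurable_EFinP; apply: measurableT_comp => //.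
  apply: measurableT_comp => //; apply: measurable_funM => //.
  by apply: measurable_funX; exact: measurable_funB.
- by apply: integral_ge0 => v _; rewrite lee_fin expR_ge0.
apply: lte_mul_pinfty; last exact: IH.
- by apply: integral_ge0 => x _; rewrite lee_fin expR_ge0.
- rewrite ge0_fin_numE ?integral_gauss_lty//.
  by apply: integral_ge0 => x _; rewrite lee_fin expR_ge0.
Qed.
End TupleDerivative.

(** * Complex-valued differential calculus *)

Section RealDerivative.
Context {R : realType} {W : normedModType R}.
Implicit Types (f g : W -> R) (x v : W) (a b : R).

Lemma is_derive_eqf x v f a b : is_derive x v f a -> a = b -> is_derive x v f b.
Proof. by move=> + <-. Qed.

Lemma is_derive_addf x v f g a b : is_derive x v f a -> is_derive x v g b ->
  is_derive x v (fun y => f y + g y) (a + b).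
Proof. by move=> df dg; exact: (is_deriveD df dg). Qed.

Lemma is_derive_mulf x v f g a b : is_derive x v f a -> is_derive x v g b ->
  is_derive x v (fun y => f y * g y) (a * g x + f x * b).
Proof.
move=> df dg; have H := is_deriveM df dg.
rewrite (_ : a * g x + f x * b = f x *: b + g x *: a); first exact: H.
by rewrite /GRing.scale /= addrC [a * _]mulrC.
Qed.

Lemma is_derive_cstf x v a : is_derive x v (fun=> a) 0.
Proof. exact: is_derive_cst. Qed.

Lemma is_derive_scalef x v f a (c : R) : is_derive x v f a ->
  is_derive x v (fun y => c * f y) (c * a).
Proof.
move=> df; have H := is_derive_mulf (is_derive_cstf x v c) df.
by rewrite mul0r add0r in H.
Qed.

Lemma is_derive_oppf x v f a : is_derive x v f a ->
  is_derive x v (fun y => - f y) (- a).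
Proof. by move=> df; exact: is_deriveN. Qed.

Lemma is_derive_sumf (I : Type) (s : seq I) x v (F : I -> W -> R) (a : I -> R) :
  (forall i, is_derive x v (F i) (a i)) ->
  is_derive x v (fun y => \sum_(i <- s) F i y) (\sum_(i <- s) a i).
Proof.
move=> dF; elim: s => [|i s IH].
  by under eq_fun do rewrite big_nil; rewrite big_nil; exact: is_derive_cst.
under eq_fun do rewrite big_cons.
by rewrite big_cons; exact: is_derive_addf.
Qed.

End RealDerivative.

Section ComplexDerivative.
Context {R : realType} {W : normedModType R}.
Implicit Types (f g : W -> R[i]) (x v : W) (a b c : R[i]).

(** Bundles existence and value of a derivative, so that the derivative of a compound expression is
    assembled as a term and its value compared afterwards by [is_deriveC_eq]. *)
Definition is_deriveC x v f a :=
  is_derive x v (Rec \o f) (Rec a) /\ is_derive x v (Imc \o f) (Imc a).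

Lemma is_deriveC_eq x v f a b : is_deriveC x v f a -> a = b -> is_deriveC x v f b.
Proof. by move=> + <-. Qed.

Lemma is_deriveC_val x v f a : is_deriveC x v f a -> deriveC v f x = a.
Proof. by move=> [[_ dR] [_ dI]]; rewrite /deriveC dR dI; case: a {dR dI}. Qed.

Lemma is_deriveC_derivable x v f a : is_deriveC x v f a -> derivableC f x v.
Proof. by move=> [[dR _] [dI _]]. Qed.

Lemma derivableCP x v f : derivableC f x v -> is_deriveC x v f (deriveC v f x).
Proof. by move=> [dR dI]; split; apply: DeriveDef. Qed.

Lemma differentiableC_is_deriveC x v f : differentiableC f x ->
  is_deriveC x v f (deriveC v f x).
Proof. by move=> [dR dI]; apply: derivableCP; split; exact: diff_derivable. Qed.

Lemma is_deriveC_cst x v c : is_deriveC x v (fun=> c) 0.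
Proof. by split; exact: is_derive_cst. Qed.

Lemma is_deriveC_add x v f g a b : is_deriveC x v f a -> is_deriveC x v g b ->
  is_deriveC x v (fun y => f y + g y) (a + b).
Proof.
move=> [fR fI] [gR gI]; split.
- rewrite (_ : _ \o _ = fun y => Rec (f y) + Rec (g y)).
    rewrite raddfD; exact: is_derive_addf.
  by apply: funext => y; rewrite /= raddfD.
- rewrite (_ : _ \o _ = fun y => Imc (f y) + Imc (g y)).
    rewrite raddfD; exact: is_derive_addf.
  by apply: funext => y; rewrite /= raddfD.
Qed.

Lemma is_deriveC_mul x v f g a b : is_deriveC x v f a -> is_deriveC x v g b ->
  is_deriveC x v (fun y => f y * g y) (a * g x + f x * b).
Proof.
move=> [fR fI] [gR gI]; split.
- rewrite (_ : _ \o _ = fun y => Rec (f y) * Rec (g y) + - (Imc (f y) * Imc (g y))).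
    have H := is_derive_addf (is_derive_mulf fR gR) (is_derive_oppf (is_derive_mulf fI gI)).
    apply: (is_derive_eqf H).
    rewrite [RHS]raddfD /=.
    by case: a b (f x) (g x) {H fR fI gR gI} => [? ?] [? ?] [? ?] [? ?] /=; ring.
  by apply: funext => y /=; case: (f y) (g y) => [? ?] [? ?].
- rewrite (_ : _ \o _ = fun y => Rec (f y) * Imc (g y) + Imc (f y) * Rec (g y)).
    have H := is_derive_addf (is_derive_mulf fR gI) (is_derive_mulf fI gR).
    apply: (is_derive_eqf H).
    rewrite [RHS]raddfD /=.
    by case: a b (f x) (g x) {H fR fI gR gI} => [? ?] [? ?] [? ?] [? ?] /=; ring.
  by apply: funext => y /=; case: (f y) (g y) => [? ?] [? ?].
Qed.

Lemma is_deriveC_scale x v f c a : is_deriveC x v f a ->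
  is_deriveC x v (fun y => c * f y) (c * a).
Proof.
move=> df; have H := is_deriveC_mul (is_deriveC_cst x v c) df.
by rewrite mul0r add0r in H.
Qed.

Lemma is_deriveC_sum (I : Type) (s : seq I) x v (F : I -> W -> R[i]) (a : I -> R[i]) :
  (forall i, is_deriveC x v (F i) (a i)) ->
  is_deriveC x v (fun y => \sum_(i <- s) F i y) (\sum_(i <- s) a i).
Proof.
move=> dF; elim: s => [|i s IH].
  by under eq_fun do rewrite big_nil; rewrite big_nil; exact: is_deriveC_cst.
under eq_fun do rewrite big_cons.
by rewrite big_cons; exact: is_deriveC_add.
Qed.

Lemma is_deriveC_real x v (f : W -> R) (a : R) : is_derive x v f a ->
  is_deriveC x v (fun y => (f y)%:C) a%:C.
Proof. by move=> df; split => //=; exact: is_derive_cst. Qed.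

Lemma is_deriveC_cplx x v (f g : W -> R) (a b : R) : is_derive x v f a ->
  is_derive x v g b -> is_deriveC x v (fun y => f y +i* g y) (a +i* b).
Proof. by []. Qed.

Lemma is_derive_line (f : W -> R) x v (a : R) :
  is_derive (0 : R) 1 (fun h : R => f (h *: v + x)) a <-> is_derive x v f a.
Proof.
have E : 'D_1 (fun h : R => f (h *: v + x)) (0 : R) = 'D_v f x.
  rewrite /derive; set g1 := fun h => h^-1 *: _; set g2 := fun h => h^-1 *: _.
  suff -> : g1 = g2 by [].
  by rewrite funeqE /g1 /g2 => h /=; rewrite addr0 scale0r add0r [_%:A]mulr1.
split=> -[df dE]; apply: DeriveDef.
- exact/derivable1P.
- exact: (etrans (esym E) dE).
- exact: (derivable1P f x v).1 df.
- exact: (etrans E dE).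
Qed.

Lemma is_derive_line_at (f : W -> R) x v (h0 a : R) :
  is_derive (h0 *: v + x) v f a ->
  is_derive h0 1 (fun h : R => f (h *: v + x)) a.
Proof.
have E : (fun h : R => h^-1 *: (((fun h : R => f (h *: v + x)) \o shift h0)
      (h *: (1 : R)) - f (h0 *: v + x))) =
    (fun h : R => h^-1 *: ((f \o shift (h0 *: v + x)) (h *: v) - f (h0 *: v + x))).
  apply: funext => h /=; congr (_ *: (f _ - _)).
  by rewrite /GRing.scale /= mulr1 [RHS]addrA -scalerDl.
move=> [df dE]; apply: DeriveDef.
  by move: df; rewrite /derivable -E.
by move: dE; rewrite /derive -E.
Qed.

End ComplexDerivative.

Section ComplexLine.
Context {R : realType} {W : normedModType R}.

Lemma is_deriveC_line (f : W -> R[i]) x v (a : R[i]) :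
  is_deriveC (0 : R) 1 (fun h : R => f (h *: v + x)) a <-> is_deriveC x v f a.
Proof.
split=> -[dR dI]; split.
- exact: ((is_derive_line (Rec \o f) x v _).1 dR).
- exact: ((is_derive_line (Imc \o f) x v _).1 dI).
- exact: ((is_derive_line (Rec \o f) x v _).2 dR).
- exact: ((is_derive_line (Imc \o f) x v _).2 dI).
Qed.

Lemma is_deriveC_line_at (f : W -> R[i]) x v (h0 : R) (a : R[i]) :
  is_deriveC (h0 *: v + x) v f a ->
  is_deriveC h0 1 (fun h : R => f (h *: v + x)) a.
Proof.
by move=> -[dR dI]; split; [exact: (is_derive_line_at dR)|exact: (is_derive_line_at dI)].
Qed.

(** Restricted to the line [h *: v + x] this is the chain rule for functions of one real
    variable. *)
Lemma is_deriveC_exp x v (f g : W -> R) (a b : R) :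
  is_derive x v f a -> is_derive x v g b ->
  is_deriveC x v (fun y => cexp (f y +i* g y))
    ((a +i* b) * cexp (f x +i* g x)).
Proof.
move=> df dg.
have df' : is_derive (0 : R) 1 (fun h : R => f (h *: v + x)) a by exact/is_derive_line.
have dg' : is_derive (0 : R) 1 (fun h : R => g (h *: v + x)) b by exact/is_derive_line.
have f0 : f (0 *: v + x) = f x by rewrite scale0r add0r.
have g0 : g (0 *: v + x) = g x by rewrite scale0r add0r.
have de := is_derive1_comp (is_derive_expR _) df'.
have dc := is_derive1_comp (is_derive_cos _) dg'.
have ds := is_derive1_comp (is_derive_sin _) dg'.
split; apply: ((is_derive_line _ x v _).1 _).
- rewrite (_ : (fun h => _) = fun h : R => expR (f (h *: v + x)) * cos (g (h *: v + x))).
    have H := is_derive_mulf de dc; apply: (is_derive_eqf H).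
    by rewrite /= f0 g0; ring.
  by apply: funext => h /=; rewrite mul0r subr0.
- rewrite (_ : (fun h => _) = fun h : R => expR (f (h *: v + x)) * sin (g (h *: v + x))).
    have H := is_derive_mulf de ds; apply: (is_derive_eqf H).
    by rewrite /= f0 g0; ring.
  by apply: funext => h /=; rewrite mul0r addr0.
Qed.

End ComplexLine.

(** * The Gaussian kernel and its integral transform *)

Section Kernel.
Context {R : realType} {n : nat} (C k : R) (k0 : 0 < k).
Local Notation tup := (n.-tuple R).
Local Notation lam := (@lebesgue_tuple R n).

(** [bargmann_kernel] with |t| and the normalising constant replaced by parameters [k] and [C]. *)
Definition kernel (p q q' : tup) : R[i] :=
  C%:C * cexp (- (k / 2 * \sum_j (tnth q j - tnth q' j) ^+ 2)
    +i* - (k / 2 * \sum_j tnth p j * (2 * tnth q' j - tnth q j))).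

Definition lin (p x : tup) (h : R) : tup := [tuple tnth p j + h * tnth x j | j < n].

Lemma tnth_lin p x h j : tnth (lin p x h) j = tnth p j + h * tnth x j.
Proof. by rewrite tnth_mktuple. Qed.

Lemma lin0 p x : lin p x 0 = p.
Proof. by apply: eq_from_tnth => j; rewrite tnth_lin mul0r addr0. Qed.

Lemma abs2_cexp (a b : R) : abs2 (cexp (a +i* b)) = expR (2 * a).
Proof.
rewrite /abs2 /cexp /= !mul0r subr0 addr0.
rewrite !exprMn -mulrDr cos2Dsin2 mulr1 expr2 -expRD; congr expR; ring.
Qed.

(** The coordinates p enter through a phase only, so the modulus is the Gaussian factor. *)
Lemma abs2_kernel p q q' : abs2 (kernel p q q') =
  C ^+ 2 * expR (- (k * \sum_j (tnth q' j - tnth q j) ^+ 2)).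
Proof.
rewrite /kernel abs2M abs2_cexp; congr (_ * expR _).
  by rewrite /abs2 /= expr0n addr0.
rewrite -mulrN mulrA mulrN; congr (- _); rewrite [2 * _]mulrC divfK// mulr_sumr mulr_sumr.
by apply: eq_bigr => j _; ring.
Qed.

Lemma measurable_kernel p q : measurableC (kernel p q).
Proof.
apply: measurableC_mul; first exact: measurableC_cst.
have m1 : measurable_fun [set: tup] (fun q' : tup =>
    - (k / 2 * \sum_j (tnth q j - tnth q' j) ^+ 2)).
  apply: measurableT_comp => //; apply: measurable_funM => //.
  apply: measurable_sum => j; apply: measurable_funX.
  by apply: measurable_funB => //; exact: measurable_tnth.
have m2 : measurable_fun [set: tup] (fun q' : tup =>
    - (k / 2 * \sum_j tnth p j * (2 * tnth q' j - tnth q j))).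
  apply: measurableT_comp => //; apply: measurable_funM => //.
  apply: measurable_sum => j; apply: measurable_funM => //.
  apply: measurable_funB => //; apply: measurable_funM => //.
  exact: measurable_tnth.
have m1' := measurableT_comp (@measurable_expR R) m1.
rewrite /cexp; split.
- rewrite (_ : _ \o _ = fun q' : tup => expR (- (k / 2 * \sum_j (tnth q j - tnth q' j) ^+ 2)) *
    cos (- (k / 2 * \sum_j tnth p j * (2 * tnth q' j - tnth q j)))).
    apply: measurable_funM; first exact: m1'.
    by apply: (measurableT_comp _ m2); exact: continuous_measurable_fun (@continuous_cos R).
  by apply/funext => q' /=; rewrite mul0r subr0.
- rewrite (_ : _ \o _ = fun q' : tup => expR (- (k / 2 * \sum_j (tnth q j - tnth q' j) ^+ 2)) *
    sin (- (k / 2 * \sum_j tnth p j * (2 * tnth q' j - tnth q j)))).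
    apply: measurable_funM; first exact: m1'.
    by apply: (measurableT_comp _ m2); exact: continuous_measurable_fun (@continuous_sin R).
  by apply/funext => q' /=; rewrite mul0r addr0.
Qed.

Lemma integrable_gauss_tuple (c : R) (a : tup) : 0 < c ->
  lam.-integrable [set: tup]
    (EFin \o (fun q => expR (- (c * \sum_j (tnth q j - tnth a j) ^+ 2)))).
Proof.
move=> c0; apply/integrableP; split.
  apply/measurable_EFinP; apply: measurableT_comp => //.
  apply: measurableT_comp => //; apply: measurable_funM => //.
  apply: measurable_sum => j; apply: measurable_funX.
  by apply: measurable_funB => //; exact: measurable_tnth.
under eq_integral do rewrite /= ger0_norm ?expR_ge0//.
exact: integral_gauss_tuple_lty.
Qed.

Lemma L2_kernel p q : L2 (kernel p q).
Proof.
apply/L2P; split; first exact: measurable_kernel.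
rewrite (_ : _ \o _ = EFin \o (fun q' => C ^+ 2 *
    expR (- (k * \sum_j (tnth q' j - tnth q j) ^+ 2)) + 0 *
    expR (- (k * \sum_j (tnth q' j - tnth q j) ^+ 2)))).
  by apply: integrable_lin; exact: integrable_gauss_tuple.
by apply/funext => q' /=; rewrite abs2_kernel mul0r addr0.
Qed.

(** The logarithmic derivative is affine in q'. Hence derivatives of the transform involve only
    moments of order 0 and 1, and two derivatives only moments of order at most 2. *)
Lemma kernel_line_derive p q x y (q' : tup) (h : R) :
  is_deriveC h 1 (fun h : R => kernel (lin p x h) (lin q y h) q')
   (((- (k * \sum_j tnth y j * (tnth (lin q y h) j - tnth q' j)))
     +i* (- (k * \sum_j tnth x j * (tnth q' j - tnth (lin q y h) j / 2))
          + k / 2 * \sum_j tnth y j * tnth (lin p x h) j))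
    * kernel (lin p x h) (lin q y h) q').
Proof.
have dl (u w : tup) j : is_derive h 1 (fun h : R => tnth (lin u w h) j) (tnth w j).
  under eq_fun do rewrite tnth_lin.
  have H := is_derive_addf (is_derive_cstf h (1:R) (tnth u j))
    (is_derive_mulf (is_derive_id h (1 : R)) (is_derive_cstf h (1:R) (tnth w j))).
  by apply: (is_derive_eqf H); rewrite /=; ring.
rewrite /kernel mulrCA; apply: is_deriveC_scale; apply: is_deriveC_exp.
- have H := is_derive_oppf (is_derive_scalef (k / 2)
   (is_derive_sumf (index_enum 'I_n) (fun j => is_derive_mulf
     (is_derive_addf (dl q y j) (is_derive_cstf h (1:R) (- tnth q' j)))
     (is_derive_addf (dl q y j) (is_derive_cstf h (1:R) (- tnth q' j)))))).
  apply: (is_derive_eqf H); congr (- _).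
  by rewrite !mulr_sumr; apply: eq_bigr => j _; field.
- have H := is_derive_oppf (is_derive_scalef (k / 2)
   (is_derive_sumf (index_enum 'I_n) (fun j => is_derive_mulf (dl p x j)
     (is_derive_addf (is_derive_cstf h (1:R) (2 * tnth q' j))
        (is_derive_oppf (dl q y j)))))).
  apply: (is_derive_eqf H).
  by rewrite !mulr_sumr -!sumrN -big_split; apply: eq_bigr => j _ /=; field.
Qed.

(** Differentiation in the integration variable, prepared for the integration by parts in
    [Phi_by_parts]. *)
Lemma kernel_upd_derive p q (q' : tup) (i : 'I_n) (a : R) :
  is_deriveC a 1 (fun a : R => kernel p q (upd q' i a))
   (((k * (tnth q i - a)) +i* (- (k * tnth p i))) * kernel p q (upd q' i a)).
Proof.
have dl j : is_derive a 1 (fun a : R => tnth (upd q' i a) j) (j == i)%:R.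
  under eq_fun do rewrite tnth_upd; case: eqP => _.
    exact: is_derive_id.
  exact: is_derive_cstf.
rewrite /kernel mulrCA; apply: is_deriveC_scale; apply: is_deriveC_exp.
- have H := is_derive_oppf (is_derive_scalef (k / 2)
   (is_derive_sumf (index_enum 'I_n) (fun j => is_derive_mulf
     (is_derive_addf (is_derive_cstf a (1:R) (tnth q j)) (is_derive_oppf (dl j)))
     (is_derive_addf (is_derive_cstf a (1:R) (tnth q j)) (is_derive_oppf (dl j)))))).
  apply: (is_derive_eqf H).
  rewrite (bigD1 i)//= big1 ?addr0; last first.
    by move=> j ji; rewrite (negbTE ji) /= mulr0n; ring.
  by rewrite tnth_upd !eqxx /= mulr1n; field.
- have H := is_derive_oppf (is_derive_scalef (k / 2)
   (is_derive_sumf (index_enum 'I_n) (fun j => is_derive_scalef (tnth p j)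
     (is_derive_addf (is_derive_scalef 2 (dl j)) (is_derive_cstf a (1:R) (- tnth q j)))))).
  apply: (is_derive_eqf H).
  rewrite (bigD1 i)//= big1 ?addr0; last first.
    by move=> j ji; rewrite (negbTE ji) /= mulr0n; ring.
  by rewrite eqxx /= mulr1n; field.
Qed.

(* |q + h y - q'|^2 >= |q - q'|^2 / 2 - h^2 |y|^2 *)
Lemma abs2_kernel_le p q x y q' (h : R) : h ^+ 2 <= 1 ->
  abs2 (kernel (lin p x h) (lin q y h) q') <=
  (C ^+ 2 * expR (k * \sum_j tnth y j ^+ 2)) *
    expR (- (k / 2 * \sum_j (tnth q' j - tnth q j) ^+ 2)).
Proof.
move=> h1; rewrite abs2_kernel -mulrA ler_wpM2l ?sqr_ge0// -expRD ler_expR.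
rewrite -[k / 2 * _]mulrA -!mulrN -mulrDr ler_pM2l//.
rewrite -!sumrN mulr_sumr -big_split /=.
apply: ler_sum => j _; rewrite tnth_lin.
have : h ^+ 2 * tnth y j ^+ 2 <= tnth y j ^+ 2 by rewrite ler_piMl ?sqr_ge0.
have := sqr_ge0 ((tnth q' j - tnth q j) / 2 - h * tnth y j).
nra.
Qed.
End Kernel.

(** * The transform: linearity, derivatives, integration by parts *)

Section Transform.
Context {R : realType} {n : nat} (C k : R) (k0 : 0 < k).
Local Notation tup := (n.-tuple R).
Local Notation lam := (@lebesgue_tuple R n).
Local Notation K := (@kernel R n C k).
Implicit Types (f g : tup -> R[i]) (p q x y : tup).

Definition Phi f p q : R[i] := integralC (fun q' => f q' * K p q q').

(** [Phi (mulq f j)] is the j-th first moment of f against the kernel, and iterating [mulq] gives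
    the higher moments. *)
Definition mulq f (j : 'I_n) (q : tup) : R[i] := (tnth q j)%:C * f q.

Lemma integrable_Phi f p q : L2 f -> integrableC (fun q' => f q' * K p q q').
Proof. by move=> Lf; apply: L2_mul_integrable => //; exact: L2_kernel. Qed.

Lemma Phi_add f g p q : L2 f -> L2 g ->
  Phi (fun q' => f q' + g q') p q = Phi f p q + Phi g p q.
Proof.
move=> Lf Lg; rewrite /Phi -integralC_add; [|exact: integrable_Phi..].
by congr integralC; apply/funext => q'; rewrite mulrDl.
Qed.

Lemma Phi_scale (c : R[i]) f p q : L2 f ->
  Phi (fun q' => c * f q') p q = c * Phi f p q.
Proof.
move=> Lf; rewrite /Phi -integralC_scale; last exact: integrable_Phi.
by congr integralC; apply/funext => q'; rewrite mulrA.
Qed.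

Lemma Phi_sum (I : Type) (s : seq I) (F : I -> tup -> R[i]) p q :
  (forall i, L2 (F i)) ->
  Phi (fun q' => \sum_(i <- s) F i q') p q = \sum_(i <- s) Phi (F i) p q.
Proof.
move=> LF; rewrite /Phi -integralC_sum; last by move=> i; exact: integrable_Phi.
by congr integralC; apply/funext => q'; rewrite mulr_suml.
Qed.

Lemma RecM_le (z w : R[i]) : `|Rec (z * w)| <= 2^-1 * abs2 z + 2^-1 * abs2 w.
Proof.
case: z w => [a b] [c d]; rewrite /abs2 /= ler_norml -!mulrDr; apply/andP; split;
  rewrite -subr_ge0.
- rewrite (_ : _ - _ = 2^-1 * ((a + c) ^+ 2 + (b - d) ^+ 2)); last by field.
  by rewrite mulr_ge0 ?invr_ge0 ?addr_ge0 ?sqr_ge0.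
- rewrite (_ : _ - _ = 2^-1 * ((a - c) ^+ 2 + (b + d) ^+ 2)); last by field.
  by rewrite mulr_ge0 ?invr_ge0 ?addr_ge0 ?sqr_ge0.
Qed.

Lemma ImcM (z w : R[i]) : Imc (z * w) = Rec (- 'i * z * w).
Proof. by case: z w => [a b] [c d] /=; ring. Qed.

Lemma abs2D_le (z w : R[i]) : abs2 (z + w) <= 2 * abs2 z + 2 * abs2 w.
Proof.
case: z w => [a b] [c d]; rewrite /abs2 /= -subr_ge0.
rewrite (_ : _ - _ = (a - c) ^+ 2 + (b - d) ^+ 2); last ring.
by rewrite addr_ge0 ?sqr_ge0.
Qed.

Section DerivativeUnderIntegral.
Variables (p q x y : tup).

(** [dcoef] and [d0] split the logarithmic derivative of the kernel into its part linear in q' and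
    the rest. Only the rest depends on h. *)
Let dcoef (j : 'I_n) : R[i] := (k * tnth y j) +i* (- (k * tnth x j)).
Let d0 (h : R) : R[i] := (- (k * \sum_j tnth y j * tnth (lin q y h) j)) +i*
  (k / 2 * \sum_j (tnth x j * tnth (lin q y h) j + tnth y j * tnth (lin p x h) j)).

Let dE (q' : tup) (h : R) :
  ((- (k * \sum_j tnth y j * (tnth (lin q y h) j - tnth q' j)))
     +i* (- (k * \sum_j tnth x j * (tnth q' j - tnth (lin q y h) j / 2))
          + k / 2 * \sum_j tnth y j * tnth (lin p x h) j)) =
  (\sum_j dcoef j * (tnth q' j)%:C) + d0 h :> R[i].
Proof.
apply/eqP; rewrite eq_complex; apply/andP; split; apply/eqP.
- rewrite raddfD /= raddf_sum /= !mulr_sumr -!sumrN -big_split /=.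
  by apply: eq_bigr => j _; ring.
- rewrite raddfD /= raddf_sum /= !mulr_sumr -!sumrN -!big_split /=.
  by apply: eq_bigr => j _; field.
Qed.

(** [d0] is affine in h, hence bounded for |h| <= 1. *)
Let d0_bound : exists M : R, 0 <= M /\ forall h : R, h ^+ 2 <= 1 -> abs2 (d0 h) <= M.
Proof.
pose b : R[i] := (- (k * \sum_j tnth y j * tnth y j)) +i*
  (k / 2 * \sum_j (tnth x j * tnth y j + tnth y j * tnth x j)).
have E h : d0 h = d0 0 + h%:C * b.
  apply/eqP; rewrite eq_complex /= !mul0r !subr0 !addr0; apply/andP; split; apply/eqP.
  - rewrite !mulr_sumr -!sumrN !mulr_sumr -big_split /=.
    by apply: eq_bigr => j _; rewrite !tnth_lin; ring.
  - rewrite !mulr_sumr -big_split /=.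
    by apply: eq_bigr => j _; rewrite !tnth_lin; ring.
exists (2 * abs2 (d0 0) + 2 * abs2 b); split.
  by rewrite addr_ge0// mulr_ge0// abs2_ge0.
move=> h h1; rewrite E; apply: (le_trans (abs2D_le _ _)).
rewrite lerD2l ler_pM2l// abs2M ler_piMl ?abs2_ge0//.
by rewrite /abs2 /= expr0n addr0.
Qed.

(* Real parts suffice: the imaginary part of an integral against f is the real
   part of one against -i f. *)
Let derive_Rec f : L2 f -> (forall j, L2 (mulq f j)) ->
  is_derive (0 : R) 1 (fun h : R => Rintegral lam setT
     (fun q' => Rec (f q' * K (lin p x h) (lin q y h) q')))
  (Rintegral lam setT (fun q' =>
     Rec ((\sum_j dcoef j * mulq f j q' + d0 0 * f q') * K p q q'))).
Proof.
move=> Lf Lqf.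
pose L q' := \sum_j dcoef j * mulq f j q'.
have LL : L2 L by apply: L2_sum => j; exact: L2_scale.
pose F (h : R) q' := Rec (f q' * K (lin p x h) (lin q y h) q').
pose D (h : R) q' := (L q' + d0 h * f q') * K (lin p x h) (lin q y h) q'.
have FD (h : R) q' : is_derive h 1 (F^~ q') (Rec (D h q')).
  have [+ _] := is_deriveC_scale (f q') (kernel_line_derive C k p q x y q' h).
  move=> H; apply: (is_derive_eqf H).
  congr Rec; rewrite dE /D /L mulrA; congr (_ * _).
  rewrite mulrDr mulr_sumr [f q' * d0 h]mulrC; congr (_ + _).
  by apply: eq_bigr => j _; rewrite /mulq; ring.
have [M [M0 Mh]] := d0_bound.
have [_ iL] := (L2P L).1 LL.
have [_ iF] := (L2P f).1 Lf.
pose c1 := C ^+ 2 * expR (k * \sum_j tnth y j ^+ 2).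
(* The bound comes from |Re(z w)| <= |z|^2 / 2 + |w|^2 / 2 with z = L + d0(h) f and w the kernel:
   |z|^2 / 2 is at most [G1], and |w|^2 is bounded uniformly in h by [abs2_kernel_le]. The
   coefficients 1 and 0 in [G1] and [G] give the shape that [integrable_lin] expects. *)
pose G1 q' := 1 * abs2 (L q') + M * abs2 (f q').
pose G q' := 1 * G1 q' + 2^-1 * (c1 * expR (- (k / 2 * \sum_j (tnth q' j - tnth q j) ^+ 2))
   + 0 * expR (- (k / 2 * \sum_j (tnth q' j - tnth q j) ^+ 2))).
have k20 : 0 < k / 2 by rewrite divr_gt0.
have iG : lam.-integrable [set: tup] (EFin \o G).
  apply: integrable_lin; first exact: integrable_lin.
  by apply: integrable_lin; exact: integrable_gauss_tuple.
have G0 v : 0 <= G v.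
  have e0 : 0 <= c1 by rewrite mulr_ge0 ?sqr_ge0 ?expR_ge0.
  have f0 : 0 <= M * abs2 (f v) by rewrite mulr_ge0 ?abs2_ge0.
  rewrite /G /G1 !mul1r mul0r addr0; apply: addr_ge0.
    by apply: addr_ge0 => //; exact: abs2_ge0.
  by rewrite mulr_ge0 ?invr_ge0// mulr_ge0 ?expR_ge0.
have intF (h : R) : `]-1, 1[%classic h -> lam.-integrable [set: tup] (EFin \o F h).
  by move=> _; have [] := integrable_Phi (lin p x h) (lin q y h) Lf.
have derF (h : R) q' : `]-1, 1[%classic h -> [set: tup] q' -> derivable (F^~ q') h 1.
  by move=> _ _; case: (FD h q').
have ub (h : R) q' : `]-1, 1[%classic h -> [set: tup] q' -> `|partial1of2 F h q'| <= G q'.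
  move=> h1 _; rewrite partial1of2E.
  have -> : 'D_1 (F^~ q') h = Rec (D h q') by case: (FD h q').
  have {}h1 : h ^+ 2 <= 1.
    by move: h1; rewrite /= in_itv/= => /andP[h1 h2]; nra.
  apply: (le_trans (RecM_le _ _)); apply: lerD.
    have := abs2D_le (L q') (d0 h * f q'); rewrite abs2M.
    have : abs2 (d0 h) * abs2 (f q') <= M * abs2 (f q').
      by rewrite ler_wpM2r ?abs2_ge0// Mh.
    by rewrite /G1; lra.
  rewrite ler_pM2l ?invr_gt0// mul0r addr0.
  exact: (abs2_kernel_le C k0).
have I0 : `]-1, 1[%classic (0 : R) by rewrite /= in_itv/= ltrN10 ltr01.
have H1 := derivable_under_integral measurableT I0 intF derF G0 iG ub.
have H2 := differentiation_under_integral measurableT I0 intF derF G0 iG ub.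
apply: DeriveDef; first exact: H1.
rewrite -derive1E H2; apply: eq_Rintegral => q' _.
rewrite partial1of2E.
have -> : 'D_1 (F^~ q') (0 : R) = Rec (D 0 q') by case: (FD 0 q').
by rewrite /D !lin0.
Qed.

Lemma Phi_line_derive f : L2 f -> (forall j, L2 (mulq f j)) ->
  is_deriveC (0 : R) 1 (fun h : R => Phi f (lin p x h) (lin q y h))
   (\sum_j ((k * tnth y j) +i* (- (k * tnth x j))) * Phi (mulq f j) p q +
    ((- (k * \sum_j tnth y j * tnth q j)) +i*
     (k / 2 * \sum_j (tnth x j * tnth q j + tnth y j * tnth p j))) * Phi f p q).
Proof.
move=> Lf Lqf.
have -> : (\sum_j ((k * tnth y j) +i* (- (k * tnth x j))) * Phi (mulq f j) p q +
    ((- (k * \sum_j tnth y j * tnth q j)) +i*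
     (k / 2 * \sum_j (tnth x j * tnth q j + tnth y j * tnth p j))) * Phi f p q) =
  Phi (fun q' => \sum_j dcoef j * mulq f j q' + d0 0 * f q') p q.
  rewrite Phi_add; last 2 first.
  - by apply: L2_sum => j; exact: L2_scale.
  - exact: L2_scale.
  rewrite Phi_sum; last by move=> j; exact: L2_scale.
  rewrite Phi_scale// /d0 !lin0; congr (_ + _).
  by apply: eq_bigr => j _; rewrite Phi_scale.
split.
- exact: (derive_Rec Lf Lqf).
- have Lf' : L2 (fun q' => - 'i * f q') by exact: L2_scale.
  have Lqf' j : L2 (mulq (fun q' => - 'i * f q') j).
    have := L2_scale (- 'i) (Lqf j); congr L2; apply/funext => q'.
    by rewrite /mulq mulrCA.
  have H := derive_Rec Lf' Lqf'.
  rewrite (_ : Imc \o _ = (fun h : R => Rintegral lam setT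
     (fun q' => Rec (- 'i * f q' * K (lin p x h) (lin q y h) q')))); last first.
    by apply: funext => h /=; apply: eq_Rintegral => q' _ /=; rewrite ImcM.
  apply: (is_derive_eqf H); apply: eq_Rintegral => q' _ /=.
  rewrite ImcM; congr (Rec (_ * _)); rewrite mulrDr mulr_sumr; congr (_ + _).
    by apply: eq_bigr => j _; rewrite /mulq; ring.
  ring.
Qed.

End DerivativeUnderIntegral.

Lemma continuous_RecM (u v : R -> R[i]) :
  continuous (Rec \o u) -> continuous (Imc \o u) ->
  continuous (Rec \o v) -> continuous (Imc \o v) ->
  continuous (Rec \o (fun a => u a * v a)).
Proof.
move=> uR uI vR vI.
rewrite (_ : _ \o _ = fun a => Rec (u a) * Rec (v a) - Imc (u a) * Imc (v a)).
  move=> a; apply: (@cvgB _ R^o); apply: cvgM.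
  - exact: uR.
  - exact: vR.
  - exact: uI.
  - exact: vI.
by apply/funext => a /=; case: (u a) (v a) => [? ?] [? ?].
Qed.

Definition continuousC (u : R -> R[i]) := continuous (Rec \o u) /\ continuous (Imc \o u).

Lemma is_deriveC_continuous (u w : R -> R[i]) :
  (forall a : R, is_deriveC a 1 u (w a)) -> continuousC u.
Proof.
move=> du; split=> a; apply/differentiable_continuous/derivable1_diffP.
  by have [[]] := du a.
by have [_ []] := du a.
Qed.

Lemma continuousC_mul u v : continuousC u -> continuousC v ->
  continuousC (fun a => u a * v a).
Proof.
move=> [uR uI] [vR vI]; split; first exact: continuous_RecM.
rewrite (_ : _ \o _ = Rec \o (fun a => (- 'i * u a) * v a)); last first.
  by apply/funext => a /=; rewrite ImcM.
apply: continuous_RecM => //.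
  rewrite (_ : _ \o _ = Imc \o u)//.
  by apply/funext => a /=; case: (u a) => [? ?] /=; ring.
rewrite (_ : _ \o _ = fun a => - Rec (u a)).
  by move=> a; apply: (@cvgN _ R^o); exact: uR.
by apply/funext => a /=; case: (u a) => [? ?] /=; ring.
Qed.

Lemma continuousC_add u v : continuousC u -> continuousC v ->
  continuousC (fun a => u a + v a).
Proof.
move=> [uR uI] [vR vI]; split.
- rewrite (_ : _ \o _ = fun a => Rec (u a) + Rec (v a)).
    by move=> a; apply: (@cvgD _ R^o); [exact: uR|exact: vR].
  by apply/funext => a /=; rewrite raddfD.
- rewrite (_ : _ \o _ = fun a => Imc (u a) + Imc (v a)).
    by move=> a; apply: (@cvgD _ R^o); [exact: uI|exact: vI].
  by apply/funext => a /=; rewrite raddfD.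
Qed.

Lemma integralC_partial_eq0 (i : 'I_n) (F G : tup -> R[i]) :
  (forall q (a : R), is_deriveC a 1 (fun b => F (upd q i b)) (G (upd q i a))) ->
  (forall q, continuousC (fun b : R => G (upd q i b))) ->
  integrableC F -> integrableC G -> integralC G = 0.
Proof.
move=> FG cG [FR FI] [GR GI]; rewrite /integralC /Rintegral.
have -> : (\int[lam]_x ((Rec \o G) x)%:E = 0)%E.
  apply: (@integral_partial_eq0 _ _ i (Rec \o F) (Rec \o G)) => //.
    by move=> q a; have [] := FG q a.
  by move=> q; have [] := cG q.
have -> // : (\int[lam]_x ((Imc \o G) x)%:E = 0)%E.
apply: (@integral_partial_eq0 _ _ i (Imc \o F) (Imc \o G)) => //.
  by move=> q a; have [] := FG q a.
by move=> q; have [] := cG q.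
Qed.

(** The derivative of f K in the i-th integration variable is the product e K below, so its integral
    vanishes. Since the logarithmic derivative of K is affine in that variable, what remains is a
    moment of f. *)
Lemma Phi_by_parts (i : 'I_n) f g p q :
  (forall q (a : R), is_deriveC a 1 (fun b => f (upd q i b)) (g (upd q i a))) ->
  (forall q, continuousC (fun b : R => g (upd q i b))) ->
  L2 f -> L2 g -> L2 (mulq f i) ->
  Phi g p q = k%:C * Phi (mulq f i) p q
    - ((k * tnth q i) +i* (- (k * tnth p i))) * Phi f p q.
Proof.
move=> fg cg Lf Lg Lqf.
pose e q' := g q' + ((((k * tnth q i) +i* (- (k * tnth p i))) * f q'
   + (- k%:C) * mulq f i q')).
have Lb : L2 (fun q' => ((k * tnth q i) +i* (- (k * tnth p i))) * f q'
   + (- k%:C) * mulq f i q').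
  by apply: L2_add; exact: L2_scale.
have Le : L2 e by exact: L2_add.
suff : Phi e p q = 0.
  rewrite /e Phi_add// Phi_add//; [|exact: L2_scale..].
  rewrite !Phi_scale// => H; apply/eqP; rewrite -subr_eq0 -H; apply/eqP; ring.
have dK q' a := kernel_upd_derive C k p q q' i a.
have dF q' (a : R) : is_deriveC a 1 (fun b => f (upd q' i b) * K p q (upd q' i b))
   (e (upd q' i a) * K p q (upd q' i a)).
  apply: (is_deriveC_eq (is_deriveC_mul (fg q' a) (dK q' a))).
  rewrite (_ : (k * (tnth q i - a)) +i* (- (k * tnth p i)) =
    ((k * tnth q i) +i* (- (k * tnth p i))) - k%:C * a%:C); last first.
    by apply/eqP; rewrite eq_complex /= !mul0r !mulr0 !subr0 addr0 subr0 mulrBr !eqxx.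
  by rewrite /e /mulq tnth_upd eqxx; ring.
apply: (@integralC_partial_eq0 i (fun q' => f q' * K p q q')) => //.
- move=> q'; apply: continuousC_mul; last exact: (is_deriveC_continuous (dK q')).
  apply: continuousC_add; first exact: cg.
  have cf := is_deriveC_continuous (fg q').
  have cc (c : R[i]) : continuousC (fun=> c) by split=> a; exact: cvg_cst.
  apply: continuousC_add; apply: continuousC_mul => //.
  rewrite /mulq; apply: continuousC_mul => //.
  split; last by move=> a; exact: cvg_cst.
  rewrite (_ : _ \o _ = id); first by move=> a; exact: cvg_id.
  by apply/funext => a; rewrite /= tnth_upd eqxx.
- exact: integrable_Phi.
- exact: integrable_Phi.
Qed.

End Transform.

(** * Coordinates on spaces of constant forms *)

Section Forms.
Context {R : realType} {E : normedModType R} (ip : {dot E for idfun}).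
Context {r : nat} (T : 'I_r -> E) (hT : euclidean_basis ip T).
Context (k : nat) (hk : (0 < k)%N) (s : R).
Local Notation AC := (formsC E).
Local Notation tup := ((r + r).-tuple R).
Local Notation kap := (abs_level k s).

Lemma ipDl x y z : ip (x + y) z = ip x z + ip y z.
Proof. exact: linearDl. Qed.
Lemma ipZl a x z : ip (a *: x) z = a * ip x z.
Proof. exact: linearZl_LR. Qed.
Lemma ipNl x z : ip (- x) z = - ip x z.
Proof. exact: linearNl. Qed.
Lemma ip0l z : ip 0 z = 0.
Proof. exact: linear0l. Qed.
Definition ipE := (ipDl, ipZl, ipNl, ip0l).

Lemma ip_suml (I : Type) (l : seq I) (F : I -> E) z :
  ip (\sum_(i <- l) F i) z = \sum_(i <- l) ip (F i) z.
Proof.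
by elim: l => [|i l IH]; rewrite ?big_nil ?ip0l// !big_cons ipDl IH.
Qed.

Lemma ipC x y : ip x y = ip y x.
Proof. by rewrite hermC /= expr0 mul1r. Qed.

Lemma ip_comb (c : 'I_r -> R) j : ip (\sum_i c i *: T i) (T j) = c j.
Proof.
have [_ hort _] := hT.
rewrite ip_suml (bigD1 j)//= big1 ?addr0; last first.
  by move=> i ij; rewrite ipZl hort (negbTE ij) mulr0.
by rewrite ipZl hort eqxx mulr1.
Qed.

Lemma form_expand x : x = \sum_j ip x (T j) *: T j.
Proof.
have [_ _ /(_ x)[c xc]] := hT.
by rewrite {1}xc; apply: eq_bigr => j _; rewrite xc ip_comb.
Qed.

Lemma ip_parseval x y : ip x y = \sum_j ip x (T j) * ip y (T j).
Proof.
rewrite {1}(form_expand x) ip_suml; apply: eq_bigr => j _.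
by rewrite ipZl [ip (T j) y]ipC.
Qed.

Lemma eq_form x y : (forall j, ip x (T j) = ip y (T j)) -> x = y.
Proof.
by move=> xy; rewrite (form_expand x) (form_expand y); apply: eq_bigr => j _; rewrite xy.
Qed.

Lemma eq_AC (A B : AC) :
  (forall j, [/\ ip A.1.1 (T j) = ip B.1.1 (T j), ip A.1.2 (T j) = ip B.1.2 (T j),
     ip A.2.1 (T j) = ip B.2.1 (T j) & ip A.2.2 (T j) = ip B.2.2 (T j)]) -> A = B.
Proof.
case: A B => [[a1 a2] [a3 a4]] [[b1 b2] [b3 b4]] /= AB.
by congr (_, _, (_, _)); apply: eq_form => j; have [] := AB j.
Qed.

Lemma kap_gt0 : 0 < kap.
Proof.
rewrite sqrtr_gt0 ltr_pwDl ?sqr_ge0// exprn_gt0// ltr0n//.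
Qed.

Lemma kap_neq0 : kap != 0. Proof. by rewrite gt_eqF// kap_gt0. Qed.

Lemma kap_sqr : kap ^+ 2 = k%:R ^+ 2 + s ^+ 2.
Proof. by rewrite sqr_sqrtr// addr_ge0 ?sqr_ge0. Qed.

Definition nrm (tau : R * R) : R := (Num.sqrt (2 * tau.2))^-1.

Lemma nrm_sqr tau : teich tau -> nrm tau ^+ 2 = (2 * tau.2)^-1.
Proof.
by move=> /= t0; rewrite /nrm exprVn sqr_sqrtr// mulr_ge0// ltW.
Qed.

Lemma nrm_neq0 tau : teich tau -> nrm tau != 0.
Proof.
by move=> /= t0; rewrite invr_eq0 gt_eqF// sqrtr_gt0 mulr_gt0.
Qed.

(** Closed forms for the coordinates that [coords] picks by choice. If A = a dx + b dy with complex
    a and b, then in the notation explained at [bt1] one has W = -i N (b - conj(tau) a) and alpha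
    conj(Z) = i N (b - tau a). [pC] and [qC] are the real and imaginary parts of W and Z. *)
Definition pC (tau : R * R) (A : AC) : tup :=
  [tuple match fintype.split i with
   | inl j => nrm tau * (ip A.2.2 (T j) - tau.1 * ip A.2.1 (T j) + tau.2 * ip A.1.1 (T j))
   | inr j => - (nrm tau * (ip A.1.2 (T j) - tau.1 * ip A.1.1 (T j) - tau.2 * ip A.2.1 (T j)))
   end | i < r + r].

Definition qC (tau : R * R) (A : AC) : tup :=
  [tuple match fintype.split i with
   | inl j => nrm tau / kap *
      (k%:R * (ip A.1.2 (T j) - tau.1 * ip A.1.1 (T j) + tau.2 * ip A.2.1 (T j))
       - s * (ip A.2.2 (T j) - tau.1 * ip A.2.1 (T j) - tau.2 * ip A.1.1 (T j)))
   | inr j => - (nrm tau / kap *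
      (s * (ip A.1.2 (T j) - tau.1 * ip A.1.1 (T j) + tau.2 * ip A.2.1 (T j))
       + k%:R * (ip A.2.2 (T j) - tau.1 * ip A.2.1 (T j) - tau.2 * ip A.1.1 (T j))))
   end | i < r + r].

Lemma split_l (j : 'I_r) : fintype.split (lshift r j) = inl j.
Proof. by rewrite -[lshift r j]/(unsplit (inl j)) unsplitK. Qed.
Lemma split_r (j : 'I_r) : fintype.split (rshift r j) = inr j.
Proof. by rewrite -[rshift r j]/(unsplit (inr j)) unsplitK. Qed.

Lemma pC_l tau A j : tnth (pC tau A) (lshift r j) =
  nrm tau * (ip A.2.2 (T j) - tau.1 * ip A.2.1 (T j) + tau.2 * ip A.1.1 (T j)).
Proof. by rewrite tnth_mktuple split_l. Qed.
Lemma pC_r tau A j : tnth (pC tau A) (rshift r j) =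
  - (nrm tau * (ip A.1.2 (T j) - tau.1 * ip A.1.1 (T j) - tau.2 * ip A.2.1 (T j))).
Proof. by rewrite tnth_mktuple split_r. Qed.
Lemma qC_l tau A j : tnth (qC tau A) (lshift r j) = nrm tau / kap *
      (k%:R * (ip A.1.2 (T j) - tau.1 * ip A.1.1 (T j) + tau.2 * ip A.2.1 (T j))
       - s * (ip A.2.2 (T j) - tau.1 * ip A.2.1 (T j) - tau.2 * ip A.1.1 (T j))).
Proof. by rewrite tnth_mktuple split_l. Qed.
Lemma qC_r tau A j : tnth (qC tau A) (rshift r j) = - (nrm tau / kap *
      (s * (ip A.1.2 (T j) - tau.1 * ip A.1.1 (T j) + tau.2 * ip A.2.1 (T j))
       + k%:R * (ip A.2.2 (T j) - tau.1 * ip A.2.1 (T j) - tau.2 * ip A.1.1 (T j)))).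
Proof. by rewrite tnth_mktuple split_r. Qed.

(* bt1 + i bt2 = alpha conj(Z), where ptP tau p + ptQ tau q =
   N (W dzeta + alpha conj(Z) dzetabar) with N = nrm tau, W = p_j + i p_(j+r),
   Z = q_j + i q_(j+r) and alpha = (s + i k) / |t| *)
Definition bt1 (q : tup) j := (s * tnth q (lshift r j) + k%:R * tnth q (rshift r j)) / kap.
Definition bt2 (q : tup) j := (k%:R * tnth q (lshift r j) - s * tnth q (rshift r j)) / kap.

Definition pt (tau : R * R) (p q : tup) : AC := ptP T tau p + ptQ T k s tau q.

(** The frames unfolded into the components of a form along the T_j. Coordinates are read off, and
    derivatives in tau taken, in this shape. *)
Definition pt_comp (tau : R * R) (p q : tup) : AC :=
  ((\sum_j (nrm tau * (tnth p (lshift r j) + bt1 q j)) *: T j,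
    \sum_j (nrm tau * (tnth p (lshift r j) * tau.1 - tnth p (rshift r j) * tau.2
        + bt1 q j * tau.1 + bt2 q j * tau.2)) *: T j),
   (\sum_j (nrm tau * (tnth p (rshift r j) + bt2 q j)) *: T j,
    \sum_j (nrm tau * (tnth p (lshift r j) * tau.2 + tnth p (rshift r j) * tau.1
        - bt1 q j * tau.2 + bt2 q j * tau.1)) *: T j)).

Lemma fst_sum (U V : lmodType R) (I : Type) (l : seq I) (F : I -> U * V) :
  (\sum_(i <- l) F i).1 = \sum_(i <- l) (F i).1.
Proof. by elim: l => [|i l IH]; rewrite ?big_nil// !big_cons /= IH. Qed.
Lemma snd_sum (U V : lmodType R) (I : Type) (l : seq I) (F : I -> U * V) :
  (\sum_(i <- l) F i).2 = \sum_(i <- l) (F i).2.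
Proof. by elim: l => [|i l IH]; rewrite ?big_nil// !big_cons /= IH. Qed.

Lemma pt_compE tau p q : teich tau -> pt tau p q = pt_comp tau p q.
Proof.
move=> t0; have t2 : tau.2 != 0 by rewrite gt_eqF.
have K0 := kap_neq0.
have [_ hort _] := hT.
have N0 := nrm_neq0 t0.
have E4 (A B : AC) : A.1.1 = B.1.1 -> A.1.2 = B.1.2 -> A.2.1 = B.2.1 ->
    A.2.2 = B.2.2 -> A = B.
  by case: A B => [[? ?] [? ?]] [[? ?] [? ?]] /= -> -> -> ->.
rewrite /pt /ptP /ptQ !big_split_ord /= -!big_split /=.
by apply: E4; rewrite /pt_comp /= ?fst_sum ?snd_sum ?fst_sum ?snd_sum;
  apply: eq_bigr => j _; apply: eq_form => i;
  rewrite /frameY /frameX !split_l !split_r /= /frame_half -/(nrm tau)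
    !ipE /bt1 /bt2; field; rewrite K0.
Qed.

(** Used from right to left: the relations N^2 (2 tau_2) = 1 and (k^2 + s^2) / |t|^2 = 1 are
    inserted as factors 1, after which both sides agree as rational functions with N and |t| treated
    as free variables. *)
Lemma eq1_mul (a x : R) : a = 1 -> a * x = x.
Proof. by move=> ->; rewrite mul1r. Qed.

Lemma pC_pt tau p q : teich tau -> pC tau (pt tau p q) = p.
Proof.
move=> t0; have t2 : tau.2 != 0 by rewrite gt_eqF.
have N2 := nrm_sqr t0; have K0 := kap_neq0.
have N2' : nrm tau * nrm tau * (2 * tau.2) = 1.
  by rewrite -expr2 N2 mulVf// mulf_neq0.
rewrite pt_compE//; apply: eq_tuple_split => j.
- rewrite pC_l /= !ip_comb -[RHS](eq1_mul _ N2'); ring.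
- rewrite pC_r /= !ip_comb -[RHS](eq1_mul _ N2'); ring.
Qed.

Lemma qC_pt tau p q : teich tau -> qC tau (pt tau p q) = q.
Proof.
move=> t0; have t2 : tau.2 != 0 by rewrite gt_eqF.
have N2 := nrm_sqr t0; have K0 := kap_neq0.
have N2' : nrm tau * nrm tau * (2 * tau.2) = 1.
  by rewrite -expr2 N2 mulVf// mulf_neq0.
have K2 : (k%:R ^+ 2 + s ^+ 2) / kap ^+ 2 = 1.
  by rewrite -kap_sqr divff// expf_neq0.
rewrite pt_compE//; apply: eq_tuple_split => j.
- rewrite qC_l /= !ip_comb -[RHS](eq1_mul _ N2') -[RHS](eq1_mul _ K2) /bt1 /bt2.
  by field; rewrite K0.
- rewrite qC_r /= !ip_comb -[RHS](eq1_mul _ N2') -[RHS](eq1_mul _ K2) /bt1 /bt2.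
  by field; rewrite K0.
Qed.

Lemma pt_pCqC tau A : teich tau -> pt tau (pC tau A) (qC tau A) = A.
Proof.
move=> t0; have t2 : tau.2 != 0 by rewrite gt_eqF.
have N2 := nrm_sqr t0; have K0 := kap_neq0.
have N2' : nrm tau * nrm tau * (2 * tau.2) = 1.
  by rewrite -expr2 N2 mulVf// mulf_neq0.
have K2 : (k%:R ^+ 2 + s ^+ 2) / kap ^+ 2 = 1.
  by rewrite -kap_sqr divff// expf_neq0.
have B1 j : bt1 (qC tau A) j = nrm tau *
    - (ip A.2.2 (T j) - tau.1 * ip A.2.1 (T j) - tau.2 * ip A.1.1 (T j)).
  rewrite /bt1 qC_l qC_r -[RHS](eq1_mul _ K2); by field; rewrite K0.
have B2 j : bt2 (qC tau A) j = nrm tau *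
    (ip A.1.2 (T j) - tau.1 * ip A.1.1 (T j) + tau.2 * ip A.2.1 (T j)).
  rewrite /bt2 qC_l qC_r -[RHS](eq1_mul _ K2); by field; rewrite K0.
rewrite pt_compE//; apply: eq_AC => j; split => /=; rewrite ip_comb ?pC_l ?pC_r ?B1 ?B2.
- rewrite -[RHS](eq1_mul _ N2'); ring.
- rewrite -[RHS](eq1_mul _ N2'); ring.
- rewrite -[RHS](eq1_mul _ N2'); ring.
- rewrite -[RHS](eq1_mul _ N2'); ring.
Qed.

(** [pt_pCqC] provides a decomposition, which excludes the default value of [xget]; [pC_pt] and
    [qC_pt] show that it is the only one. *)
Lemma coordsE tau A : teich tau -> coords T k s tau A = (pC tau A, qC tau A).
Proof.
move=> t0; rewrite /coords.
case: xgetP => [[p q] _ /= ->|/(_ (pC tau A, qC tau A))[]].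
  by rewrite -/(pt _ _ _) pC_pt// qC_pt.
by rewrite /= -/(pt _ _ _) pt_pCqC.
Qed.

Lemma pC_lin tau A e h : pC tau (h *: e + A) = lin (pC tau A) (pC tau e) h.
Proof.
by apply: eq_tuple_split => j; rewrite tnth_lin ?pC_l ?pC_r /= !ipE; ring.
Qed.

Lemma qC_lin tau A e h : qC tau (h *: e + A) = lin (qC tau A) (qC tau e) h.
Proof.
have K0 := kap_neq0.
by apply: eq_tuple_split => j; rewrite tnth_lin ?qC_l ?qC_r /= !ipE; field.
Qed.

Lemma omega_tE tau A e : teich tau -> omega_t ip k s A e =
  kap * \sum_i (tnth (pC tau A) i * tnth (qC tau e) i - tnth (qC tau A) i * tnth (pC tau e) i).
Proof.
move=> t0; have t2 : tau.2 != 0 by rewrite gt_eqF.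
have N2 := nrm_sqr t0; have K0 := kap_neq0.
rewrite /omega_t /level /omegaC /ipC /=.
rewrite !(ip_parseval A.1.1) !(ip_parseval A.1.2) !(ip_parseval A.2.1) !(ip_parseval A.2.2).
rewrite -!sumrB -!big_split /= -!sumrB !mulr_sumr -!sumrB big_split_ord /= -big_split /=.
apply: eq_bigr => j _; rewrite !pC_l !pC_r !qC_l !qC_r.
transitivity ((nrm tau ^+ 2 * (2 * tau.2)) * (
 k%:R * (ip A.1.1 (T j) * ip e.1.2 (T j) - ip A.2.1 (T j) * ip e.2.2 (T j) -
  (ip A.1.2 (T j) * ip e.1.1 (T j) - ip A.2.2 (T j) * ip e.2.1 (T j))) -
 s * (ip A.1.1 (T j) * ip e.2.2 (T j) + ip A.2.1 (T j) * ip e.1.2 (T j) -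
  (ip A.1.2 (T j) * ip e.2.1 (T j) + ip A.2.2 (T j) * ip e.1.1 (T j))))).
  by rewrite N2 mulVf ?mul1r// mulf_neq0.
by field.
Qed.

Definition bconst : R := (kap ^+ 3 / (4 * pi ^+ 3)) `^ (r%:R / 2).

Lemma bargmannE tau (psi : AC -> R[i]) A : teich tau ->
  bargmann T k s tau psi A =
  Phi bconst kap (fun q' => psi (ptQ T k s tau q')) (pC tau A) (qC tau A).
Proof. by move=> t0; rewrite /bargmann coordsE. Qed.

End Forms.

(** * Covariant derivatives of a transformed function *)

Section HolomorphicNabla.
Context {R : realType} {E : normedModType R} (ip : {dot E for idfun}).
Context {r : nat} (T : 'I_r -> E) (hT : euclidean_basis ip T).
Context (k : nat) (hk : (0 < k)%N) (s : R).
Local Notation AC := (formsC E).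
Local Notation tup := ((r + r).-tuple R).
Local Notation kap := (abs_level k s).
Local Notation pC := (pC ip T).
Local Notation qC := (qC ip T k s).
Context (tau : R * R) (t0 : teich tau).
Implicit Types (f : tup -> R[i]) (A e : AC).

Definition tr f A : R[i] := Phi (@bconst R r k s) kap f (pC tau A) (qC tau A).

(** Equals -i |t| z_i(e) for the holomorphic coordinate z = p + i q, and is the coefficient of q'_i
    in the logarithmic derivative of the kernel along e. *)
Definition cf e (i : 'I_(r + r)) : R[i] :=
  (kap * tnth (qC tau e) i) +i* (- (kap * tnth (pC tau e) i)).

Lemma tr_derive f A e : L2 f -> (forall i, L2 (mulq f i)) ->
  is_deriveC A e (tr f)
   (\sum_i cf e i * tr (mulq f i) A +
    ((- (kap * \sum_j tnth (qC tau e) j * tnth (qC tau A) j)) +i*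
     (kap / 2 * \sum_j (tnth (pC tau e) j * tnth (qC tau A) j +
       tnth (qC tau e) j * tnth (pC tau A) j))) * tr f A).
Proof.
move=> Lf Lqf; apply: ((is_deriveC_line _ _ _ _).1 _).
rewrite (_ : (fun h => _) = fun h : R => Phi (@bconst R r k s) kap f
   (lin (pC tau A) (pC tau e) h) (lin (qC tau A) (qC tau e) h)).
  exact: (Phi_line_derive _ (kap_gt0 hk s)).
by apply/funext => h; rewrite /tr pC_lin// (qC_lin _ _ hk).
Qed.

(** The symplectic potential combines with the part of the logarithmic derivative that is free of q'
    into - sum_i cf_i q_i(A). The result depends on e only through its holomorphic coordinates,
    which expresses the holomorphy of the transform. *)
Lemma nabla_tr f A e : L2 f -> (forall i, L2 (mulq f i)) ->
  nabla (omega_t ip k s) e (tr f) A =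
  \sum_i cf e i * (tr (mulq f i) A - (tnth (qC tau A) i)%:C * tr f A).
Proof.
move=> Lf Lqf; rewrite /nabla (is_deriveC_val (tr_derive A e Lf Lqf)).
set S := \sum_i cf e i * tr (mulq f i) A; set X := (_ +i* _).
have key : X - (0 +i* (omega_t ip k s A e / 2)) =
    - \sum_i cf e i * (tnth (qC tau A) i)%:C.
  rewrite (omega_tE hT hk s A e t0); apply/eqP; rewrite eq_complex -sumrN.
  apply/andP; split; apply/eqP; rewrite !raddf_sum /=.
  - rewrite subr0 mulr_sumr -sumrN; apply: eq_bigr => j _; ring.
  - by rewrite !mulr_sumr mulr_suml -sumrB; apply: eq_bigr => j _; field.
rewrite (_ : \sum_i _ * (_ - _) =
    S - (\sum_i cf e i * (tnth (qC tau A) i)%:C) * tr f A); last first.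
  by rewrite mulr_suml -sumrB; apply: eq_bigr => i _; ring.
rewrite (_ : \sum_i _ * _%:C = - (X - (0 +i* (omega_t ip k s A e / 2)))); last first.
  by rewrite key opprK.
ring.
Qed.

Lemma qC_derive A e i :
  is_deriveC A e (fun A => (tnth (qC tau A) i)%:C) (tnth (qC tau e) i)%:C.
Proof.
apply: is_deriveC_real; apply: ((is_derive_line _ _ _ _).1 _).
rewrite (_ : (fun h => _) = fun h : R => tnth (qC tau A) i + h * tnth (qC tau e) i).
  have H := is_derive_addf (is_derive_cstf 0 (1:R) (tnth (qC tau A) i))
    (is_derive_mulf (is_derive_id 0 (1 : R)) (is_derive_cstf 0 (1:R) (tnth (qC tau e) i))).
  by apply: (is_derive_eqf H); rewrite /=; ring.
by apply: funext => h; rewrite (qC_lin _ _ hk) tnth_lin.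
Qed.

(** Iterate [nabla_tr]. The extra term with [qC tau e'] arises from differentiating the coefficient
    q_i(A); it disappears after contraction in [sum_uC_Bform]. *)
Lemma nabla2_tr f A e e' : L2 f -> (forall i, L2 (mulq f i)) ->
  (forall i l, L2 (mulq (mulq f i) l)) ->
  nabla (omega_t ip k s) e' (nabla (omega_t ip k s) e (tr f)) A =
  \sum_i cf e i * (\sum_l cf e' l *
     (tr (mulq (mulq f i) l) A - (tnth (qC tau A) l)%:C * tr (mulq f i) A
      - (tnth (qC tau A) i)%:C * tr (mulq f l) A
      + (tnth (qC tau A) i)%:C * (tnth (qC tau A) l)%:C * tr f A)
     - (tnth (qC tau e') i)%:C * tr f A).
Proof.
move=> Lf Lqf Lqqf.
have -> : nabla (omega_t ip k s) e (tr f) = fun A =>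
    \sum_i cf e i * (tr (mulq f i) A - (tnth (qC tau A) i)%:C * tr f A).
  by apply/funext => B; exact: nabla_tr.
have dF := is_deriveC_derivable (tr_derive A e' Lf Lqf).
have {}dF := derivableCP dF.
have dFi i := derivableCP (is_deriveC_derivable (tr_derive A e' (Lqf i) (Lqqf i))).
have nF : deriveC e' (tr f) A = nabla (omega_t ip k s) e' (tr f) A +
   (0 +i* (omega_t ip k s A e' / 2)) * tr f A by rewrite /nabla subrK.
have nFi i : deriveC e' (tr (mulq f i)) A = nabla (omega_t ip k s) e' (tr (mulq f i)) A +
   (0 +i* (omega_t ip k s A e' / 2)) * tr (mulq f i) A by rewrite /nabla subrK.
have H := is_deriveC_sum (index_enum 'I_(r + r)) (fun i => is_deriveC_scale (cf e i)
   (is_deriveC_add (dFi i) (is_deriveC_scale (-1)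
     (is_deriveC_mul (qC_derive A e' i) dF)))).
rewrite {1}/nabla.
rewrite (_ : (fun A => \sum_i cf e i * (tr (mulq f i) A - (tnth (qC tau A) i)%:C * tr f A)) =
  fun A => \sum_i cf e i * (tr (mulq f i) A + -1 * ((tnth (qC tau A) i)%:C * tr f A))); last first.
  by apply/funext => B; apply: eq_bigr => i _; rewrite mulN1r.
rewrite (is_deriveC_val H) mulr_sumr -sumrB; apply: eq_bigr => i _.
rewrite nF nFi !nabla_tr//.
set S1 := \sum_(l < _) _; set S2 := \sum_(l < _) _; set S3 := \sum_(l < _) _.
have -> : S3 = S1 - (tnth (qC tau A) i)%:C * S2.
  by rewrite mulr_sumr -sumrB; apply: eq_bigr => l _; ring.
ring.
Qed.

End HolomorphicNabla.

(** * Variation of the Kaehler structures *)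

Section TauCalculus.
Context {R : realType}.
Implicit Types (tau v : R * R).

Lemma is_derive_invf {W : normedModType R} (x v : W) (f : W -> R) (a : R) :
  f x != 0 -> is_derive x v f a ->
  is_derive x v (fun y => (f y)^-1) (- a / f x ^+ 2).
Proof.
move=> f0 [df dE]; apply: DeriveDef; first exact: derivableV.
by rewrite deriveV// dE /GRing.scale /= mulrC mulNr mulrN.
Qed.

Lemma is_derive_fst tau v : is_derive tau v (fun sg : R * R => sg.1) v.1.
Proof.
apply: (is_derive_line (fun sg : R * R => sg.1) tau v v.1).1.
have H := is_derive_addf (is_derive_mulf (is_derive_id 0 (1 : R)) (is_derive_cstf 0 (1:R) v.1))
  (is_derive_cstf 0 (1:R) tau.1).
by apply: (is_derive_eqf H); rewrite /=; ring.
Qed.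

Lemma is_derive_snd tau v : is_derive tau v (fun sg : R * R => sg.2) v.2.
Proof.
apply: (is_derive_line (fun sg : R * R => sg.2) tau v v.2).1.
have H := is_derive_addf (is_derive_mulf (is_derive_id 0 (1 : R)) (is_derive_cstf 0 (1:R) v.2))
  (is_derive_cstf 0 (1:R) tau.2).
by apply: (is_derive_eqf H); rewrite /=; ring.
Qed.

Lemma near_teich tau : teich tau -> \forall sg \near tau, teich sg.
Proof.
move=> t0; apply: open_nbhs_nbhs; split => //.
have : open ((@snd R R) @^-1` [set x | 0 < x]).
  by apply: open_comp; [move=> ? _; exact: cvg_snd|exact: open_gt].
by [].
Qed.

Definition d_eta (eta : R) : R[i] * R[i] := (2^-1 +i* 0, 0 +i* (- (eta / 2))).

Lemma d_tauE : d_tau = d_eta 1. Proof. by rewrite /d_tau /d_eta mul1r. Qed.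
Lemma d_taubarE : d_taubar = d_eta (-1).
Proof. by rewrite /d_taubar /d_eta mulN1r opprK. Qed.

Lemma Dtau_val V F tau a b : is_deriveC tau ((1, 0) : R * R) F a ->
  is_deriveC tau ((0, 1) : R * R) F b -> Dtau V F tau = V.1 * a + V.2 * b.
Proof. by move=> Fa Fb; rewrite /Dtau (is_deriveC_val Fa) (is_deriveC_val Fb). Qed.

Lemma near_is_deriveC {W : normedModType R} (f g : W -> R[i]) (x v : W) a :
  (\forall y \near x, f y = g y) -> is_deriveC x v f a -> is_deriveC x v g a.
Proof.
move=> fg [fR fI]; split.
- by apply: near_eq_is_derive fR; apply: filterS fg => y /= ->.
- by apply: near_eq_is_derive fI; apply: filterS fg => y /= ->.
Qed.

End TauCalculus.

(** * Matrices of the metric and of the Hodge star *)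

Section MetricMatrices.
Context {R : realType} {E : normedModType R} (ip : {dot E for idfun}).
Context {r : nat} (T : 'I_r -> E) (hT : euclidean_basis ip T).
Implicit Types (tau : R * R).

Lemma split_orthonormal i j : ip (T i) (T j) = (i == j)%:R.
Proof. by have [_ + _] := hT. Qed.

(** [jx] and [xy] read an index of [basis0] as a pair: the index of T and the choice between dx and
    dy. *)
Definition jx (a : 'I_(r + r)) : 'I_r := match fintype.split a with inl j => j | inr j => j end.
Definition xy (a : 'I_(r + r)) : bool := match fintype.split a with inl _ => false | inr _ => true end.

Definition ginv tau (x y : bool) : R :=
  if x then if y then (tau.1 ^+ 2 + tau.2 ^+ 2) / tau.2 else tau.1 / tau.2
  else if y then tau.1 / tau.2 else tau.2^-1.

Definition gmat tau (x y : bool) : R :=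
  if x then if y then tau.2^-1 else - (tau.1 / tau.2)
  else if y then - (tau.1 / tau.2) else (tau.1 ^+ 2 + tau.2 ^+ 2) / tau.2.

Lemma sum_delta {K : pzRingType} (i : 'I_r) (F : 'I_(r + r) -> K) :
  \sum_b (i == jx b)%:R * F b = F (lshift r i) + F (rshift r i).
Proof.
rewrite big_split_ord /=; congr (_ + _).
- rewrite (bigD1 i)//= big1 ?addr0 /jx ?split_l ?eqxx ?mul1r// => j ji.
  by rewrite split_l eq_sym (negbTE ji) mul0r.
- rewrite (bigD1 i)//= big1 ?addr0 /jx ?split_r ?eqxx ?mul1r// => j ji.
  by rewrite split_r eq_sym (negbTE ji) mul0r.
Qed.

Lemma jx_l j : jx (lshift r j) = j. Proof. by rewrite /jx split_l. Qed.
Lemma jx_r j : jx (rshift r j) = j. Proof. by rewrite /jx split_r. Qed.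
Lemma xy_l j : xy (lshift r j) = false. Proof. by rewrite /xy split_l. Qed.
Lemma xy_r j : xy (rshift r j) = true. Proof. by rewrite /xy split_r. Qed.

(* m (x) 1_r, where false and true stand for dx and dy *)
Definition tens {K : pzRingType} (m : bool -> bool -> K) : 'M[K]_(r + r) :=
  \matrix_(a, b) ((jx a == jx b)%:R * m (xy a) (xy b)).

Lemma tensM {K : pzRingType} (m m' : bool -> bool -> K) :
  tens m *m tens m' =
  tens (fun x y => m x false * m' false y + m x true * m' true y).
Proof.
apply/matrixP => c d; rewrite !mxE.
under eq_bigr do rewrite !mxE -mulrA.
rewrite sum_delta jx_l jx_r xy_l xy_r.
by case: eqVneq => _ /=; rewrite ?mul1r ?mul0r ?mulr0 ?addr0.
Qed.

Lemma eq_tens {K : pzRingType} (m m' : bool -> bool -> K) :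
  (forall x y, m x y = m' x y) -> tens m = tens m'.
Proof. by move=> mm; apply/matrixP => a b; rewrite !mxE mm. Qed.

Lemma tens1 {K : pzRingType} : 1%:M = tens (fun x y => (x == y)%:R) :> 'M[K]_(r + r).
Proof.
apply/matrixP => c d; rewrite !mxE -natrM mulnb; congr (_%:R); congr nat_of_bool.
rewrite -(splitK c) -(splitK d) /jx /xy !unsplitK.
case: (fintype.split c) => i; case: (fintype.split d) => j /=;
  rewrite ?andbT ?andbF ?(inj_eq (@lshift_inj _ _)) ?(inj_eq (@rshift_inj _ _))//.
- exact: eq_lrshift.
- exact: eq_rlshift.
Qed.

Lemma invmx_eq n (A B : 'M[R]_n) : A *m B = 1%:M -> invmx A = B.
Proof.
move=> AB; have [uA _] := mulmx1_unit AB.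
by rewrite -[invmx A]mulmx1 -AB mulKmx.
Qed.

Lemma metric_basis tau a b : teich tau ->
  metric ip tau (basis0 T a) (basis0 T b) = (jx a == jx b)%:R * gmat tau (xy a) (xy b).
Proof.
move=> t0; have t2 : tau.2 != 0 by rewrite gt_eqF.
rewrite /metric /omega /hodge /basis0 /gmat /jx /xy.
by case: (fintype.split a) => i; case: (fintype.split b) => j /=;
  rewrite !(ipC _ (T i)) ?(ipC _ 0) !ipE !split_orthonormal eq_sym; field.
Qed.

Lemma metric_tens tau : teich tau ->
  \matrix_(a, b) metric ip tau (basis0 T a) (basis0 T b) = tens (gmat tau).
Proof. by move=> t0; apply/matrixP => a b; rewrite !mxE metric_basis. Qed.

Lemma gmat_ginv tau : teich tau -> tens (gmat tau) *m tens (ginv tau) = 1%:M.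
Proof.
move=> t0; have t2 : tau.2 != 0 by rewrite gt_eqF.
rewrite tensM tens1; apply: eq_tens => -[] [] /=; rewrite /gmat /ginv ?mulr1n ?mulr0n; by field.
Qed.

Lemma inv_bivector_metric tau : teich tau ->
  inv_bivector (metric ip tau) (basis0 T) = tens (ginv tau).
Proof.
by move=> t0; rewrite /inv_bivector metric_tens//; apply/invmx_eq/gmat_ginv.
Qed.

Definition hmat tau (x y : bool) : R :=
  if x then if y then - (tau.1 / tau.2) else (tau.1 ^+ 2 + tau.2 ^+ 2) / tau.2
  else if y then - tau.2^-1 else tau.1 / tau.2.

Lemma endo_hodge tau : teich tau ->
  endo_mx (basis0 T) (Defs.coord0 ip T) (hodge tau) = tens (hmat tau).
Proof.
move=> t0; have t2 : tau.2 != 0 by rewrite gt_eqF.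
apply/matrixP => a b; rewrite !mxE /basis0 /Defs.coord0 /hodge /jx /xy /hmat.
by case: (fintype.split a) => i; case: (fintype.split b) => j /=;
  rewrite !ipE ?split_orthonormal eq_sym; field.
Qed.

Section Variation.
Context (eta : R) (heta : eta = 1 \/ eta = -1).

Definition ceta tau : R[i] := 0 +i* (- (eta / (2 * tau.2 ^+ 2))).
Definition veta tau (x : bool) : R[i] := if x then tau.1 +i* (- (eta * tau.2)) else 1.
Definition Veta tau : 'M[R[i]]_(r + r) :=
  tens (fun x y => ceta tau * veta tau x * veta tau y).

(** The constant [c] stands for the Kronecker symbol that multiplies the entries of [tens]. *)
Lemma Dtau_ginv tau (c : R) x y : teich tau ->
  - Dtau (d_eta eta) (fun sg => (c * ginv sg x y)%:C) tau =
  c%:C * (ceta tau * veta tau x * veta tau y).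
Proof.
move=> t0; have t2 : tau.2 != 0 by rewrite gt_eqF.
have d1 v := is_derive_fst tau v.
have d2 v := is_derive_snd tau v.
have dV v := is_derive_invf t2 (d2 v).
have d12 v := is_derive_mulf (d1 v) (dV v).
have dN v := is_derive_mulf (is_derive_addf (is_derive_mulf (d1 v) (d1 v))
  (is_derive_mulf (d2 v) (d2 v))) (dV v).
have fin (F : R * R -> R) (a b : R) :
   is_derive tau ((1,0) : R * R) F a -> is_derive tau ((0,1) : R * R) F b ->
   (- (2^-1 * a) +i* (eta / 2 * b)) = ceta tau * veta tau x * veta tau y ->
   - Dtau (d_eta eta) (fun sg => (c * F sg)%:C) tau =
   c%:C * (ceta tau * veta tau x * veta tau y).
  move=> Fa Fb <-; rewrite (Dtau_val _ (is_deriveC_real (is_derive_scalef c Fa))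
    (is_deriveC_real (is_derive_scalef c Fb))) /=.
  by apply: complex_ext => /=; field.
rewrite /ginv; case: x fin => fin; case: y fin => fin.
- apply: (fin _ _ _ (dN _) (dN _)).
  by rewrite /ceta /veta; case: heta => ->; apply: complex_ext => /=; field.
- apply: (fin _ _ _ (d12 _) (d12 _)).
  by rewrite /ceta /veta; case: heta => ->; apply: complex_ext => /=; field.
- apply: (fin _ _ _ (d12 _) (d12 _)).
  by rewrite /ceta /veta; case: heta => ->; apply: complex_ext => /=; field.
- apply: (fin _ _ _ (dV _) (dV _)).
  by rewrite /ceta /veta; case: heta => ->; apply: complex_ext => /=; field.
Qed.

End Variation.

End MetricMatrices.

Section VariationMatrices.
Context {R : realType} {E : normedModType R} (ip : {dot E for idfun}).
Context {r : nat} (T : 'I_r -> E) (hT : euclidean_basis ip T).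
Context (k : nat) (hk : (0 < k)%N) (s : R).
Context (eta : R) (heta : eta = 1 \/ eta = -1) (tau : R * R) (t0 : teich tau).
Local Notation kap := (abs_level k s).
Local Notation V := (@Veta R r eta tau).
Local Notation HC := (@tens r R[i] (fun x y => (hmat tau x y)%:C)).
Local Notation ei := (0 +i* eta : R[i]).

Lemma near_eq_Dtau W (F G : R * R -> R[i]) :
  (\forall sg \near tau, F sg = G sg) -> Dtau W F tau = Dtau W G tau.
Proof.
move=> FG; rewrite /Dtau /deriveC.
have FR v : 'D_v (Rec \o F) tau = 'D_v (Rec \o G) tau.
  by apply: near_eq_derive; apply: filterS FG => y /= ->.
have FI v : 'D_v (Imc \o F) tau = 'D_v (Imc \o G) tau.
  by apply: near_eq_derive; apply: filterS FG => y /= ->.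
by rewrite !FR !FI.
Qed.

Lemma variation_metric : Defs.variation (d_eta eta) (metric ip) (basis0 T) tau = V.
Proof.
apply/matrixP => a b; rewrite !mxE.
transitivity (- Dtau (d_eta eta) (fun sg => ((jx a == jx b)%:R * ginv sg (xy a) (xy b))%:C) tau); last first.
  by rewrite (Dtau_ginv heta)// rmorph_nat.
congr (- _).
apply: near_eq_Dtau; have := near_teich t0; apply: filterS => sg sg0.
by rewrite (inv_bivector_metric hT)// mxE.
Qed.

(** The vector v is an eigenvector of the Hodge star for the eigenvalue i eta. So V is of type (2,0)
    for eta = 1 and of type (0,2) for eta = -1. *)
Lemma HCV : HC *m V = ei *: V.
Proof.
have t2 : tau.2 != 0 by rewrite gt_eqF.
have key x : (hmat tau x false)%:C * veta eta tau false +
    (hmat tau x true)%:C * veta eta tau true = ei * veta eta tau x.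
  rewrite /hmat /veta; case: x; case: heta => ->;
    by apply: complex_ext => /=; field.
rewrite tensM /Veta; apply/matrixP => a b; rewrite !mxE [RHS]mulrCA; congr (_ * _).
rewrite [RHS](_ : _ = ceta eta tau * (ei * veta eta tau (xy a)) * veta eta tau (xy b)).
  by rewrite -key; ring.
by ring.
Qed.

Lemma Veta_tr : V^T = V.
Proof.
by apply/matrixP => a b; rewrite !mxE eq_sym -!mulrA [veta _ _ _ * _]mulrC.
Qed.

Lemma VHC : V *m HC^T = ei *: V.
Proof. by rewrite -[LHS]trmxK trmx_mul trmxK Veta_tr HCV linearZ /= Veta_tr. Qed.

Lemma proj10_hodge : proj10 (endo_mx (basis0 T) (Defs.coord0 ip T) (hodge tau)) =
  2^-1 *: (1%:M - 'i *: HC).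
Proof.
rewrite (endo_hodge hT t0); apply/matrixP => a b; rewrite !mxE.
case: (jx a == jx b); case: (a == b);
  by apply: complex_ext => /=; field.
Qed.

Lemma proj01_hodge : proj01 (endo_mx (basis0 T) (Defs.coord0 ip T) (hodge tau)) =
  2^-1 *: (1%:M + 'i *: HC).
Proof.
rewrite (endo_hodge hT t0); apply/matrixP => a b; rewrite !mxE.
case: (jx a == jx b); case: (a == b);
  by apply: complex_ext => /=; field.
Qed.

Lemma proj_V (c : R[i]) (P : 'M[R[i]]_(r + r)) :
  P = 2^-1 *: (1%:M + c *: HC) ->
  P *m V *m P^T = (2^-1 * (1 + c * ei)) ^+ 2 *: V.
Proof.
move=> ->.
have -> : (2^-1 *: (1%:M + c *: HC))^T = 2^-1 *: (1%:M + c *: HC^T).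
  by apply/matrixP => a b; rewrite !mxE [b == a]eq_sym.
have PV : (2^-1 *: (1%:M + c *: HC)) *m V = (2^-1 * (1 + c * ei)) *: V.
  rewrite -scalemxAl mulmxDl mul1mx -scalemxAl HCV scalerDr !scalerA -scalerDl.
  by congr (_ *: _); ring.
have VP : V *m (2^-1 *: (1%:M + c *: HC^T)) = (2^-1 * (1 + c * ei)) *: V.
  rewrite -scalemxAr mulmxDr mulmx1 -scalemxAr VHC scalerDr !scalerA -scalerDl.
  by congr (_ *: _); ring.
by rewrite PV -scalemxAl VP scalerA expr2.
Qed.

Lemma HW_G_eta : HW_G ip T (d_eta eta) tau = ((1 + eta) / 2)%:C *: V.
Proof.
rewrite /HW_G variation_metric /part20 (@proj_V (- 'i)); last first.
  by rewrite proj10_hodge scaleNr.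
congr (_ *: _); case: heta => ->;
  by apply: complex_ext => /=; field.
Qed.

Lemma HW_Gbar_eta : HW_Gbar ip T (d_eta eta) tau = ((1 - eta) / 2)%:C *: V.
Proof.
rewrite /HW_Gbar variation_metric /part02 (@proj_V 'i); last exact: proj01_hodge.
congr (_ *: _); case: heta => ->;
  by apply: complex_ext => /=; field.
Qed.

(** The terms mixing real and imaginary parts cancel, and the others carry the factor (k^2 + s^2) /
    |t|^2 = 1; the metric is thus independent of t. *)
Lemma metricCE sg A B : teich sg -> metricC ip k s sg A B =
  metric ip sg A.1 B.1 + metric ip sg A.2 B.2.
Proof.
move=> sg0; have t2 : sg.2 != 0 by rewrite gt_eqF.
have K0 := kap_neq0 hk s; have K2 := kap_sqr k s.
transitivity ((k%:R ^+ 2 + s ^+ 2) / kap ^+ 2 *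
  (metric ip sg A.1 B.1 + metric ip sg A.2 B.2)); last first.
  by rewrite -K2 divff ?mul1r// expf_neq0.
rewrite /metricC /omega_t /level /omegaC /ipC /metric /omega /cplx_I /=.
rewrite !(ipC ip A.1.1) !(ipC ip A.1.2) !(ipC ip A.2.1) !(ipC ip A.2.2).
by rewrite !ipE; field; rewrite t2 K0.
Qed.

(** The action of the (1,0)-projection of I_{tau,t} on the range of V, where false and true stand
    for the real and imaginary part. It is a symmetric projection of rank one: its trace is 1 and
    its determinant 0. *)
Definition piC (a b : bool) : R :=
  if a then if b then (1 - eta * k%:R / kap) / 2 else - (eta * s / kap) / 2
  else if b then - (eta * s / kap) / 2 else (1 + eta * k%:R / kap) / 2.

Lemma basisC_l a : basisC T (lshift (r + r) a) = (basis0 T a, 0).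
Proof. by rewrite /basisC -[lshift _ a]/(unsplit (inl a)) unsplitK. Qed.
Lemma basisC_r a : basisC T (rshift (r + r) a) = (0, basis0 T a).
Proof. by rewrite /basisC -[rshift _ a]/(unsplit (inr a)) unsplitK. Qed.
Lemma coordC_l A a : coordC ip T A (lshift (r + r) a) = Defs.coord0 ip T A.1 a.
Proof. by rewrite /coordC -[lshift _ a]/(unsplit (inl a)) unsplitK. Qed.
Lemma coordC_r A a : coordC ip T A (rshift (r + r) a) = Defs.coord0 ip T A.2 a.
Proof. by rewrite /coordC -[rshift _ a]/(unsplit (inr a)) unsplitK. Qed.

Lemma metric0l A : metric ip tau 0 A = 0.
Proof. by rewrite /metric /omega /= !ip0l subrr. Qed.
Lemma metric0r A : metric ip tau A 0 = 0.
Proof.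
by rewrite /metric /omega /hodge /= !scaler0 subrr !scaler0 !(ipC ip _ 0) !ip0l subrr.
Qed.

End VariationMatrices.

Section VariationMatricesC.
Context {R : realType} {E : normedModType R} (ip : {dot E for idfun}).
Context {r : nat} (T : 'I_r -> E) (hT : euclidean_basis ip T).
Context (k : nat) (hk : (0 < k)%N) (s : R).
Context (eta : R) (heta : eta = 1 \/ eta = -1) (tau : R * R) (t0 : teich tau).
Local Notation kap := (abs_level k s).
Local Notation V := (@Veta R r eta tau).
Local Notation HC := (@tens r R[i] (fun x y => (hmat tau x y)%:C)).
Local Notation ei := (0 +i* eta : R[i]).

Lemma eq_mx4 {K : Type} n m (A B : 'M[K]_(n + m, n + m)) :
  (forall a b, A (lshift m a) (lshift m b) = B (lshift m a) (lshift m b)) ->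
  (forall a b, A (lshift m a) (rshift n b) = B (lshift m a) (rshift n b)) ->
  (forall a b, A (rshift n a) (lshift m b) = B (rshift n a) (lshift m b)) ->
  (forall a b, A (rshift n a) (rshift n b) = B (rshift n a) (rshift n b)) -> A = B.
Proof.
move=> ll lr rl rr; apply/matrixP => a b; rewrite -(splitK a) -(splitK b).
by case: (fintype.split a) => a'; case: (fintype.split b) => b' /=.
Qed.

Lemma inv_bivector_metricC sg : teich sg ->
  inv_bivector (metricC ip k s sg) (basisC T) =
  block_mx (@tens r R (ginv sg)) 0 0 (@tens r R (ginv sg)).
Proof.
move=> sg0; rewrite /inv_bivector.
have -> : \matrix_(a, b) metricC ip k s sg (basisC T a) (basisC T b) =
    block_mx (@tens r R (gmat sg)) 0 0 (@tens r R (gmat sg)).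
  apply: eq_mx4 => a b; rewrite mxE ?(block_mxEul, block_mxEur, block_mxEdl, block_mxEdr)
    ?basisC_l ?basisC_r metricCE//= ?metric0l ?metric0r ?addr0 ?add0r
    ?(metric_basis hT)// ?mxE//.
apply: invmx_eq; rewrite mulmx_block !mul0mx !mulmx0 !addr0 !add0r gmat_ginv//.
by rewrite -scalar_mx_block.
Qed.

Lemma variation_metricC :
  Defs.variation (d_eta eta) (metricC ip k s) (basisC T) tau = block_mx V 0 0 V.
Proof.
pose F a b := fun sg => (inv_bivector (metricC ip k s sg) (basisC T) a b)%:C.
have near0 a b (G : R * R -> R) : (forall sg, teich sg ->
    inv_bivector (metricC ip k s sg) (basisC T) a b = G sg) ->
    - Dtau (d_eta eta) (F a b) tau = - Dtau (d_eta eta) (fun sg => (G sg)%:C) tau.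
  move=> FG; congr (- _); apply: near_eq_Dtau.
  by have := near_teich t0; apply: filterS => sg sg0; rewrite /F FG.
have zero : - Dtau (d_eta eta) (fun sg : R * R => (0 : R)%:C) tau = 0.
  rewrite (Dtau_val _ (is_deriveC_cst _ _ _) (is_deriveC_cst _ _ _)).
  by rewrite !mulr0 addr0 oppr0.
apply: eq_mx4 => a b; rewrite mxE ?(block_mxEul, block_mxEur, block_mxEdl, block_mxEdr).
- rewrite (near0 _ _ (fun sg => @tens r R (ginv sg) a b)).
    by rewrite -(variation_metric hT heta t0) mxE; congr (- _); apply: near_eq_Dtau;
      have := near_teich t0; apply: filterS => sg sg0; rewrite (inv_bivector_metric hT).
  by move=> sg sg0; rewrite inv_bivector_metricC// block_mxEul.
- rewrite (near0 _ _ (fun sg => 0)) ?zero ?mxE//.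
  by move=> sg sg0; rewrite inv_bivector_metricC// block_mxEur mxE.
- rewrite (near0 _ _ (fun sg => 0)) ?zero ?mxE//.
  by move=> sg sg0; rewrite inv_bivector_metricC// block_mxEdl mxE.
- rewrite (near0 _ _ (fun sg => @tens r R (ginv sg) a b)).
    by rewrite -(variation_metric hT heta t0) mxE; congr (- _); apply: near_eq_Dtau;
      have := near_teich t0; apply: filterS => sg sg0; rewrite (inv_bivector_metric hT).
  by move=> sg sg0; rewrite inv_bivector_metricC// block_mxEdr.
Qed.

(** With respect to real and imaginary parts, I_{tau,t} is the Hodge star tensored with the
    reflection (k, -s; -s, -k) / |t|. *)
Lemma proj10_cplx_I : proj10 (endo_mx (basisC T) (coordC ip T) (cplx_I k s tau)) =
  block_mx (2^-1 *: (1%:M + (- 'i * (k%:R / kap)%:C) *: HC)) (('i * (s / kap / 2)%:C) *: HC)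
    (('i * (s / kap / 2)%:C) *: HC) (2^-1 *: (1%:M + ('i * (k%:R / kap)%:C) *: HC)).
Proof.
have t2 : tau.2 != 0 by rewrite gt_eqF.
have K0 := kap_neq0 hk s.
have H0 c d : Defs.coord0 ip T (hodge tau (basis0 T d)) c = @tens r R (hmat tau) c d.
  by rewrite -(endo_hodge hT t0) mxE.
have cD A B c : Defs.coord0 ip T (A + B) c = Defs.coord0 ip T A c + Defs.coord0 ip T B c.
  by rewrite /Defs.coord0; case: (fintype.split c) => j /=; rewrite ipDl.
have cZ (x : R) A c : Defs.coord0 ip T (x *: A) c = x * Defs.coord0 ip T A c.
  by rewrite /Defs.coord0; case: (fintype.split c) => j /=; rewrite ipZl.
have cN A c : Defs.coord0 ip T (- A) c = - Defs.coord0 ip T A c.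
  by rewrite -scaleN1r cZ mulN1r.
have h0 : hodge tau (0 : E * E) = 0.
  by rewrite /hodge /= !scaler0 subrr !scaler0.
have hN (A : E * E) : hodge tau (- A) = - hodge tau A.
  by rewrite /hodge /= !scalerN -!opprD !scalerN.
have c0 c : Defs.coord0 ip T 0 c = 0.
  by rewrite -(scale0r 0) cZ mul0r.
apply: eq_mx4 => a b; rewrite ?(block_mxEul, block_mxEur, block_mxEdl, block_mxEdr)
  !mxE ?basisC_l ?basisC_r ?coordC_l ?coordC_r /cplx_I /cplx_K /hodgeC /multi /=
  ?oppr0 ?hN ?h0 ?oppr0 ?cZ ?cD ?cZ ?cN ?c0 ?H0 ?eq_lshift ?eq_rshift ?eq_lrshift ?eq_rlshift ?mxE;
  case: (jx a == jx b); rewrite ?(inj_eq (@lshift_inj _ _)) ?(inj_eq (@rshift_inj _ _));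
  try case: (a == b);
  by apply: complex_ext => /=; field.
Qed.

Lemma affHC_V (x c : R[i]) : (x *: (1%:M + c *: HC)) *m V = (x * (1 + c * ei)) *: V.
Proof.
rewrite -scalemxAl mulmxDl mul1mx -scalemxAl HCV// scalerDr !scalerA -scalerDl.
by congr (_ *: _); ring.
Qed.

Lemma V_affHC (x c : R[i]) : V *m (x *: (1%:M + c *: HC))^T = (x * (1 + c * ei)) *: V.
Proof.
by rewrite -[LHS]trmxK trmx_mul trmxK Veta_tr affHC_V linearZ /= Veta_tr.
Qed.

Lemma part20_block (A B D : 'M[R[i]]_(r + r)) (a b d : R[i]) :
  A *m V = a *: V -> B *m V = b *: V -> D *m V = d *: V ->
  V *m A^T = a *: V -> V *m B^T = b *: V -> V *m D^T = d *: V ->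
  block_mx A B B D *m block_mx V 0 0 V *m (block_mx A B B D)^T =
  block_mx ((a ^+ 2 + b ^+ 2) *: V) ((b * (a + d)) *: V)
           ((b * (a + d)) *: V) ((b ^+ 2 + d ^+ 2) *: V).
Proof.
move=> AV BV DV VA VB VD.
rewrite tr_block_mx mulmx_block !mulmx0 !addr0 !add0r AV BV DV mulmx_block.
rewrite -!scalemxAl VA VB VD !scalerA -!scalerDl.
by congr block_mx; congr (_ *: _); ring.
Qed.

(** The projection is applied to both tensor factors. On the range of V each application is [piC],
    which is symmetric and idempotent, so the product of the two is [piC] again. *)
Lemma hitchin_GC_eta : hitchin_GC ip T k s (d_eta eta) tau =
  block_mx ((piC k s eta false false)%:C *: V) ((piC k s eta false true)%:C *: V)
           ((piC k s eta true false)%:C *: V) ((piC k s eta true true)%:C *: V).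
Proof.
have K0 := kap_neq0 hk s; have K2 := kap_sqr k s.
have BV (c : R[i]) : (c *: HC) *m V = (c * ei) *: V.
  by rewrite -scalemxAl HCV// scalerA.
have VB (c : R[i]) : V *m (c *: HC)^T = (c * ei) *: V.
  by rewrite -[LHS]trmxK trmx_mul trmxK Veta_tr BV linearZ /= Veta_tr.
rewrite /hitchin_GC variation_metricC /part20 proj10_cplx_I.
rewrite (part20_block (affHC_V _ _) (BV _) (affHC_V _ _) (V_affHC _ _) (VB _) (V_affHC _ _)).
have eta2 : eta ^+ 2 = 1 by case: heta => ->; rewrite ?sqrrN expr1n.
have cE (x y : R) : x = y -> x%:C *: V = y%:C *: V by move=> ->.
have sa : 2^-1 * (1 + - 'i * (k%:R / kap)%:C * ei) = ((1 + eta * k%:R / kap) / 2)%:C.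
  by apply: complex_ext => /=; field.
have sb : 'i * (s / kap / 2)%:C * ei = (- (eta * s / kap) / 2)%:C.
  by apply: complex_ext => /=; field.
have sd : 2^-1 * (1 + 'i * (k%:R / kap)%:C * ei) = ((1 - eta * k%:R / kap) / 2)%:C.
  by apply: complex_ext => /=; field.
rewrite sa sb sd -!(rmorphXn, rmorphD, rmorphM) /piC.
have kk : (k%:R ^+ 2 + s ^+ 2) / kap ^+ 2 = 1 by rewrite -K2 divff// expf_neq0.
congr block_mx; apply: cE.
- transitivity ((1 + 2 * eta * k%:R / kap + eta ^+ 2 * ((k%:R ^+ 2 + s ^+ 2) / kap ^+ 2)) / 4).
    by field.
  by rewrite kk eta2; field.
- by field.
- by field.
- transitivity ((1 - 2 * eta * k%:R / kap + eta ^+ 2 * ((k%:R ^+ 2 + s ^+ 2) / kap ^+ 2)) / 4).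
    by field.
  by rewrite kk eta2; field.
Qed.
End VariationMatricesC.

(** * The Laplacian of the complexified connection *)

Section LaplacianC.
Context {R : realType} {E : normedModType R} (ip : {dot E for idfun}).
Context {r : nat} (T : 'I_r -> E) (hT : euclidean_basis ip T).
Context (k : nat) (hk : (0 < k)%N) (s : R).
Context (eta : R) (heta : eta = 1 \/ eta = -1) (tau : R * R) (t0 : teich tau).
Local Notation AC := (formsC E).
Local Notation tup := ((r + r).-tuple R).
Local Notation kap := (abs_level k s).
Local Notation pC := (pC ip T).
Local Notation qC := (qC ip T k s).
Local Notation cf := (cf ip T k s tau).
Local Notation tr := (tr ip T k s tau).
Local Notation V := (@Veta R r eta tau).
Local Notation ei := (0 +i* eta : R[i]).
Local Notation "j '.l'" := (lshift r j) (at level 2, format "j .l").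
Local Notation "j '.r'" := (rshift r j) (at level 2, format "j .r").

Arguments piC : simpl never.
Arguments veta : simpl never.

(** A vector spanning the range of [piC], of squared length 2 |t| (|t| + k). Scaling it so that |t|
    + k > 0 is one of its entries keeps it nonzero for every s. *)
Definition wC (c : bool) : R :=
  if eta == 1 then if c then - s else kap + k%:R else if c then kap + k%:R else s.

Lemma N1_eq1 : (-1 == 1 :> R) = false.
Proof. by rewrite lt_eqF// (lt_trans (ltrN10 R) ltr01). Qed.

Lemma kapk_neq0 : kap + k%:R != 0 :> R.
Proof. by rewrite gt_eqF// ltr_wpDr ?kap_gt0. Qed.

Arguments wC : simpl never.

Lemma piC_wC c d : piC k s eta c d = wC c * wC d / (2 * kap * (kap + k%:R)).
Proof.
have K0 := kap_neq0 hk s; have K2 := kap_sqr k s; have Kk := kapk_neq0.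
have s2 : s * s = (kap - k%:R) * (kap + k%:R).
  by rewrite -expr2 -subr_sqr K2 addrC addKr.
rewrite /piC /wC; case: heta => ->; rewrite ?eqxx ?N1_eq1;
  case: c; case: d; rewrite ?mulrNN ?s2; by field; rewrite ?K0 ?Kk.
Qed.

Definition bvec (c x : bool) (j : 'I_r) : AC :=
  if c then if x then ((0, 0), (0, T j)) else ((0, 0), (T j, 0))
  else if x then ((0, T j), (0, 0)) else ((T j, 0), (0, 0)).

Arguments bvec : simpl never.

(* p- and q-coordinates of the basis vectors: [b] selects the index j + r rather
   than j, [c] a factor i, and [x] the form dy rather than dx *)
Definition bp (b c x : bool) : R := nrm tau *
  if b then if c then if x then 0 else tau.2 else if x then -1 else tau.1
  else if c then if x then 1 else - tau.1 else if x then 0 else tau.2.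
Definition bq (b c x : bool) : R := nrm tau / kap *
  if b then if c then if x then - k%:R else - (s * tau.2 - k%:R * tau.1)
            else if x then - s else s * tau.1 + k%:R * tau.2
  else if c then if x then - s else k%:R * tau.2 + s * tau.1
            else if x then k%:R else - (k%:R * tau.1) + s * tau.2.

Lemma pC_bvec_l c x j i : tnth (pC tau (bvec c x j)) i.l = (j == i)%:R * bp false c x.
Proof.
rewrite pC_l /bvec /bp; case: c; case: x; rewrite /= ?ip0l ?(split_orthonormal hT); ring.
Qed.
Lemma pC_bvec_r c x j i : tnth (pC tau (bvec c x j)) i.r = (j == i)%:R * bp true c x.
Proof.
rewrite pC_r /bvec /bp; case: c; case: x; rewrite /= ?ip0l ?(split_orthonormal hT); ring.
Qed.
Lemma qC_bvec_l c x j i : tnth (qC tau (bvec c x j)) i.l = (j == i)%:R * bq false c x.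
Proof.
have K0 := kap_neq0 hk s.
by rewrite qC_l /bvec /bq; case: c; case: x; rewrite /= ?ip0l ?(split_orthonormal hT); field.
Qed.
Lemma qC_bvec_r c x j i : tnth (qC tau (bvec c x j)) i.r = (j == i)%:R * bq true c x.
Proof.
have K0 := kap_neq0 hk s.
by rewrite qC_r /bvec /bq; case: c; case: x; rewrite /= ?ip0l ?(split_orthonormal hT); field.
Qed.

Definition bc (b c x : bool) : R[i] := (kap * bq b c x) +i* (- (kap * bp b c x)).

Lemma cf_bvec_l c x j i : cf (bvec c x j) i.l = (j == i)%:R * bc false c x.
Proof.
rewrite /Submission.cf pC_bvec_l qC_bvec_l /bc; case: (j == i).
  by apply: complex_ext => /=; ring.
by apply: complex_ext => /=; ring.
Qed.
Lemma cf_bvec_r c x j i : cf (bvec c x j) i.r = (j == i)%:R * bc true c x.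
Proof.
rewrite /Submission.cf pC_bvec_r qC_bvec_r /bc; case: (j == i).
  by apply: complex_ext => /=; ring.
by apply: complex_ext => /=; ring.
Qed.

Lemma sum_delta_at {K : pzRingType} (j : 'I_r) (F g : 'I_(r + r) -> K) (a b : K) :
  (forall i, g i.l = (j == i)%:R * a) -> (forall i, g i.r = (j == i)%:R * b) ->
  \sum_i g i * F i = a * F j.l + b * F j.r.
Proof.
move=> gl gr; rewrite big_split_ord /=; congr (_ + _).
- rewrite (bigD1 j)//= big1 ?addr0 ?gl ?eqxx ?mul1r// => i ij.
  by rewrite gl eq_sym (negbTE ij) !mul0r.
- rewrite (bigD1 j)//= big1 ?addr0 ?gr ?eqxx ?mul1r// => i ij.
  by rewrite gr eq_sym (negbTE ij) !mul0r.
Qed.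

(** The complex vector w (x) v; up to a scalar its square is the block of [hitchin_GC] at each j. *)
Definition uC (c x : bool) : R[i] := (wC c)%:C * veta eta tau x.

(** At |t| this is the p-coordinate of [uC] at j. The argument is left free so that |t| can be
    rewritten as (k^2 + s^2) / |t| before comparing with q-coordinates. *)
Definition XC (x : R) : R[i] := (nrm tau * tau.2)%:C *
  (if eta == 1 then (x + k%:R) +i* s else s +i* (x + k%:R)).

Lemma uC_bp b : \sum_c \sum_x uC c x * (bp b c x)%:C = (if b then ei else 1) * XC kap.
Proof.
rewrite !big_bool /= /uC /bp /veta /wC /XC; case: b; case: heta => ->;
  rewrite ?eqxx ?N1_eq1;
  by apply: complex_ext => /=; ring.
Qed.

(** The q-coordinates are -i times the p-coordinates of [uC_bp]: the vector [uC] has the form X - i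
    I X, of type (1,0) for I_{tau,t}. *)
Lemma uC_bq b : \sum_c \sum_x uC c x * (bq b c x)%:C =
  (if b then ei else 1) * (- 'i * XC kap).
Proof.
have K0 := kap_neq0 hk s.
have -> : XC kap = XC ((k%:R ^+ 2 + s ^+ 2) / kap).
  by congr XC; rewrite -(kap_sqr k s) expr2 mulfK.
rewrite !big_bool /= /uC /bq /veta /wC /XC; case: b; case: heta => ->;
  rewrite ?eqxx ?N1_eq1;
  by apply: complex_ext => /=; field.
Qed.

Lemma uC_bc b : \sum_c \sum_x uC c x * bc b c x =
  (if b then ei else 1) * (- (2 * kap)%:C * 'i * XC kap).
Proof.
transitivity (kap%:C * (\sum_c \sum_x uC c x * (bq b c x)%:C) -
  kap%:C * 'i * \sum_c \sum_x uC c x * (bp b c x)%:C).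
  rewrite !big_bool /=.
  have bcE c x : bc b c x = kap%:C * (bq b c x)%:C - kap%:C * 'i * (bp b c x)%:C.
    by apply: complex_ext => /=; ring.
  by rewrite !bcE; ring.
by rewrite uC_bp uC_bq rmorphM rmorph_nat; ring.
Qed.

(** The factor t_eta of the complexified side appears here, from (|t| + t)^2 = 2 (|t| + k) t and its
    conjugate. *)
Lemma XC_sqr : XC kap ^+ 2 = (eta * (kap + k%:R) * tau.2)%:C * (k%:R +i* (eta * s)).
Proof.
have t2 : tau.2 != 0 by rewrite gt_eqF.
have N2 := nrm_sqr t0.
have K2 := kap_sqr k s.
have s2 : s * s = (kap - k%:R) * (kap + k%:R).
  by rewrite -expr2 -subr_sqr K2 addrC addKr.
have NE : (nrm tau * tau.2) ^+ 2 = tau.2 / 2.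
  by rewrite exprMn N2; field.
rewrite exprMn -rmorphXn NE; case: heta => ->; rewrite ?eqxx ?N1_eq1 expr2.
  apply: complex_ext => /=; rewrite ?s2; by field.
apply: complex_ext => /=; rewrite ?s2; by field.
Qed.

Section Sum.
Context (M : 'I_(r + r) -> 'I_(r + r) -> R[i]) (F0 : R[i]).
(** The shape of the second covariant derivative in [nabla2_tr], with the moments abstracted into
    [M] and [F0]. *)
Definition Bform (e' e : AC) : R[i] :=
  \sum_i cf e i * (\sum_l cf e' l * M i l - (tnth (qC tau e') i)%:C * F0).

Lemma Bform_bvec c x d y j : Bform (bvec c x j) (bvec d y j) =
  bc false d y * (bc false c x * M j.l j.l + bc true c x * M j.l j.r - (bq false c x)%:C * F0) +
  bc true d y * (bc false c x * M j.r j.l + bc true c x * M j.r j.r - (bq true c x)%:C * F0).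
Proof.
rewrite /Bform (sum_delta_at _ (cf_bvec_l d y j) (cf_bvec_r d y j)).
rewrite !(sum_delta_at _ (cf_bvec_l c x j) (cf_bvec_r c x j)).
by rewrite qC_bvec_l qC_bvec_r eqxx !mul1r.
Qed.

(** The coordinates of [uC] at j and j + r are in the ratio 1 : i eta. The terms in [F0] therefore
    carry 1 + (i eta)^2 = 0, and the coefficient of M at (j + r, j + r) is the opposite of that at
    (j, j). *)
Lemma sum_uC_Bform j :
  \sum_c \sum_x \sum_d \sum_y uC c x * uC d y * Bform (bvec c x j) (bvec d y j) =
  - (4 * kap ^+ 2)%:C * XC kap ^+ 2 *
   (M j.l j.l + ei * (M j.l j.r + M j.r j.l) - M j.r j.r).
Proof.
pose S (F : bool -> bool -> R[i]) := \sum_c \sum_x uC c x * F c x.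
transitivity (S (bc false) * (S (bc false) * M j.l j.l + S (bc true) * M j.l j.r
   - S (fun c x => (bq false c x)%:C) * F0) +
  S (bc true) * (S (bc false) * M j.r j.l + S (bc true) * M j.r j.r
   - S (fun c x => (bq true c x)%:C) * F0)).
  rewrite /S !big_bool /= !Bform_bvec; ring.
rewrite /S !uC_bc !uC_bq.
have e2 : ei * ei = -1.
  by case: heta => ->; apply: complex_ext => /=; ring.
have i2 : 'i * 'i = -1 :> R[i].
  by apply: complex_ext => /=; ring.
transitivity (('i * 'i) * (4 * kap ^+ 2)%:C * XC kap ^+ 2 *
  (M j.l j.l + ei * (M j.l j.r + M j.r j.l) + (ei * ei) * M j.r j.r)
  + ('i * 'i) * (2 * kap)%:C * XC kap ^+ 2 * F0 * (1 + ei * ei) * (-1)).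
  rewrite !rmorphM !rmorph_nat; ring.
by rewrite e2 i2; ring.
Qed.

Lemma basisC_ll j : basisC T (lshift (r + r) j.l) = bvec false false j.
Proof. by rewrite basisC_l /basis0 split_l. Qed.
Lemma basisC_lr j : basisC T (lshift (r + r) j.r) = bvec false true j.
Proof. by rewrite basisC_l /basis0 split_r. Qed.
Lemma basisC_rl j : basisC T (rshift (r + r) j.l) = bvec true false j.
Proof. by rewrite basisC_r /basis0 split_l. Qed.
Lemma basisC_rr j : basisC T (rshift (r + r) j.r) = bvec true true j.
Proof. by rewrite basisC_r /basis0 split_r. Qed.

Lemma Veta_l j b : V j.l b = (j == jx b)%:R * (ceta eta tau * veta eta tau false * veta eta tau (xy b)).
Proof. by rewrite mxE jx_l xy_l. Qed.
Lemma Veta_r j b : V j.r b = (j == jx b)%:R * (ceta eta tau * veta eta tau true * veta eta tau (xy b)).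
Proof. by rewrite mxE jx_r xy_r. Qed.

Lemma sum_Veta j x (G : 'I_(r + r) -> R[i]) :
  \sum_b V (if x then j.r else j.l) b * G b = ceta eta tau * veta eta tau x *
    (veta eta tau false * G j.l + veta eta tau true * G j.r).
Proof.
case: x.
  under eq_bigr do rewrite Veta_r -mulrA.
  by rewrite sum_delta xy_l xy_r; ring.
under eq_bigr do rewrite Veta_l -mulrA.
by rewrite sum_delta xy_l xy_r; ring.
Qed.

(** By [piC_wC] and the rank-one form of V the bivector is c0 times the sum over j of the squares of
    [uC], which [sum_uC_Bform] contracts. *)
Lemma sum_GC : \sum_a \sum_b hitchin_GC ip T k s (d_eta eta) tau a b *
   Bform (basisC T a) (basisC T b) =
  (4 * kap)%:C * \sum_j ('i * (k%:R +i* (eta * s)) * ((4 * tau.2)^-1)%:C) *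
     (M j.l j.l + ei * (M j.l j.r + M j.r j.l) - M j.r j.r).
Proof.
have K0 := kap_neq0 hk s; have Kk := kapk_neq0.
have t2 : tau.2 != 0 by rewrite gt_eqF.
rewrite (hitchin_GC_eta hT hk s heta t0).
pose c0 := ceta eta tau * ((2 * kap * (kap + k%:R))^-1)%:C.
transitivity (\sum_j c0 * \sum_c \sum_x \sum_d \sum_y
   uC c x * uC d y * Bform (bvec c x j) (bvec d y j)).
  rewrite !big_split_ord /=.
  have sE (c : R[i]) a b : (c *: V) a b = c * V a b by rewrite mxE.
  have GE a : \sum_b block_mx ((piC k s eta false false)%:C *: V) ((piC k s eta false true)%:C *: V)
           ((piC k s eta true false)%:C *: V) ((piC k s eta true true)%:C *: V) (lshift (r + r) a) b *
     Bform (basisC T (lshift (r + r) a)) (basisC T b) =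
   \sum_b V a b * ((piC k s eta false false)%:C * Bform (basisC T (lshift (r + r) a)) (basisC T (lshift (r + r) b))
     + (piC k s eta false true)%:C * Bform (basisC T (lshift (r + r) a)) (basisC T (rshift (r + r) b))).
    rewrite big_split_ord /= -big_split /=; apply: eq_bigr => b _.
    by rewrite block_mxEul block_mxEur !sE; ring.
  have GE' a : \sum_b block_mx ((piC k s eta false false)%:C *: V) ((piC k s eta false true)%:C *: V)
           ((piC k s eta true false)%:C *: V) ((piC k s eta true true)%:C *: V) (rshift (r + r) a) b *
     Bform (basisC T (rshift (r + r) a)) (basisC T b) =
   \sum_b V a b * ((piC k s eta true false)%:C * Bform (basisC T (rshift (r + r) a)) (basisC T (lshift (r + r) b))
     + (piC k s eta true true)%:C * Bform (basisC T (rshift (r + r) a)) (basisC T (rshift (r + r) b))).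
    rewrite big_split_ord /= -big_split /=; apply: eq_bigr => b _.
    by rewrite block_mxEdl block_mxEdr !sE; ring.
  rewrite -!big_split /=; apply: eq_bigr => j _.
  rewrite !GE !GE' !(sum_Veta j false) !(sum_Veta j true).
  rewrite !(basisC_ll, basisC_lr, basisC_rl, basisC_rr) !piC_wC !rmorphM.
  by rewrite !big_bool /= /uC /c0; ring.
rewrite mulr_sumr; apply: eq_bigr => j _.
rewrite sum_uC_Bform XC_sqr /c0 /ceta.
rewrite mulrA [RHS]mulrA; congr (_ * _).
by case: heta => ->; apply: complex_ext => /=; field; rewrite K0 Kk t2.
Qed.

End Sum.

Lemma laplacian_tr (f : tup -> R[i]) A : L2 f -> (forall i, L2 (mulq f i)) ->
  (forall i l, L2 (mulq (mulq f i) l)) ->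
  ((4 * kap)^-1)%:C *
  laplacian (omega_t ip k s) (basisC T) (hitchin_GC ip T k s (d_eta eta) tau) (tr f) A =
  \sum_j ('i * (k%:R +i* (eta * s)) * ((4 * tau.2)^-1)%:C) *
    let M i l := tr (mulq (mulq f i) l) A - (tnth (qC tau A) l)%:C * tr (mulq f i) A
      - (tnth (qC tau A) i)%:C * tr (mulq f l) A
      + (tnth (qC tau A) i)%:C * (tnth (qC tau A) l)%:C * tr f A in
     (M j.l j.l + ei * (M j.l j.r + M j.r j.l) - M j.r j.r).
Proof.
move=> Lf Lqf Lqqf; have K0 := kap_neq0 hk s.
pose M i l := tr (mulq (mulq f i) l) A - (tnth (qC tau A) l)%:C * tr (mulq f i) A
      - (tnth (qC tau A) i)%:C * tr (mulq f l) A
      + (tnth (qC tau A) i)%:C * (tnth (qC tau A) l)%:C * tr f A.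
have -> : laplacian (omega_t ip k s) (basisC T) (hitchin_GC ip T k s (d_eta eta) tau) (tr f) A =
   \sum_a \sum_b hitchin_GC ip T k s (d_eta eta) tau a b *
     Bform M (tr f A) (basisC T a) (basisC T b).
  by apply: eq_bigr => a _; apply: eq_bigr => b _; rewrite (nabla2_tr hT hk s t0).
rewrite sum_GC mulrA -rmorphM mulVf ?mul1r//.
by rewrite mulf_neq0.
Qed.

End LaplacianC.

(** * The complexified Hitchin connection *)

Section Curves.
Context {R : realType}.

Lemma is_derive_pairR (V W : normedModType R) (f : R -> V) (g : R -> W) (x : R) a b :
  is_derive x 1 f a -> is_derive x 1 g b ->
  is_derive x 1 (fun y => (f y, g y)) (a, b).
Proof.
move=> [df fE] [dg gE].
have df' := (derivable1_diffP f x).1 df; have dg' := (derivable1_diffP g x).1 dg.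
have dp : differentiable (fun y => (f y, g y)) x by exact: differentiable_pair.
apply: DeriveDef; first exact/derivable1_diffP.
by rewrite deriveE// diff_pair//= -!deriveE// fE gE.
Qed.

Lemma is_derive_scalel (V : normedModType R) (f : R -> R) (v : V) (x a : R) :
  is_derive x 1 f a -> is_derive x 1 (fun y => f y *: v) (a *: v).
Proof.
move=> [df fE]; have df' := (derivable1_diffP f x).1 df.
have dp : differentiable (fun y => f y *: v) x by exact: differentiableZl.
apply: DeriveDef; first exact/derivable1_diffP.
by rewrite deriveE// diffZl//= -deriveE// fE.
Qed.

Lemma is_derive_sumv (V : normedModType R) n (F : 'I_n -> R -> V) (x : R) (a : 'I_n -> V) :
  (forall i, is_derive x 1 (F i) (a i)) ->
  is_derive x 1 (fun y => \sum_i F i y) (\sum_i a i).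
Proof.
move=> dF; have H := @is_derive_sum R R V n F x 1 a dF.
by rewrite (_ : (fun y => _) = \sum_i F i)//; apply: funext => y; rewrite fct_sumE.
Qed.

Lemma is_derive_curve (W : normedModType R) (F : W -> R) (c : R -> W) (w x : W) :
  c 0 = x -> differentiable F x -> is_derive (0 : R) 1 c w ->
  is_derive (0 : R) 1 (F \o c) ('D_w F x).
Proof.
move=> c0 dF [dc cE]; have dc' := (derivable1_diffP c 0).1 dc.
have dFc : differentiable (F \o c) 0 by apply: differentiable_comp => //; rewrite c0.
apply: DeriveDef; first exact/derivable1_diffP.
by rewrite deriveE// diff_comp//= ?c0// -[X in 'd F x X]deriveE// cE -deriveE.
Qed.

Lemma is_deriveC_curve (W : normedModType R) (F : W -> R[i]) (c : R -> W) (w x : W) :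
  c 0 = x -> differentiableC F x -> is_derive (0 : R) 1 c w ->
  is_deriveC (0 : R) 1 (F \o c) (deriveC w F x).
Proof.
by move=> c0 [dR dI] dc; split; [exact: (is_derive_curve c0 dR dc)|exact: (is_derive_curve c0 dI dc)].
Qed.

Lemma deriveC_lin (W : normedModType R) (F : W -> R[i]) (x v w : W) (a : R) :
  differentiableC F x ->
  deriveC (a *: v + w) F x = a%:C * deriveC v F x + deriveC w F x.
Proof.
have lin (f : W -> R) : differentiable f x ->
    'D_(a *: v + w) f x = a * 'D_v f x + 'D_w f x.
  by move=> df; rewrite !deriveE// linearP.
move=> [dR dI]; rewrite /deriveC (lin _ dR) (lin _ dI).
move: ('D_v _ x) ('D_v _ x) ('D_w _ x) ('D_w _ x) => p q p' q'.
by apply/eqP; rewrite eq_complex /= !mul0r subr0 addr0 !eqxx.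
Qed.

Lemma deriveC_add (W : normedModType R) (F : W -> R[i]) (x v w : W) :
  differentiableC F x -> deriveC (v + w) F x = deriveC v F x + deriveC w F x.
Proof. by move=> dF; rewrite -[v]scale1r deriveC_lin// scale1r mul1r. Qed.

Lemma deriveC0 (W : normedModType R) (F : W -> R[i]) (x : W) :
  differentiableC F x -> deriveC 0 F x = 0.
Proof.
move=> dF; apply: (addrI (deriveC 0 F x)).
by rewrite addr0 -deriveC_add// addr0.
Qed.

Lemma deriveC_sum (W : normedModType R) (F : W -> R[i]) (x : W) (I : Type) (l : seq I)
    (c : I -> R) (v : I -> W) : differentiableC F x ->
  deriveC (\sum_(i <- l) c i *: v i) F x = \sum_(i <- l) (c i)%:C * deriveC (v i) F x.
Proof.
move=> dF; elim: l => [|i l IH]; first by rewrite !big_nil deriveC0.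
by rewrite !big_cons deriveC_lin// IH.
Qed.

Lemma derive_pairl (V W : normedModType R) (F : V * W -> R) (x v : V) (y : W) :
  'D_((v, 0) : V * W) F (x, y) = 'D_v (fun x => F (x, y)) x.
Proof.
have E : (fun h : R => h^-1 *: ((F \o shift (x, y)) (h *: ((v, 0) : V * W)) - F (x, y))) =
    (fun h : R => h^-1 *: (((fun x => F (x, y)) \o shift x) (h *: v) - F (x, y))).
  apply: funext => h /=; congr (_ *: (F _ - _)).
  transitivity ((h *: v + x, h *: (0 : W) + y)); first by [].
  by rewrite scaler0 add0r.
by rewrite /derive E.
Qed.

Lemma derive_pairr (V W : normedModType R) (F : V * W -> R) (x : V) (y w : W) :
  'D_((0, w) : V * W) F (x, y) = 'D_w (fun y => F (x, y)) y.
Proof.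
have E : (fun h : R => h^-1 *: ((F \o shift (x, y)) (h *: ((0, w) : V * W)) - F (x, y))) =
    (fun h : R => h^-1 *: (((fun y => F (x, y)) \o shift y) (h *: w) - F (x, y))).
  apply: funext => h /=; congr (_ *: (F _ - _)).
  transitivity ((h *: (0 : V) + x, h *: w + y)); first by [].
  by rewrite scaler0 add0r.
by rewrite /derive E.
Qed.

Lemma deriveC_pairl (V W : normedModType R) (F : V * W -> R[i]) (x v : V) (y : W) :
  deriveC ((v, 0) : V * W) F (x, y) = deriveC v (fun x => F (x, y)) x.
Proof. by rewrite /deriveC !derive_pairl. Qed.

Lemma deriveC_pairr (V W : normedModType R) (F : V * W -> R[i]) (x : V) (y w : W) :
  deriveC ((0, w) : V * W) F (x, y) = deriveC w (fun y => F (x, y)) y.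
Proof. by rewrite /deriveC !derive_pairr. Qed.

Lemma differentiableC_pairl (V W : normedModType R) (F : V * W -> R[i]) (x : V) (y : W) :
  differentiableC F (x, y) -> differentiableC (fun x => F (x, y)) x.
Proof.
have dp : differentiable (fun x : V => (x, y)) x.
  by apply: differentiable_pair; [exact: ex_diff|exact: ex_diff].
by move=> [dR dI]; split;
  [exact: (differentiable_comp dp dR)|exact: (differentiable_comp dp dI)].
Qed.

Lemma differentiableC_pairr (V W : normedModType R) (F : V * W -> R[i]) (x : V) (y : W) :
  differentiableC F (x, y) -> differentiableC (fun y => F (x, y)) y.
Proof.
have dp : differentiable (fun y : W => (x, y)) y.
  by apply: differentiable_pair; [exact: ex_diff|exact: ex_diff].
by move=> [dR dI]; split;
  [exact: (differentiable_comp dp dR)|exact: (differentiable_comp dp dI)].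
Qed.

End Curves.

(** * Comparison of derivatives at fixed coordinates and at a fixed point *)

Section ChainRule.
Context {R : realType} {E : normedModType R} (ip : {dot E for idfun}).
Context {r : nat} (T : 'I_r -> E) (hT : euclidean_basis ip T).
Context (k : nat) (hk : (0 < k)%N) (s : R).
Context (tau : R * R) (t0 : teich tau).
Local Notation AC := (formsC E).
Local Notation tup := ((r + r).-tuple R).
Local Notation kap := (abs_level k s).
Local Notation pC := (pC ip T).
Local Notation qC := (qC ip T k s).

(* minus the rate of change of the p- (resp. q-) coordinates of a fixed point
   when tau moves in the direction e *)
Definition dotC (e : R * R) (p q : tup) : tup :=
  [tuple match fintype.split i with
   | inl j => (e.1 * (tnth p (rshift r j) + bt2 k s q j) - e.2 * bt1 k s q j) / (2 * tau.2)
   | inr j => - (e.1 * (tnth p (lshift r j) + bt1 k s q j) + e.2 * bt2 k s q j) / (2 * tau.2)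
   end | i < r + r].

Lemma dotC_l e p q j : tnth (dotC e p q) (lshift r j) =
  (e.1 * (tnth p (rshift r j) + bt2 k s q j) - e.2 * bt1 k s q j) / (2 * tau.2).
Proof. by rewrite tnth_mktuple split_l. Qed.
Lemma dotC_r e p q j : tnth (dotC e p q) (rshift r j) =
  - (e.1 * (tnth p (lshift r j) + bt1 k s q j) + e.2 * bt2 k s q j) / (2 * tau.2).
Proof. by rewrite tnth_mktuple split_r. Qed.

Lemma bt1_dotC e p q j : bt1 k s (dotC e q p) j =
  - (e.1 * (bt2 k s q j + tnth p (rshift r j)) + e.2 * tnth p (lshift r j)) / (2 * tau.2).
Proof.
have t2 : tau.2 != 0 by rewrite gt_eqF.
have K0 := kap_neq0 hk s.
have kk : (k%:R ^+ 2 + s ^+ 2) / kap ^+ 2 = 1.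
  by rewrite -(kap_sqr k s) divff// expf_neq0.
rewrite -[tnth p _ in RHS](eq1_mul _ kk) -[tnth p (lshift _ _) in RHS](eq1_mul _ kk).
by rewrite {1}/bt1 dotC_l dotC_r /bt1 /bt2; field; rewrite K0 t2.
Qed.

Lemma bt2_dotC e p q j : bt2 k s (dotC e q p) j =
  (e.1 * (bt1 k s q j + tnth p (lshift r j)) - e.2 * tnth p (rshift r j)) / (2 * tau.2).
Proof.
have t2 : tau.2 != 0 by rewrite gt_eqF.
have K0 := kap_neq0 hk s.
have kk : (k%:R ^+ 2 + s ^+ 2) / kap ^+ 2 = 1.
  by rewrite -(kap_sqr k s) divff// expf_neq0.
rewrite -[tnth p _ in RHS](eq1_mul _ kk) -[tnth p (rshift _ _) in RHS](eq1_mul _ kk).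
by rewrite {1}/bt2 dotC_l dotC_r /bt1 /bt2; field; rewrite K0 t2.
Qed.

Lemma nrm_derive e : is_derive (0 : R) 1 (fun h : R => nrm (h *: e + tau))
  (- (nrm tau * e.2 / (2 * tau.2))).
Proof.
have t2 : 0 < 2 * tau.2 by rewrite mulr_gt0.
have d2 := is_derive_scalef 2 ((is_derive_line (fun sg : R * R => sg.2) tau e e.2).2
  (is_derive_snd tau e)).
have E0 : 2 * (0 *: e + tau).2 = 2 * tau.2 by rewrite scale0r add0r.
have t2' : 0 < 2 * (0 *: e + tau).2 by rewrite E0.
have ds := @is_derive1_comp _ Num.sqrt (fun h : R => 2 * (h *: e + tau).2) 0 _ _
  (is_derive1_sqrt t2') d2.
have s0 : (Num.sqrt \o (fun h : R => 2 * (h *: e + tau).2)) 0 != 0.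
  by rewrite /comp E0 gt_eqF// sqrtr_gt0.
have H := is_derive_invf s0 ds.
apply: (is_derive_eqf H); rewrite /comp E0 /nrm sqr_sqrtr ?ltW//.
have : Num.sqrt (2 * tau.2) != 0 by rewrite gt_eqF// sqrtr_gt0.
have : tau.2 != 0 by rewrite gt_eqF.
by move=> ? ?; field; apply/andP.
Qed.

(** In the notation of [bt1], with eps = e.1 + i e.2, differentiating dzeta, dzetabar and N gives W
    the rate -i (e.1 W + conj(eps) alpha conj(Z)) / (2 tau_2). The rate of Z is the same expression
    with W and Z exchanged, because |alpha| = 1; hence the exchanged arguments of [dotC]. *)
Lemma pt_derive e p q : is_derive (0 : R) 1 (fun h : R => pt T k s (h *: e + tau) p q)
  (pt T k s tau (dotC e p q) (dotC e q p)).
Proof.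
have t2 : tau.2 != 0 by rewrite gt_eqF.
have K0 := kap_neq0 hk s; have K2 := kap_sqr k s.
have dN := nrm_derive e.
have d1 := (is_derive_line (fun sg : R * R => sg.1) tau e e.1).2 (is_derive_fst tau e).
have d2 := (is_derive_line (fun sg : R * R => sg.2) tau e e.2).2 (is_derive_snd tau e).
have dc (c : R) := is_derive_cstf (0 : R) (1 : R) c.
have E1 : (0 *: e + tau).1 = tau.1 by rewrite scale0r add0r.
have E2 : (0 *: e + tau).2 = tau.2 by rewrite scale0r add0r.
have E3 : nrm (0 *: e + tau) = nrm tau by rewrite /nrm E2.
(* The closed form [pt_comp] is valid on Teichmueller space only, which is open, so the two families
   agree for small h. *)
suff H : is_derive (0 : R) 1 (fun h : R => pt_comp T k s (h *: e + tau) p q)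
    (pt_comp T k s tau (dotC e p q) (dotC e q p)).
  rewrite -(pt_compE hT hk s) in H => //.
  apply: near_eq_is_derive H; have := near_teich t0.
  have cvl : (h *: e + tau) @[h --> (0 : R)] --> tau.
    have H1 : h *: e @[h --> (0 : R)] --> (0 : R) *: e.
      by apply: cvgZr_tmp; exact: cvg_id.
    have H3 : (h *: e + tau) @[h --> (0 : R)] --> (0 : R) *: e + tau.
      by apply: cvgD => //; exact: cvg_cst.
    by rewrite scale0r add0r in H3.
  move=> nt; near=> h; apply/esym/(pt_compE hT hk s).
  by near: h; exact: (cvl _ nt).
apply: is_derive_pairR; apply: is_derive_pairR; apply: is_derive_sumv => j; apply: is_derive_scalel.
- have H := is_derive_mulf dN (dc (tnth p (lshift r j) + bt1 k s q j)).
  by apply: (is_derive_eqf H); rewrite E3 bt1_dotC dotC_l; field.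
- have H := is_derive_mulf dN (is_derive_addf (is_derive_addf (is_derive_addf
     (is_derive_scalef (tnth p (lshift r j)) d1)
     (is_derive_oppf (is_derive_scalef (tnth p (rshift r j)) d2)))
     (is_derive_scalef (bt1 k s q j) d1)) (is_derive_scalef (bt2 k s q j) d2)).
  by apply: (is_derive_eqf H); rewrite E1 E2 E3 bt1_dotC bt2_dotC dotC_l dotC_r; field.
- have H := is_derive_mulf dN (dc (tnth p (rshift r j) + bt2 k s q j)).
  by apply: (is_derive_eqf H); rewrite E3 bt2_dotC dotC_r; field.
- have H := is_derive_mulf dN (is_derive_addf (is_derive_addf (is_derive_addf
     (is_derive_scalef (tnth p (lshift r j)) d2)
     (is_derive_scalef (tnth p (rshift r j)) d1))
     (is_derive_oppf (is_derive_scalef (bt1 k s q j) d2))) (is_derive_scalef (bt2 k s q j) d1)).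
  by apply: (is_derive_eqf H); rewrite E1 E2 E3 bt1_dotC bt2_dotC dotC_l dotC_r; field.
Unshelve. all: by end_near. Qed.

(** Differentiate the joint function along the curve of pairs (tau + h e, point with coordinates (p,
    q) at tau + h e), and split its velocity into the two factors. *)
Lemma deriveC_family (F : R * R -> AC -> R[i]) (p q : tup) e :
  differentiableC (fun x : (R * R) * AC => F x.1 x.2) (tau, pt T k s tau p q) ->
  deriveC e (fun sg => F sg (pt T k s sg p q)) tau =
  deriveC e (fun sg => F sg (pt T k s tau p q)) tau +
  deriveC (pt T k s tau (dotC e p q) (dotC e q p)) (F tau) (pt T k s tau p q).
Proof.
move=> dF; set G := fun x : (R * R) * AC => F x.1 x.2.
have dc : is_derive (0 : R) 1 (fun h : R => (h *: e + tau, pt T k s (h *: e + tau) p q))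
    (e, pt T k s tau (dotC e p q) (dotC e q p)).
  apply: is_derive_pairR (pt_derive e p q).
  have H1 := is_derive_scalel e (is_derive_id (0 : R) (1 : R)).
  have H := is_deriveD H1 (is_derive_cst tau (0 : R) (1 : R)).
  by rewrite scale1r addr0 in H.
have c0 : (0 *: e + tau, pt T k s (0 *: e + tau) p q) = (tau, pt T k s tau p q).
  by rewrite scale0r add0r.
have H := is_deriveC_curve c0 dF dc.
have := (is_deriveC_line (fun sg => F sg (pt T k s sg p q)) tau e _).1 H.
move=> /is_deriveC_val ->.
have P1 := deriveC_pairl G tau e (pt T k s tau p q).
have P2 := deriveC_pairr G tau (pt T k s tau p q) (pt T k s tau (dotC e p q) (dotC e q p)).
have vE : (e, pt T k s tau (dotC e p q) (dotC e q p)) =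
  (e, 0) + (0, pt T k s tau (dotC e p q) (dotC e q p)) :> (R * R) * AC.
  exact: (congr2 pair (esym (addr0 e)) (esym (add0r _))).
have Hadd := deriveC_add ((e, 0) : (R * R) * AC) (0, pt T k s tau (dotC e p q) (dotC e q p)) dF.
rewrite -vE in Hadd.
exact: (etrans Hadd (congr2 +%R P1 P2)).
Qed.

Lemma Dtau_family V (F : R * R -> AC -> R[i]) A :
  differentiableC (fun x : (R * R) * AC => F x.1 x.2) (tau, A) ->
  Dtau V (fun sg => F sg A) tau = delta T k s V F tau A -
  (V.1 * deriveC (pt T k s tau (dotC (1, 0) (pC tau A) (qC tau A)) (dotC (1, 0) (qC tau A) (pC tau A))) (F tau) A +
   V.2 * deriveC (pt T k s tau (dotC (0, 1) (pC tau A) (qC tau A)) (dotC (0, 1) (qC tau A) (pC tau A))) (F tau) A).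
Proof.
have AE := pt_pCqC hT hk s A t0.
move=> dF; rewrite /delta (coordsE hT hk s A t0) /=.
rewrite -{1}AE in dF.
rewrite {2}/Dtau -!/(pt T k s _ (pC tau A) (qC tau A)).
have H e := deriveC_family e dF.
rewrite [deriveC ((1, 0) : R * R) _ _ in RHS](H (1, 0)).
rewrite [deriveC ((0, 1) : R * R) _ _ in RHS](H (0, 1)).
have comb (v1 v2 a b x y : R[i]) :
  v1 * a + v2 * b = v1 * (a + x) + v2 * (b + y) - (v1 * x + v2 * y) by ring.
rewrite AE; exact: comb.
Qed.

End ChainRule.

(** * The complexified connection in terms of moments *)

Section ComplexifiedSide.
Context {R : realType} {E : normedModType R} (ip : {dot E for idfun}).
Context {r : nat} (T : 'I_r -> E) (hT : euclidean_basis ip T).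
Context (k : nat) (hk : (0 < k)%N) (s : R).
Context (eta : R) (heta : eta = 1 \/ eta = -1) (tau : R * R) (t0 : teich tau).
Local Notation AC := (formsC E).
Local Notation tup := ((r + r).-tuple R).
Local Notation kap := (abs_level k s).
Local Notation pC := (pC ip T tau).
Local Notation qC := (qC ip T k s tau).
Local Notation tr := (tr ip T k s tau).
Local Notation ei := (0 +i* eta : R[i]).
Local Notation "j '.l'" := (lshift r j) (at level 2, format "j .l").
Local Notation "j '.r'" := (rshift r j) (at level 2, format "j .r").

(** Here [b1] and [b2] are -i z_j and -i z_(j+r). Both sides of the intertwining identity are
    brought to this expression: [hitchin_complexifiedE] from the complexified side, [tr_hw_fun] from
    the Hitchin-Witten side. *)
Definition ladder_term (f : tup -> R[i]) (A : AC) (j : 'I_r) : R[i] :=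
  let b1 := tnth (qC A) j.l +i* (- tnth (pC A) j.l) in
  let b2 := tnth (qC A) j.r +i* (- tnth (pC A) j.r) in
  let S2 := tr (mulq (mulq f j.l) j.l) A + ei * (tr (mulq (mulq f j.l) j.r) A
     + tr (mulq (mulq f j.r) j.l) A) - tr (mulq (mulq f j.r) j.r) A in
  ((4 * tau.2)^-1)%:C * (kap%:C * (b1 * tr (mulq f j.r) A - b2 * tr (mulq f j.l) A)
   + 'i * (k%:R +i* (eta * s)) *
    (S2 - (b1 + ei * b2) * (tr (mulq f j.l) A + ei * tr (mulq f j.r) A)
     + 2^-1 * (b1 + ei * b2) ^+ 2 * tr f A)).

Let e1 : R * R := (1, 0).
Let e2 : R * R := (0, 1).

(** Divided by 4 tau_2, the quantities x1, x2 and y1, y2 are |t| times the p- and q-rates [dotC],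
    combined over the two directions of tau as [d_eta] prescribes. *)
Lemma dot_term (f : tup -> R[i]) A : L2 f -> (forall i, L2 (mulq f i)) ->
  (d_eta eta).1 * deriveC (pt T k s tau (dotC k s tau e1 (pC A) (qC A)) (dotC k s tau e1 (qC A) (pC A))) (tr f) A +
  (d_eta eta).2 * deriveC (pt T k s tau (dotC k s tau e2 (pC A) (qC A)) (dotC k s tau e2 (qC A) (pC A))) (tr f) A
  = \sum_j
   let p1 := tnth (pC A) j.l in let p2 := tnth (pC A) j.r in
   let q1 := tnth (qC A) j.l in let q2 := tnth (qC A) j.r in
   let y1 := (kap * q2 + (k%:R * p1 - s * p2)) +i* (eta * (s * p1 + k%:R * p2)) in
   let y2 := - (kap * q1 + (s * p1 + k%:R * p2)) +i* (eta * (k%:R * p1 - s * p2)) in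
   let x1 := (kap * p2 + (k%:R * q1 - s * q2)) +i* (eta * (s * q1 + k%:R * q2)) in
   let x2 := - (kap * p1 + (s * q1 + k%:R * q2)) +i* (eta * (k%:R * q1 - s * q2)) in
   ((4 * tau.2)^-1)%:C * ((y1 - 'i * x1) * tr (mulq f j.l) A + (y2 - 'i * x2) * tr (mulq f j.r) A
     + (- (y1 * q1%:C + y2 * q2%:C) + 'i * 2^-1 *
         (x1 * q1%:C + x2 * q2%:C + y1 * p1%:C + y2 * p2%:C)) * tr f A).
Proof.
move=> Lf Lqf; have K0 := kap_neq0 hk s.
have t2 : tau.2 != 0 by rewrite gt_eqF.
pose D (x y : tup) := \sum_i ((kap * tnth y i) +i* (- (kap * tnth x i))) * tr (mulq f i) A +
  ((- (kap * \sum_j tnth y j * tnth (qC A) j)) +i*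
     (kap / 2 * \sum_j (tnth x j * tnth (qC A) j + tnth y j * tnth (pC A) j))) * tr f A.
have DE e : deriveC (pt T k s tau (dotC k s tau e (pC A) (qC A)) (dotC k s tau e (qC A) (pC A))) (tr f) A =
    D (dotC k s tau e (pC A) (qC A)) (dotC k s tau e (qC A) (pC A)).
  by rewrite (is_deriveC_val (tr_derive ip T hk s tau A _ Lf Lqf)) /cf !(pC_pt hT hk)// !(qC_pt hT hk).
pose c0 (x y q p : R) : R[i] := (- (kap * (y * q))) +i* (kap / 2 * (x * q + y * p)).
have D2 x y : D x y = \sum_j (((kap * tnth y j.l) +i* (- (kap * tnth x j.l))) * tr (mulq f j.l) A +
   ((kap * tnth y j.r) +i* (- (kap * tnth x j.r))) * tr (mulq f j.r) A +
   (c0 (tnth x j.l) (tnth y j.l) (tnth (qC A) j.l) (tnth (pC A) j.l) +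
    c0 (tnth x j.r) (tnth y j.r) (tnth (qC A) j.r) (tnth (pC A) j.r)) * tr f A).
  have -> : D x y = \sum_i ((kap * tnth y i) +i* (- (kap * tnth x i))) * tr (mulq f i) A +
      (\sum_i c0 (tnth x i) (tnth y i) (tnth (qC A) i) (tnth (pC A) i)) * tr f A.
    congr (_ + _ * _); apply/eqP; rewrite eq_complex !raddf_sum /=.
    by rewrite mulr_sumr -sumrN mulr_sumr !eqxx.
  by rewrite mulr_suml -big_split /= big_split_ord /= -big_split /=; apply: eq_bigr => j _; ring.
rewrite !DE !D2 !mulr_sumr -big_split /=; apply: eq_bigr => j _.
rewrite !dotC_l !dotC_r.
have helper (a b c X1 X2 X3 Y1 Y2 Y3 Z1 Z2 Z3 f1 f2 f3 : R[i]) :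
    a * X1 + b * X2 = c * X3 -> a * Y1 + b * Y2 = c * Y3 -> a * Z1 + b * Z2 = c * Z3 ->
    a * (X1 * f1 + Y1 * f2 + Z1 * f3) + b * (X2 * f1 + Y2 * f2 + Z2 * f3) =
    c * (X3 * f1 + Y3 * f2 + Z3 * f3).
  move=> HX HY HZ; transitivity ((a * X1 + b * X2) * f1 + (a * Y1 + b * Y2) * f2 + (a * Z1 + b * Z2) * f3).
    by ring.
  by rewrite HX HY HZ; ring.
apply: helper; rewrite /c0 /bt1 /bt2 /e1 /e2 /=;
  move: (tnth (qC A) j.l) (tnth (qC A) j.r) (tnth (pC A) j.l) (tnth (pC A) j.r) => q1 q2 p1 p2;
  by case: heta => ->; apply: complex_ext => /=; field; rewrite K0 t2.
Qed.

Lemma bargmann_tr (psi : AC -> R[i]) :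
  bargmann T k s tau psi = tr (fun q => psi (ptQ T k s tau q)).
Proof. by apply: funext => A; exact: bargmannE. Qed.

(** Passing from a fixed point to fixed coordinates costs the first-order expression of [dot_term].
    Its sum with the Laplacian is compared with [ladder_term] moment by moment, using that the mixed
    second moments are symmetric. *)
Lemma hitchin_complexifiedE (psi : R * R -> AC -> R[i]) A :
  let f q := psi tau (ptQ T k s tau q) in
  let F sg := bargmann T k s sg (psi sg) in
  differentiableC (fun x : (R * R) * AC => F x.1 x.2) (tau, A) ->
  L2 f -> (forall i, L2 (mulq f i)) -> (forall i l, L2 (mulq (mulq f i) l)) ->
  hitchin_complexified ip T k s (d_eta eta) F tau A =
  delta T k s (d_eta eta) F tau A + \sum_j ladder_term f A j.
Proof.
move=> f F dF Lf Lqf Lqqf; have K0 := kap_neq0 hk s.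
have t2 : tau.2 != 0 by rewrite gt_eqF.
rewrite /hitchin_complexified (Dtau_family hT hk s t0 _ dF).
have FE : F tau = tr f by rewrite /F bargmann_tr.
rewrite [F tau]FE (dot_term _ Lf Lqf) (laplacian_tr hT hk s heta t0 A Lf Lqf Lqqf).
rewrite -addrA; congr (_ + _); rewrite -sumrN -big_split /=; apply: eq_bigr => j _.
have sym : tr (mulq (mulq f j.r) j.l) A = tr (mulq (mulq f j.l) j.r) A.
  by congr (tr _ A); apply: funext => q; rewrite /mulq; ring.
rewrite /ladder_term sym.
move: (tr (mulq (mulq f j.l) j.l) A) (tr (mulq (mulq f j.l) j.r) A) (tr (mulq (mulq f j.r) j.r) A)
  (tr (mulq f j.l) A) (tr (mulq f j.r) A) (tr f A) => f11 f12 f22 f1 f2 f0.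
move: (tnth (qC A) j.l) (tnth (qC A) j.r) (tnth (pC A) j.l) (tnth (pC A) j.r) => q1 q2 p1 p2.
set it := (4 * tau.2)^-1.
have [h0 h1] : 'i * 2^-1 = (0 +i* 2^-1 : R[i]) /\ 2^-1 = (2^-1 +i* 0 : R[i]).
  by split; apply: complex_ext => /=; field.
rewrite h0 h1.
by case: heta => ->; move: f11 f12 f22 f1 f2 f0 => [? ?] [? ?] [? ?] [? ?] [? ?] [? ?];
  apply: complex_ext => /=; field.
Qed.

End ComplexifiedSide.

(** * The Hitchin-Witten connection *)

Section Smooth.
Context {R : realType}.

Lemma foldr_derive_pairr (V W : normedModType R) (G : V * W -> R) (x : V) (vs : seq W) (y : W) :
  foldr (fun v g => 'D_v g) G [seq ((0, v) : V * W) | v <- vs] (x, y) =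
  foldr (fun v g => 'D_v g) (fun y => G (x, y)) vs y.
Proof.
elim: vs y => [//|v vs IH] y /=.
rewrite derive_pairr; congr ('D_v _ y); apply: funext => z; exact: IH.
Qed.

Lemma smooth_on_pairr (V W : normedModType R) (U : set V) (F : V * W -> R[i]) (x : V) :
  smooth_on (U `*` setT) F -> U x -> smooth_on setT (fun y => F (x, y)).
Proof.
move=> sF Ux vs y _.
have [dR dI] := sF [seq ((0, v) : V * W) | v <- vs] (x, y) (conj Ux I).
have dp : differentiable (fun y : W => (x, y)) y.
  by apply: differentiable_pair; exact: ex_diff.
split.
- have := differentiable_comp dp dR.
  rewrite (_ : _ \o _ = foldr (fun v g => 'D_v g) (Rec \o (fun y => F (x, y))) vs)//.
  by apply: funext => z; exact: (foldr_derive_pairr (Rec \o F)).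
- have := differentiable_comp dp dI.
  rewrite (_ : _ \o _ = foldr (fun v g => 'D_v g) (Imc \o (fun y => F (x, y))) vs)//.
  by apply: funext => z; exact: (foldr_derive_pairr (Imc \o F)).
Qed.

Lemma smooth_on_differentiable (W : normedModType R) (D : set W) (F : W -> R[i]) x :
  smooth_on D F -> D x -> differentiableC F x.
Proof. by move=> sF Dx; exact: (sF [::] x Dx). Qed.

Lemma smooth_on_deriveC (W : normedModType R) (D : set W) (F : W -> R[i]) v :
  smooth_on D F -> smooth_on D (deriveC v F).
Proof.
move=> sF vs x Dx; have := sF (rcons vs v) x Dx.
by rewrite !foldr_rcons.
Qed.

End Smooth.

(** * Polarised functions and the frame rho *)

Section Polarised.
Context {R : realType} {E : normedModType R} (ip : {dot E for idfun}).
Context {r : nat} (T : 'I_r -> E) (hT : euclidean_basis ip T).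
Context (k : nat) (hk : (0 < k)%N) (s : R).
Context (tau : R * R) (t0 : teich tau).
Local Notation AC := (formsC E).
Local Notation tup := ((r + r).-tuple R).
Local Notation kap := (abs_level k s).
Local Notation pC := (pC ip T tau).
Local Notation qC := (qC ip T k s tau).
Local Notation rho := (rho T k s tau).
Local Notation Y := (frameY T k s tau).

Lemma polarised_deriveC v (P : AC -> R[i]) : polarised T tau P -> polarised T tau (deriveC v P).
Proof.
move=> pP A p.
have E0 (f : AC -> R) : (forall A, f (A + ptP T tau p) = f A) ->
    'D_v f (A + ptP T tau p) = 'D_v f A.
  move=> fP; have E1 : (fun h : R => h^-1 *: ((f \o shift (A + ptP T tau p)) (h *: v) - f (A + ptP T tau p))) =
      (fun h : R => h^-1 *: ((f \o shift A) (h *: v) - f A)).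
    by apply: funext => h /=; rewrite addrA !fP.
  by rewrite /derive E1.
by congr (_ +i* _); apply: E0 => B /=; rewrite pP.
Qed.

Lemma ptP_scale h p : h *: ptP T tau p = ptP T tau [tuple h * tnth p i | i < r + r].
Proof.
by rewrite /ptP scaler_sumr; apply: eq_bigr => i _; rewrite tnth_mktuple scalerA.
Qed.

Lemma deriveC_ptP p (P : AC -> R[i]) A : polarised T tau P -> deriveC (ptP T tau p) P A = 0.
Proof.
move=> pP; suff H : is_deriveC A (ptP T tau p) P 0 by exact: (is_deriveC_val H).
apply: (is_deriveC_line P A (ptP T tau p) 0).1.
have -> : (fun h : R => P (h *: ptP T tau p + A)) = fun=> P A.
  by apply: funext => h; rewrite addrC ptP_scale pP.
exact: is_deriveC_cst.
Qed.

(** The P-component of the direction contributes nothing, which leaves the frame Y. *)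
Lemma deriveC_polarised x y (P : AC -> R[i]) A : polarised T tau P -> differentiableC P A ->
  deriveC (pt T k s tau x y) P A = \sum_i (tnth y i)%:C * deriveC (Y i) P A.
Proof.
by move=> pP dP; rewrite /pt deriveC_add// deriveC_ptP// add0r /ptQ deriveC_sum.
Qed.

Lemma deriveC_qC e (P : AC -> R[i]) A : polarised T tau P -> differentiableC P A ->
  deriveC e P A = \sum_i (tnth (qC e) i)%:C * deriveC (Y i) P A.
Proof.
by move=> pP dP; rewrite -{1}(pt_pCqC hT hk s e t0) deriveC_polarised.
Qed.

Lemma rhoE A : rho A = cexp (0 +i* (- (kap / 2 * dot (pC A) (qC A)))).
Proof. by rewrite /Defs.rho (coordsE hT hk s A t0). Qed.

Lemma pC_derive A e i : is_derive A e (fun A => tnth (pC A) i) (tnth (pC e) i).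
Proof.
apply: ((is_derive_line _ _ _ _).1 _).
rewrite (_ : (fun h => _) = fun h : R => tnth (pC A) i + h * tnth (pC e) i).
  have H := is_derive_addf (is_derive_cstf 0 (1:R) (tnth (pC A) i))
    (is_derive_mulf (is_derive_id 0 (1 : R)) (is_derive_cstf 0 (1:R) (tnth (pC e) i))).
  by apply: (is_derive_eqf H); rewrite /=; ring.
by apply: funext => h; rewrite pC_lin tnth_lin.
Qed.

Lemma qC_deriveR A e i : is_derive A e (fun A => tnth (qC A) i) (tnth (qC e) i).
Proof. by have [H _] := qC_derive ip T hk s tau A e i. Qed.

Lemma rho_derive A e : is_deriveC A e rho
  ((0 +i* (- (kap / 2 * \sum_i (tnth (pC e) i * tnth (qC A) i + tnth (pC A) i * tnth (qC e) i))))
   * rho A).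
Proof.
rewrite (_ : rho = fun A => cexp (0 +i* (- (kap / 2 * dot (pC A) (qC A))))); last first.
  by apply: funext => B; rewrite rhoE.
have H := is_derive_oppf (is_derive_scalef (kap / 2) (is_derive_sumf (index_enum 'I_(r + r))
  (fun i => is_derive_mulf (pC_derive A e i) (qC_deriveR A e i)))).
exact: (is_deriveC_exp (is_derive_cstf A e 0) H).
Qed.

Local Notation om := (omega_t ip k s).

(** The derivative of rho and the symplectic potential add up to -i |t| p . q(e): along P_tau, where
    q(e) = 0, the frame rho is covariantly constant. *)
Lemma nabla_polarised (P : AC -> R[i]) A e : polarised T tau P -> differentiableC P A ->
  nabla om e (fun A => P A * rho A) A =
  rho A * \sum_i (tnth (qC e) i)%:C * (deriveC (Y i) P A - (0 +i* (kap * tnth (pC A) i)) * P A).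
Proof.
move=> pP dP; rewrite /nabla.
have H := is_deriveC_mul (differentiableC_is_deriveC e dP) (rho_derive A e).
rewrite (is_deriveC_val H) (deriveC_qC e pP dP).
set D := \sum_(i < r + r) _.
have -> : \sum_(i < r + r) (tnth (qC e) i)%:C * (deriveC (Y i) P A - (0 +i* (kap * tnth (pC A) i)) * P A)
    = D - (\sum_i (0 +i* (kap * (tnth (pC A) i * tnth (qC e) i)))) * P A.
  have Ei i : (tnth (qC e) i)%:C * (0 +i* (kap * tnth (pC A) i)) = 0 +i* (kap * (tnth (pC A) i * tnth (qC e) i)).
    by apply: complex_ext => /=; ring.
  by rewrite mulr_suml -sumrB; apply: eq_bigr => i _; rewrite -Ei mulrBr mulrA.
have key : (0 +i* (- (kap / 2 * \sum_i (tnth (pC e) i * tnth (qC A) i + tnth (pC A) i * tnth (qC e) i))))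
   - (0 +i* (om A e / 2)) = - \sum_i (0 +i* (kap * (tnth (pC A) i * tnth (qC e) i))) :> R[i].
  rewrite (omega_tE hT hk s A e t0); apply/eqP; rewrite eq_complex -sumrN.
  apply/andP; split; apply/eqP; rewrite !raddf_sum /=.
  - by rewrite subr0 big1// => i _; rewrite oppr0.
  - by rewrite !mulr_sumr mulr_suml -sumrN -sumrB; apply: eq_bigr => i _; field.
rewrite -[\sum_i (0 +i* _)]opprK -key; move: (_ +i* _) (_ +i* _) => X Z.
ring.
Qed.

End Polarised.

Section NablaCalculus.
Context {R : realType} {W : normedModType R} (om : W -> W -> R).

Lemma nabla_sum (I : finType) (c : I -> R[i]) (F : I -> W -> R[i]) A e :
  (forall i, derivableC (F i) A e) ->
  nabla om e (fun A => \sum_i c i * F i A) A = \sum_i c i * nabla om e (F i) A.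
Proof.
move=> dF0; have dF i := derivableCP (dF0 i); rewrite /nabla.
have H := is_deriveC_sum (index_enum I) (fun i => is_deriveC_scale (c i) (dF i)).
rewrite (is_deriveC_val H) mulr_sumr -sumrB; apply: eq_bigr => i _.
by rewrite mulrBr mulrCA.
Qed.

Lemma nabla_sub (F G : W -> R[i]) (a b : R[i]) A e :
  is_deriveC A e F a -> is_deriveC A e G b ->
  nabla om e (fun A => F A - G A) A = nabla om e F A - nabla om e G A.
Proof.
move=> dF dG; rewrite /nabla.
have H := is_deriveC_add dF (is_deriveC_scale (-1) dG).
have -> : (fun A => F A - G A) = fun A => F A + -1 * G A by apply: funext => y; rewrite mulN1r.
rewrite (is_deriveC_val H) (is_deriveC_val dF) (is_deriveC_val dG); ring.
Qed.

Lemma nabla_mul (g F : W -> R[i]) (a b : R[i]) A e :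
  is_deriveC A e g a -> is_deriveC A e F b ->
  nabla om e (fun A => g A * F A) A = a * F A + g A * nabla om e F A.
Proof.
move=> dg dF; rewrite /nabla (is_deriveC_val (is_deriveC_mul dg dF)) (is_deriveC_val dF); ring.
Qed.

End NablaCalculus.

Section HitchinWittenSide.
Context {R : realType} {E : normedModType R} (ip : {dot E for idfun}).
Context {r : nat} (T : 'I_r -> E) (hT : euclidean_basis ip T).
Context (k : nat) (hk : (0 < k)%N) (s : R).
Context (tau : R * R) (t0 : teich tau).
Local Notation AC := (formsC E).
Local Notation tup := ((r + r).-tuple R).
Local Notation kap := (abs_level k s).
Local Notation pC := (pC ip T tau).
Local Notation qC := (qC ip T k s tau).
Local Notation rho := (rho T k s tau).
Local Notation Y := (frameY T k s tau).
Local Notation om := (omega_t ip k s).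

(** The composition of D_l - i |t| p_l with D_i - i |t| p_i applied to P, the coordinates p being
    treated as constants. *)
Definition hess (P : AC -> R[i]) A (i l : 'I_(r + r)) : R[i] :=
  deriveC (Y l) (deriveC (Y i) P) A - (0 +i* (kap * tnth (pC A) l)) * deriveC (Y i) P A
  - (0 +i* (kap * tnth (pC A) i)) * deriveC (Y l) P A
  - (kap ^+ 2 * tnth (pC A) i * tnth (pC A) l)%:C * P A.

(** Iterating [nabla_polarised] gives [hess] and one more term, which comes from differentiating the
    coefficient p_i along e'. *)
Lemma nabla2_polarised (P : AC -> R[i]) A e e' : polarised T tau P ->
  (forall A, differentiableC P A) -> (forall i A, differentiableC (deriveC (Y i) P) A) ->
  nabla om e' (nabla om e (fun A => P A * rho A)) A =
  rho A * (\sum_i \sum_l (tnth (qC e) i)%:C * (tnth (qC e') l)%:C * hess P A i l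
    - (0 +i* (kap * \sum_i tnth (qC e) i * tnth (pC e') i)) * P A).
Proof.
move=> pP dP dDP.
have -> : nabla om e (fun A => P A * rho A) = fun A => \sum_i (tnth (qC e) i)%:C *
    (deriveC (Y i) P A * rho A - (0 +i* (kap * tnth (pC A) i)) * (P A * rho A)).
  apply: funext => B; rewrite (nabla_polarised hT hk s t0 e pP (dP B)) mulr_sumr.
  by apply: eq_bigr => i _; ring.
have dr := rho_derive hT hk s t0 A e'.
have dPr := is_deriveC_mul (differentiableC_is_deriveC e' (dP A)) dr.
have dDr i := is_deriveC_mul (differentiableC_is_deriveC e' (dDP i A)) dr.
have dp i := is_deriveC_cplx (is_derive_cstf A e' 0) (is_derive_scalef kap (pC_derive ip T tau A e' i)).
have dpPr i := is_deriveC_mul (dp i) dPr.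
have H i := is_deriveC_add (dDr i) (is_deriveC_scale (-1) (dpPr i)).
have dG i : derivableC (fun A => deriveC (Y i) P A * rho A - (0 +i* (kap * tnth (pC A) i)) * (P A * rho A)) A e'.
  have E0 : (fun A => deriveC (Y i) P A * rho A - (0 +i* (kap * tnth (pC A) i)) * (P A * rho A)) =
   (fun A => deriveC (Y i) P A * rho A + -1 * ((0 +i* (kap * tnth (pC A) i)) * (P A * rho A))).
    by apply: funext => y; rewrite mulN1r.
  by rewrite E0; exact: is_deriveC_derivable (H i).
rewrite (nabla_sum om (fun i => (tnth (qC e) i)%:C) dG).
pose S i := \sum_l (tnth (qC e') l)%:C * hess P A i l - (0 +i* (kap * tnth (pC e') i)) * P A.
transitivity (rho A * \sum_i (tnth (qC e) i)%:C * S i).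
  rewrite mulr_sumr; apply: eq_bigr => i _.
  rewrite mulrCA; congr (_ * _).
  rewrite (nabla_sub om (dDr i) (dpPr i)) (nabla_mul om (dp i) dPr).
  rewrite (nabla_polarised hT hk s t0 e' (polarised_deriveC _ pP) (dDP i A)).
  rewrite (nabla_polarised hT hk s t0 e' pP (dP A)) /S /hess.
  set a := 0 +i* (kap * tnth (pC A) i).
  have -> : \sum_l (tnth (qC e') l)%:C * (deriveC (Y l) (deriveC (Y i) P) A - (0 +i* (kap * tnth (pC A) l)) * deriveC (Y i) P A
     - a * deriveC (Y l) P A - (kap ^+ 2 * tnth (pC A) i * tnth (pC A) l)%:C * P A) =
    \sum_l (tnth (qC e') l)%:C * (deriveC (Y l) (deriveC (Y i) P) A - (0 +i* (kap * tnth (pC A) l)) * deriveC (Y i) P A)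
    - a * \sum_l (tnth (qC e') l)%:C * (deriveC (Y l) P A - (0 +i* (kap * tnth (pC A) l)) * P A).
    rewrite mulr_sumr -sumrB; apply: eq_bigr => l _.
    have -> : (kap ^+ 2 * tnth (pC A) i * tnth (pC A) l)%:C = - (a * (0 +i* (kap * tnth (pC A) l))).
      by apply: complex_ext => /=; rewrite /a /=; ring.
    by move: a (0 +i* _) => ? ?; ring.
  rewrite /a.
  by move: (\sum_l _) (\sum_l _) => ? ?; ring.
congr (_ * _); rewrite /S.
have -> : (0 +i* (kap * \sum_i tnth (qC e) i * tnth (pC e') i)) =
    \sum_i (tnth (qC e) i)%:C * (0 +i* (kap * tnth (pC e') i)) :> R[i].
  rewrite mulr_sumr; apply/eqP; rewrite eq_complex !raddf_sum /=; apply/andP; split; apply/eqP.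
    by rewrite big1// => i _; ring.
  by apply: eq_bigr => i _; ring.
rewrite mulr_suml -sumrB; apply: eq_bigr => i _.
by rewrite mulrBr mulr_sumr mulrA; congr (_ - _); apply: eq_bigr => l _; rewrite mulrA.
Qed.

End HitchinWittenSide.

Section HitchinWittenFormula.
Context {R : realType} {E : normedModType R} (ip : {dot E for idfun}).
Context {r : nat} (T : 'I_r -> E) (hT : euclidean_basis ip T).
Context (k : nat) (hk : (0 < k)%N) (s : R).
Context (eta : R) (heta : eta = 1 \/ eta = -1) (tau : R * R) (t0 : teich tau).
Local Notation A0 := (forms E).
Local Notation AC := (formsC E).
Local Notation tup := ((r + r).-tuple R).
Local Notation kap := (abs_level k s).
Local Notation pC := (pC ip T tau).
Local Notation qC := (qC ip T k s tau).
Local Notation rho := (rho T k s tau).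
Local Notation Y := (frameY T k s tau).
Local Notation om := (omega_t ip k s).
Local Notation V := (@Veta R r eta tau).
Local Notation hess := (hess ip T k s tau).
Local Notation ei := (0 +i* eta : R[i]).
Local Notation teta := (k%:R +i* (eta * s) : R[i]).
Local Notation "j '.l'" := (lshift r j) (at level 2, format "j .l").
Local Notation "j '.r'" := (rshift r j) (at level 2, format "j .r").

Arguments veta : simpl never.

Lemma nabla_real e (phi : AC -> R[i]) (A : A0) :
  nabla (omega_t0 ip k s) e (fun A => phi (A, 0)) A = nabla om (e, 0) phi (A, 0).
Proof. by rewrite /nabla (deriveC_pairl phi A e 0). Qed.

(** The sum contracts the second covariant derivative twice with v. Only the complex q-coordinates
    of v survive, and their square carries t_eta^2. *)
Lemma laplacian_real (P : AC -> R[i]) (A : A0) : polarised T tau P ->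
  (forall A, differentiableC P A) -> (forall i A, differentiableC (deriveC (Y i) P) A) ->
  laplacian (omega_t0 ip k s) (basis0 T) V (fun A => P (A, 0) * rho (A, 0)) A =
  rho (A, 0) * \sum_j ((0 +i* (eta / (4 * tau.2 * kap ^+ 2))) * teta ^+ 2) *
    (hess P (A, 0) j.l j.l + ei * (hess P (A, 0) j.l j.r + hess P (A, 0) j.r j.l)
     - hess P (A, 0) j.r j.r).
Proof.
move=> pP dP dDP; have K0 := kap_neq0 hk s.
have t2 : tau.2 != 0 by rewrite gt_eqF.
pose N (e' e : A0) := nabla om (e', 0) (nabla om (e, 0) (fun A => P A * rho A)) (A, 0).
have lapE : laplacian (omega_t0 ip k s) (basis0 T) V (fun A => P (A, 0) * rho (A, 0)) A =
    \sum_a \sum_b V a b * N (basis0 T a) (basis0 T b).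
  have inner b : nabla (omega_t0 ip k s) (basis0 T b) (fun A => P (A, 0) * rho (A, 0)) =
      fun A => nabla om (basis0 T b, 0) (fun A => P A * rho A) (A, 0).
    by apply: funext => B; exact: (nabla_real _ (fun A => P A * rho A)).
  have outer a b : nabla (omega_t0 ip k s) (basis0 T a)
     (nabla (omega_t0 ip k s) (basis0 T b) (fun A => P (A, 0) * rho (A, 0))) A = N (basis0 T a) (basis0 T b).
    by rewrite inner; exact: (nabla_real _ (nabla om (basis0 T b, 0) (fun A => P A * rho A))).
  by rewrite /laplacian; apply: eq_bigr => a _; apply: eq_bigr => b _; rewrite outer.
pose Q (b x : bool) : R[i] := (bq k s tau b false x)%:C.
pose H j (c c' : bool) := hess P (A, 0) (if c then j.r else j.l) (if c' then j.r else j.l).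
have NE (x y : bool) j : N (basis0 T (if x then j.r else j.l)) (basis0 T (if y then j.r else j.l)) =
   rho (A, 0) * (Q false y * (Q false x * H j false false + Q true x * H j false true) +
     Q true y * (Q false x * H j true false + Q true x * H j true true)
     - (0 +i* (kap * (bq k s tau false false y * bp tau false false x +
                      bq k s tau true false y * bp tau true false x))) * P (A, 0)).
  have bE (z : bool) : (basis0 T (if z then j.r else j.l), 0) = bvec T false z j :> AC.
    by case: z; rewrite -?basisC_ll -?basisC_lr basisC_l.
  rewrite /N !bE (nabla2_polarised hT hk t0 _ _ _ pP dP dDP).
  have ql z i : (tnth (qC (bvec T false z j)) i.l)%:C = (j == i)%:R * Q false z.
    by rewrite (qC_bvec_l hT hk) rmorphM rmorph_nat.
  have qr z i : (tnth (qC (bvec T false z j)) i.r)%:C = (j == i)%:R * Q true z.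
    by rewrite (qC_bvec_r hT hk) rmorphM rmorph_nat.
  congr (_ * (_ - (0 +i* (kap * _)) * _)).
    under eq_bigr => i _.
      under eq_bigr => l _ do rewrite -mulrA.
      rewrite -mulr_sumr (sum_delta_at _ (ql x) (qr x)).
      over.
    by rewrite (sum_delta_at _ (ql y) (qr y)).
  rewrite (sum_delta_at _ (qC_bvec_l hT hk s tau false y j) (qC_bvec_r hT hk s tau false y j)).
  by rewrite (pC_bvec_l hT) (pC_bvec_r hT) eqxx !mul1r.
rewrite lapE {lapE}; clearbody N; rewrite big_split_ord /= -big_split /= mulr_sumr; apply: eq_bigr => j _.
have SV := sum_Veta eta tau j.
move: (SV false) (SV true) => /= {}SV SV1; rewrite SV SV1 {SV SV1}.
move: (NE false false j) (NE false true j) (NE true false j) (NE true true j); rewrite /H /= => -> -> -> ->.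
move: (hess P (A, 0) j.l j.l) (hess P (A, 0) j.l j.r) (hess P (A, 0) j.r j.l)
  (hess P (A, 0) j.r j.r) (P (A, 0)) (rho (A, 0)) => h11 h12 h21 h22 P0 r0.
pose v x := veta eta tau x.
(* [Q0] and [Q1] are the q-coordinates of the complex vector v at j and j + r. *)
pose Q0 := v false * Q false false + v true * Q false true.
pose Q1 := v false * Q true false + v true * Q true true.
pose B x y := (0 +i* (kap * (bq k s tau false false y * bp tau false false x +
                      bq k s tau true false y * bp tau true false x))) : R[i].
have N2 := nrm_sqr t0.
have Q1E : Q1 = ei * Q0.
  by rewrite /Q1 /Q0 /Q /v /bq /veta; case: heta => ->; apply: complex_ext => /=; field.
have Q0E : Q0 = (nrm tau)%:C * ((tau.2 / kap)%:C * (0 +i* (- eta)) * teta).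
  by rewrite /Q0 /Q /v /bq /veta; case: heta => ->; apply: complex_ext => /=; field.
(* Both the p- and the q-coordinates of v are proportional to the null vector (1, i eta), so their
   bilinear pairing vanishes. *)
have BE : v false * (v false * B false false + v true * B false true) +
  v true * (v false * B true false + v true * B true true) = 0.
  by rewrite /B /v /bq /bp /veta; case: heta => ->; apply: complex_ext => /=; field.
transitivity (ceta eta tau * r0 * (Q0 * (Q0 * h11 + Q1 * h12) + Q1 * (Q0 * h21 + Q1 * h22) -
  (v false * (v false * B false false + v true * B false true) +
  v true * (v false * B true false + v true * B true true)) * P0)).

  rewrite /Q0 /Q1 -/(v false) -/(v true) -!/(B _ _).
  by move: (B) (v) (Q) => ? ? ?; ring.
rewrite BE mul0r subr0 Q1E.
have e2 : ei * ei = -1.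
  by case: heta => ->; apply: complex_ext => /=; ring.
have c2 : ceta eta tau * Q0 ^+ 2 = (0 +i* (eta / (4 * tau.2 * kap ^+ 2))) * teta ^+ 2.
  rewrite Q0E exprMn -rmorphXn N2 !exprMn; move: (teta ^+ 2) => X.
  rewrite !mulrA; congr (_ * X); rewrite /ceta -!rmorphXn.
  by case: heta => ->; rewrite !expr2; apply: complex_ext => /=; field; rewrite K0 t2.
rewrite -c2; move: ei e2 => e e2.
transitivity (ceta eta tau * r0 * (Q0 ^+ 2 * (h11 + e * (h12 + h21) + e * e * h22))); first ring.
by rewrite e2; ring.
Qed.

End HitchinWittenFormula.

(** * Dependence of the coordinates and of rho on tau at a fixed point *)

Section RhoFamily.
Context {R : realType} {E : normedModType R} (ip : {dot E for idfun}).
Context {r : nat} (T : 'I_r -> E) (hT : euclidean_basis ip T).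
Context (k : nat) (hk : (0 < k)%N) (s : R).
Context (tau : R * R) (t0 : teich tau).
Local Notation A0 := (forms E).
Local Notation AC := (formsC E).
Local Notation kap := (abs_level k s).
Local Notation pC := (pC ip T).
Local Notation qC := (qC ip T k s).

Lemma bt_qC A j : bt1 k s (qC tau A) j = nrm tau *
    - (ip A.2.2 (T j) - tau.1 * ip A.2.1 (T j) - tau.2 * ip A.1.1 (T j)) /\
  bt2 k s (qC tau A) j = nrm tau *
    (ip A.1.2 (T j) - tau.1 * ip A.1.1 (T j) + tau.2 * ip A.2.1 (T j)).
Proof.
have K0 := kap_neq0 hk s.
have K2 : (k%:R ^+ 2 + s ^+ 2) / kap ^+ 2 = 1.
  by rewrite -kap_sqr divff// expf_neq0.
by split; rewrite /bt1 /bt2 qC_l qC_r -[RHS](eq1_mul _ K2); field; rewrite K0.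
Qed.

Lemma pC_family A e i : is_derive (0 : R) 1 (fun h : R => tnth (pC (h *: e + tau) A) i)
  (- tnth (dotC k s tau e (pC tau A) (qC tau A)) i).
Proof.
have t2 : tau.2 != 0 by rewrite gt_eqF.
have dN := nrm_derive t0 e.
have d1 := (is_derive_line (fun sg : R * R => sg.1) tau e e.1).2 (is_derive_fst tau e).
have d2 := (is_derive_line (fun sg : R * R => sg.2) tau e e.2).2 (is_derive_snd tau e).
have dc (c : R) := is_derive_cstf (0 : R) (1 : R) c.
have E1 : (0 *: e + tau).1 = tau.1 by rewrite scale0r add0r.
have E2 : (0 *: e + tau).2 = tau.2 by rewrite scale0r add0r.
have E3 : nrm (0 *: e + tau) = nrm tau by rewrite /nrm E2.
rewrite -(splitK i); case: (fintype.split i) => j /=.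
- under eq_fun do rewrite pC_l.
  have H := is_derive_mulf dN (is_derive_addf (is_derive_addf (dc (ip A.2.2 (T j)))
    (is_derive_oppf (is_derive_mulf d1 (dc (ip A.2.1 (T j))))))
    (is_derive_mulf d2 (dc (ip A.1.1 (T j))))).
  apply: (is_derive_eqf H); rewrite E1 E2 E3 dotC_l pC_r.
  by have [-> ->] := bt_qC A j; field.
- under eq_fun do rewrite pC_r.
  have H := is_derive_oppf (is_derive_mulf dN (is_derive_addf (is_derive_addf (dc (ip A.1.2 (T j)))
    (is_derive_oppf (is_derive_mulf d1 (dc (ip A.1.1 (T j))))))
    (is_derive_oppf (is_derive_mulf d2 (dc (ip A.2.1 (T j))))))).
  apply: (is_derive_eqf H); rewrite E1 E2 E3 dotC_r pC_l.
  by have [-> ->] := bt_qC A j; field.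
Qed.

Lemma qC_family A e i : is_derive (0 : R) 1 (fun h : R => tnth (qC (h *: e + tau) A) i)
  (- tnth (dotC k s tau e (qC tau A) (pC tau A)) i).
Proof.
have t2 : tau.2 != 0 by rewrite gt_eqF.
have K0 := kap_neq0 hk s.
have dN := nrm_derive t0 e.
have d1 := (is_derive_line (fun sg : R * R => sg.1) tau e e.1).2 (is_derive_fst tau e).
have d2 := (is_derive_line (fun sg : R * R => sg.2) tau e e.2).2 (is_derive_snd tau e).
have dc (c : R) := is_derive_cstf (0 : R) (1 : R) c.
have E1 : (0 *: e + tau).1 = tau.1 by rewrite scale0r add0r.
have E2 : (0 *: e + tau).2 = tau.2 by rewrite scale0r add0r.
have E3 : nrm (0 *: e + tau) = nrm tau by rewrite /nrm E2.
have da (j : 'I_r) := is_derive_addf (is_derive_addf (dc (ip A.1.2 (T j)))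
    (is_derive_oppf (is_derive_mulf d1 (dc (ip A.1.1 (T j))))))
    (is_derive_mulf d2 (dc (ip A.2.1 (T j)))).
have db (j : 'I_r) := is_derive_addf (is_derive_addf (dc (ip A.2.2 (T j)))
    (is_derive_oppf (is_derive_mulf d1 (dc (ip A.2.1 (T j))))))
    (is_derive_oppf (is_derive_mulf d2 (dc (ip A.1.1 (T j))))).
rewrite -(splitK i); case: (fintype.split i) => j /=.
- under eq_fun do rewrite qC_l.
  have H := is_derive_mulf (is_derive_mulf dN (dc kap^-1))
    (is_derive_addf (is_derive_scalef k%:R (da j)) (is_derive_oppf (is_derive_scalef s (db j)))).
  apply: (is_derive_eqf H); rewrite E1 E2 E3 dotC_l qC_r /bt1 /bt2 pC_l pC_r.
  by field; rewrite t2 K0.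
- under eq_fun do rewrite qC_r.
  have H := is_derive_oppf (is_derive_mulf (is_derive_mulf dN (dc kap^-1))
    (is_derive_addf (is_derive_scalef s (da j)) (is_derive_scalef k%:R (db j)))).
  apply: (is_derive_eqf H); rewrite E1 E2 E3 dotC_r qC_l /bt1 /bt2 pC_l pC_r.
  by field; rewrite t2 K0.
Qed.

Lemma rho_family A e : is_deriveC tau e (fun sg => rho T k s sg A)
  ((0 +i* (kap / 2 * \sum_i (tnth (dotC k s tau e (pC tau A) (qC tau A)) i * tnth (qC tau A) i +
     tnth (pC tau A) i * tnth (dotC k s tau e (qC tau A) (pC tau A)) i))) * rho T k s tau A).
Proof.
have E0 : 0 *: e + tau = tau by rewrite scale0r add0r.
suff H : is_deriveC tau e (fun sg => cexp (0 +i* (- (kap / 2 * dot (pC sg A) (qC sg A)))))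
    ((0 +i* (kap / 2 * \sum_i (tnth (dotC k s tau e (pC tau A) (qC tau A)) i * tnth (qC tau A) i +
     tnth (pC tau A) i * tnth (dotC k s tau e (qC tau A) (pC tau A)) i))) * rho T k s tau A).
  apply: near_is_deriveC H; apply: filterS (near_teich t0) => sg sg0.
  by rewrite (rhoE hT hk s sg0).
apply: (is_deriveC_line (fun sg => cexp (0 +i* (- (kap / 2 * dot (pC sg A) (qC sg A))))) tau e _).1.
have H := is_derive_oppf (is_derive_scalef (kap / 2) (is_derive_sumf (index_enum 'I_(r + r))
  (fun i => is_derive_mulf (pC_family A e i) (qC_family A e i)))).
apply: (is_deriveC_eq (is_deriveC_exp (is_derive_cstf (0 : R) (1 : R) 0) H)).
rewrite E0 (rhoE hT hk s t0); congr ((0 +i* _) * _).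
rewrite -mulrN -sumrN; congr (_ * _); apply: eq_bigr => i _; ring.
Qed.

End RhoFamily.

Section HitchinWitten.
Context {R : realType} {E : normedModType R} (ip : {dot E for idfun}).
Context {r : nat} (T : 'I_r -> E) (hT : euclidean_basis ip T).
Context (k : nat) (hk : (0 < k)%N) (s : R).
Context (eta : R) (heta : eta = 1 \/ eta = -1) (tau : R * R) (t0 : teich tau).
Local Notation A0 := (forms E).
Local Notation AC := (formsC E).
Local Notation kap := (abs_level k s).
Local Notation pC := (pC ip T tau).
Local Notation qC := (qC ip T k s tau).
Local Notation rho := (rho T k s).
Local Notation Y := (frameY T k s tau).
Local Notation V := (@Veta R r eta tau).
Local Notation hess := (hess ip T k s tau).
Local Notation ei := (0 +i* eta : R[i]).
Local Notation teta := (k%:R +i* (eta * s) : R[i]).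
Local Notation "j '.l'" := (lshift r j) (at level 2, format "j .l").
Local Notation "j '.r'" := (rshift r j) (at level 2, format "j .r").

Definition hw_term (P : AC -> R[i]) (A : AC) (j : 'I_r) : R[i] :=
  let q1 := (tnth (qC A) j.l)%:C in let q2 := (tnth (qC A) j.r)%:C in
  ((4 * tau.2)^-1)%:C * (q1 * deriveC (Y j.r) P A - q2 * deriveC (Y j.l) P A
   + 'i * teta * (((2 * kap ^+ 2)^-1)%:C *
      (deriveC (Y j.l) (deriveC (Y j.l) P) A
       + ei * (deriveC (Y j.r) (deriveC (Y j.l) P) A + deriveC (Y j.l) (deriveC (Y j.r) P) A)
       - deriveC (Y j.r) (deriveC (Y j.r) P) A)
      + 2^-1 * (q1 + ei * q2) ^+ 2 * P A)).

(** For eta = 1 only [HW_G] survives, with weight 1 / (2 t); for eta = -1 only [HW_Gbar], with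
    weight -1 / (2 conj(t)). Both are eta / (2 t_eta). *)
Lemma hitchin_witten_laplacian (eta0 : R * R -> A0 -> R[i]) A :
  hitchin_witten ip T k s (d_eta eta) eta0 tau A =
  Dtau (d_eta eta) (fun sg => eta0 sg A) tau +
  (eta / 2)%:C * teta^-1 * laplacian (omega_t0 ip k s) (basis0 T) V (eta0 tau) A.
Proof.
rewrite /hitchin_witten (HW_G_eta hT heta t0) (HW_Gbar_eta hT heta t0).
have lapZ (c : R[i]) : laplacian (omega_t0 ip k s) (basis0 T) (c *: V) (eta0 tau) A =
    c * laplacian (omega_t0 ip k s) (basis0 T) V (eta0 tau) A.
  rewrite /laplacian mulr_sumr; apply: eq_bigr => a _; rewrite mulr_sumr; apply: eq_bigr => b _.
  by rewrite mxE mulrA.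
rewrite !lapZ; congr (_ + _).
move: (laplacian _ _ _ _ _) => L.
have h1 : 2^-1 = (2^-1 +i* 0 : R[i]).
  by apply: complex_ext => /=; field.
rewrite !mulrA -mulrBl -mulNr mulrA; congr (_ * L).
case: heta => ->.
- have -> : (1 - 1) / 2 = 0 :> R by field.
  have -> : (1 + 1) / 2 = 1 :> R by field.
  by rewrite mulr0 sub0r mulr1 mulrNN mul1r h1 /level mul1r.
- have -> : (1 - -1) / 2 = 1 :> R by field.
  have -> : (1 + -1) / 2 = 0 :> R by field.
  rewrite mulr0 subr0 mulr1 h1; congr (_ * _^-1).
    by apply: complex_ext => /=; ring.
  by rewrite /level mulN1r.
Qed.

(** A real form satisfies alpha conj(Z) = conj(W) in the notation of [bt1], so its p- and
    q-coordinates determine each other. *)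
Lemma real_coords (A : A0) j :
  [/\ tnth (qC (A, 0)) j.l = (s * tnth (pC (A, 0)) j.l - k%:R * tnth (pC (A, 0)) j.r) / kap,
      tnth (qC (A, 0)) j.r = (k%:R * tnth (pC (A, 0)) j.l + s * tnth (pC (A, 0)) j.r) / kap,
      bt1 k s (qC (A, 0)) j = tnth (pC (A, 0)) j.l &
      bt2 k s (qC (A, 0)) j = - tnth (pC (A, 0)) j.r].
Proof.
have K0 := kap_neq0 hk s; have [-> ->] := bt_qC ip T hk s tau (A, 0) j.
by rewrite qC_l qC_r pC_l pC_r /= !ip0l; split; field.
Qed.

Lemma hitchin_wittenE (psi : R * R -> AC -> R[i]) (A : A0) : polarised T tau (psi tau) ->
  (forall A, differentiableC (fun x : (R * R) * AC => psi x.1 x.2) (tau, A)) ->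
  (forall i A, differentiableC (deriveC (Y i) (psi tau)) A) ->
  hitchin_witten ip T k s (d_eta eta) (fun sg A => psi sg (A, 0) * rho sg (A, 0)) tau A =
  rho tau (A, 0) * (delta T k s (d_eta eta) psi tau (A, 0) + \sum_j hw_term (psi tau) (A, 0) j).
Proof.
move=> pP dpsi dDP; have K0 := kap_neq0 hk s.
have t2 : tau.2 != 0 by rewrite gt_eqF.
have K2 : (k%:R ^+ 2 + s ^+ 2) / kap ^+ 2 = 1.
  by rewrite -kap_sqr divff// expf_neq0.
have dP B : differentiableC (psi tau) B := differentiableC_pairr (dpsi B).
rewrite hitchin_witten_laplacian (laplacian_real hT hk heta t0 A pP dP dDP).
have dsg e := is_deriveC_mul (differentiableC_is_deriveC e (differentiableC_pairl (dpsi (A, 0))))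
  (rho_family hT hk s t0 (A, 0) e).
rewrite (Dtau_val _ (dsg (1, 0)) (dsg (0, 1))).
have DF := Dtau_family hT hk s t0 (d_eta eta) (dpsi (A, 0)).
pose x e i := tnth (dotC k s tau e (pC (A, 0)) (qC (A, 0))) i.
pose y e i := tnth (dotC k s tau e (qC (A, 0)) (pC (A, 0))) i.
pose D1 i := deriveC (Y i) (psi tau) (A, 0).
have BE e : deriveC (pt T k s tau (dotC k s tau e (pC (A, 0)) (qC (A, 0)))
    (dotC k s tau e (qC (A, 0)) (pC (A, 0)))) (psi tau) (A, 0) =
    \sum_j ((y e j.l)%:C * D1 j.l + (y e j.r)%:C * D1 j.r).
  have H : deriveC (pt T k s tau (dotC k s tau e (pC (A, 0)) (qC (A, 0)))
    (dotC k s tau e (qC (A, 0)) (pC (A, 0)))) (psi tau) (A, 0) = \sum_i (y e i)%:C * D1 i.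
    by apply: deriveC_polarised.
  by rewrite H big_split_ord /= -big_split.
have SE e : 0 +i* (kap / 2 * \sum_i (x e i * tnth (qC (A, 0)) i + tnth (pC (A, 0)) i * y e i)) =
    \sum_j (0 +i* (kap / 2 * (x e j.l * tnth (qC (A, 0)) j.l + tnth (pC (A, 0)) j.l * y e j.l +
      (x e j.r * tnth (qC (A, 0)) j.r + tnth (pC (A, 0)) j.r * y e j.r)))) :> R[i].
  apply/eqP; rewrite eq_complex !raddf_sum /=; apply/andP; split; apply/eqP.
    by rewrite big1.
  by rewrite big_split_ord /= -big_split mulr_sumr.
(* Pulls out the common factor rho and the delta-derivative; the remainder is first-order terms and
   Laplacian, compared summand by summand with [hw_term]. *)
have rearrange (v1 v2 a1 a2 S1 S2 B1 B2 P0 r0 d c L G : R[i]) :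
    v1 * a1 + v2 * a2 = d - (v1 * B1 + v2 * B2) ->
    (v1 * S1 + v2 * S2) * P0 - (v1 * B1 + v2 * B2) + c * L = G ->
    v1 * (a1 * r0 + P0 * (S1 * r0)) + v2 * (a2 * r0 + P0 * (S2 * r0)) + c * (r0 * L) =
    r0 * (d + G).
  move=> DE <-; transitivity (r0 * ((v1 * a1 + v2 * a2) + (v1 * S1 + v2 * S2) * P0 + c * L)); first by ring.
  by rewrite DE; ring.
apply: (rearrange _ _ _ _ _ _ _ _ _ _ _ _ _ _ DF).
rewrite !SE !BE !mulr_sumr -!big_split /= mulr_suml -sumrB -big_split /=.
apply: eq_bigr => j _.
have teta0 : teta != 0.
  by rewrite eq_complex negb_and /= pnatr_eq0 -lt0n hk.
(* The factor 1 / t_eta of the connection meets the t_eta^2 of [laplacian_real], leaving one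
   power. *)
have cE H : (eta / 2)%:C * teta^-1 * ((0 +i* (eta / (4 * tau.2 * kap ^+ 2))) * teta ^+ 2 * H) =
    (0 +i* (8 * tau.2 * kap ^+ 2)^-1) * teta * H.
  have -> : (0 +i* (8 * tau.2 * kap ^+ 2)^-1) = (eta / 2)%:C * (0 +i* (eta / (4 * tau.2 * kap ^+ 2))) :> R[i].
    by case: heta => ->; apply: complex_ext => /=; field; rewrite t2 K0.
  by move: (_ +i* _) (_%:C) teta0 => ? ? ?; field.
rewrite cE /hess /hw_term -/(D1 _) -/(D1 _).
have [ql qr b1 b2] := real_coords A j.
(* Comparison of coefficients: the four hypotheses concern, in order, the second derivatives of P,
   its derivative along Y_j, its derivative along Y_(j+r), and P itself. *)
have helper (v1 v2 S1 S2 yl1 yr1 yl2 yr2 C a1 a2 c11 c12 c22 c21 m q1 q2 tt n h e P0 Dl Dr H11 H12 H21 H22 : R[i]) :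
    C = m * tt * n -> v1 * yl1 + v2 * yl2 + 2 * C * (a1 + e * a2) = m * q2 ->
    v1 * yr1 + v2 * yr2 + 2 * C * (e * a1 - a2) = - (m * q1) ->
    v1 * S1 + v2 * S2 - C * (c11 + e * (c12 + c21) - c22) = m * tt * h * (q1 + e * q2) ^+ 2 ->
    (v1 * S1 + v2 * S2) * P0 - (v1 * (yl1 * Dl + yr1 * Dr) + v2 * (yl2 * Dl + yr2 * Dr)) +
    C * ((H11 - a1 * Dl - a1 * Dl - c11 * P0) + e * ((H12 - a2 * Dl - a1 * Dr - c12 * P0) +
        (H21 - a1 * Dr - a2 * Dl - c21 * P0)) - (H22 - a2 * Dr - a2 * Dr - c22 * P0)) =
    m * (q1 * Dr - q2 * Dl + tt * (n * (H11 + e * (H12 + H21) - H22) + h * (q1 + e * q2) ^+ 2 * P0)).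
  move=> EC E1 E2 E3.
  transitivity ((v1 * S1 + v2 * S2 - C * (c11 + e * (c12 + c21) - c22)) * P0
    - (v1 * yl1 + v2 * yl2 + 2 * C * (a1 + e * a2)) * Dl - (v1 * yr1 + v2 * yr2 + 2 * C * (e * a1 - a2)) * Dr
    + C * (H11 + e * (H12 + H21) - H22)); first by ring.
  by rewrite E1 E2 E3 EC; ring.
have h1 : 2^-1 = (2^-1 +i* 0 : R[i]).
  by apply: complex_ext => /=; field.
apply: helper.
- by apply: complex_ext => /=; field; rewrite t2 K0.
- rewrite /y !dotC_l qr /bt1 /bt2 /=; move: (tnth (pC _) _) (tnth (pC _) _) => pl pr.
  by case: heta => ->; apply: complex_ext => /=; field; rewrite t2 K0.
- rewrite /y !dotC_r ql /bt1 /bt2 /=; move: (tnth (pC _) _) (tnth (pC _) _) => pl pr.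
  by case: heta => ->; apply: complex_ext => /=; field; rewrite t2 K0.
- rewrite /x /y !dotC_l !dotC_r b1 b2 ql qr /bt1 /bt2 h1 /=; move: (tnth (pC _) _) (tnth (pC _) _) => pl pr.
  by case: heta => ->; apply: complex_ext => /=;
    rewrite -[LHS](eq1_mul _ K2); field; rewrite t2 K0.
Qed.

End HitchinWitten.

(** * Polarised extension *)

Section Extension.
Context {R : realType} {E : normedModType R} (ip : {dot E for idfun}).
Context {r : nat} (T : 'I_r -> E) (hT : euclidean_basis ip T).
Context (k : nat) (hk : (0 < k)%N) (s : R).
Context (tau : R * R) (t0 : teich tau).
Local Notation A0 := (forms E).
Local Notation AC := (formsC E).
Local Notation tup := ((r + r).-tuple R).
Local Notation kap := (abs_level k s).
Local Notation pC := (pC ip T tau).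
Local Notation qC := (qC ip T k s tau).
Local Notation rho := (rho T k s tau).
Local Notation om := (omega_t ip k s).

Lemma cexp_imN (a : R) : cexp (0 +i* a) * cexp (0 +i* (- a)) = 1.
Proof.
rewrite /cexp /= expR0 cosN sinN; apply/eqP; rewrite eq_complex /=.
by apply/andP; split; apply/eqP; [rewrite -[RHS](cos2Dsin2 a)|]; ring.
Qed.

Lemma cexp0 : cexp (0 : R[i]) = 1.
Proof. by have := cexp_imN 0; rewrite /cexp /= expR0 cosN sinN cos0 sin0 oppr0 !mul1r. Qed.

Lemma is_deriveC0_cst (f : R -> R[i]) : (forall x : R, is_deriveC x 1 f 0) -> forall x y, f x = f y.
Proof.
move=> df x y; have [dR dI] : (forall x : R, is_derive x 1 (Rec \o f) 0) /\
    (forall x : R, is_derive x 1 (Imc \o f) 0) by split=> z; have [] := df z.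
have hR := is_derive_0_is_cst x y dR; have hI := is_derive_0_is_cst x y dI.
by apply/eqP; rewrite eq_complex; apply/andP; split; apply/eqP.
Qed.

Lemma pt_tuple0 p : pt T k s tau p (@Defs.tuple0 R (r + r)) = ptP T tau p.
Proof.
rewrite /pt /ptQ big1 ?addr0// => i _.
by rewrite tnth_mktuple scale0r.
Qed.

Lemma qC_ptP p i : tnth (qC (ptP T tau p)) i = 0.
Proof. by rewrite -pt_tuple0 (qC_pt hT hk)// tnth_mktuple. Qed.

Lemma pC_ptP p : pC (ptP T tau p) = p.
Proof. by rewrite -pt_tuple0 (pC_pt hT hk). Qed.

Lemma pC_line A p h i : tnth (pC (h *: ptP T tau p + A)) i = tnth (pC A) i + h * tnth p i.
Proof. by rewrite pC_lin tnth_lin pC_ptP. Qed.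

Lemma qC_line A p h : qC (h *: ptP T tau p + A) = qC A.
Proof.
by apply: eq_from_tnth => i; rewrite (qC_lin _ _ hk) tnth_lin qC_ptP mulr0 addr0.
Qed.

Lemma omega_line A p : om A (ptP T tau p) = - (kap * dot (qC A) p).
Proof.
rewrite (omega_tE hT hk s A _ t0) -mulrN -sumrN; congr (_ * _); apply: eq_bigr => i _.
by rewrite qC_ptP pC_ptP mulr0 sub0r.
Qed.

Lemma phase_derive (c h : R) : is_deriveC h 1 (fun h : R => cexp (0 +i* (h * c)))
  ((0 +i* c) * cexp (0 +i* (h * c))).
Proof.
have H := is_derive_mulf (is_derive_id h (1 : R)) (is_derive_cstf h (1:R) c).
apply: (is_deriveC_eq (is_deriveC_exp (is_derive_cstf h (1 : R) 0) H)).
by congr ((0 +i* _) * _); rewrite /=; ring.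
Qed.

(** Since q is constant along P_tau, the polarisation condition on a line is a linear differential
    equation with constant coefficient. Multiplying phi by the inverse of its exponential solution
    gives a function with zero derivative. *)
Lemma polarised_section_line (phi : AC -> R[i]) A p : polarised_section ip T k s tau phi ->
  cexp (0 +i* (kap / 2 * dot (qC A) p)) * phi (A + ptP T tau p) = phi A.
Proof.
move=> sphi; set c := kap / 2 * dot (qC A) p.
pose g (h : R) := cexp (0 +i* (h * c)) * phi (h *: ptP T tau p + A).
suff H (h : R) : is_deriveC h 1 g 0.
  have := is_deriveC0_cst H 1 0.
  by rewrite /g mul1r mul0r cexp0 mul1r scale1r scale0r add0r addrC.
have [dphi nphi] := sphi (h *: ptP T tau p + A) p.
have dl := is_deriveC_line_at (derivableCP dphi).
apply: (is_deriveC_eq (is_deriveC_mul (phase_derive c h) dl)).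
move: nphi; rewrite /nabla omega_line qC_line => /eqP; rewrite subr_eq0 => /eqP ->.
have -> : 0 +i* (- (kap * dot (qC A) p) / 2) = - (0 +i* c) :> R[i].
  by apply: complex_ext => /=; rewrite /c; field.
ring.
Qed.

(** The p-coordinates that make the form with q-coordinates q real, from conj(W) = alpha conj(Z).
    Thus A_0 is a graph over Q_tau. *)
Definition preal (q : tup) : tup :=
  [tuple match fintype.split i with inl j => bt1 k s q j | inr j => - bt2 k s q j end | i < r + r].

Lemma pt_preal2 q : (pt T k s tau (preal q) q).2 = 0.
Proof.
rewrite (pt_compE hT hk s)// /pt_comp /=; congr pair; apply: big1 => j _;
  rewrite !tnth_mktuple ?split_l ?split_r ?addNr ?mulr0 ?scale0r//.
by rewrite (_ : nrm tau * _ = 0) ?scale0r//; ring.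
Qed.

Definition realpt (q : tup) : A0 := (pt T k s tau (preal q) q).1.

Lemma realptE q : (realpt q, 0) = pt T k s tau (preal q) q.
Proof. by rewrite -(pt_preal2 q) /realpt; case: (pt _ _ _ _ _ _). Qed.

Lemma pC_real (A : A0) : pC (A, 0) = preal (qC (A, 0)).
Proof.
apply: eq_tuple_split => j; rewrite [in RHS]tnth_mktuple ?split_l ?split_r;
  by have [_ _ b1 b2] := real_coords ip T hk s tau A j; rewrite ?b1 ?b2 ?opprK.
Qed.

Lemma realpt_qC (A : A0) : realpt (qC (A, 0)) = A.
Proof. by rewrite /realpt -pC_real (pt_pCqC hT hk s _ t0). Qed.

(** Transports the value at the real point with the same q along P_tau, with the phase dictated by
    the polarisation condition. It is the witness that excludes the default value in [Ext]. *)
Definition ext_section (eta0 : A0 -> R[i]) (A : AC) : R[i] :=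
  cexp (0 +i* (- (kap / 2 * \sum_i tnth (qC A) i * (tnth (pC A) i - tnth (preal (qC A)) i))))
  * eta0 (realpt (qC A)).

Lemma ext_section_real eta0 (A : A0) : ext_section eta0 (A, 0) = eta0 A.
Proof.
rewrite /ext_section realpt_qC pC_real big1 ?mulr0 ?oppr0 ?cexp0 ?mul1r// => i _.
by rewrite subrr mulr0.
Qed.

Lemma ext_section_polarised eta0 : polarised_section ip T k s tau (ext_section eta0).
Proof.
move=> A p.
pose c := - (kap / 2 * dot (qC A) p).
have H : is_deriveC A (ptP T tau p) (ext_section eta0) ((0 +i* c) * ext_section eta0 A).
  apply: (is_deriveC_line _ _ _ _).1.
  set S := kap / 2 * \sum_i tnth (qC A) i * (tnth (pC A) i - tnth (preal (qC A)) i).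
  have -> : (fun h : R => ext_section eta0 (h *: ptP T tau p + A)) =
      fun h : R => eta0 (realpt (qC A)) * cexp (0 +i* (- S + h * c)).
    apply: funext => h; rewrite /ext_section qC_line mulrC; congr (_ * cexp (0 +i* _)).
    rewrite /S /c mulrN mulrCA -opprD -mulrDr; congr (- (_ * _)).
    rewrite /dot mulr_sumr -big_split /=; apply: eq_bigr => i _; rewrite pC_line; ring.
  have H0 := is_derive_addf (is_derive_cstf (0 : R) (1 : R) (- S))
    (is_derive_mulf (is_derive_id (0 : R) (1 : R)) (is_derive_cstf (0 : R) (1:R) c)).
  have H1 := is_deriveC_scale (eta0 (realpt (qC A)))
    (is_deriveC_exp (is_derive_cstf (0 : R) (1 : R) 0) H0).
  apply: (is_deriveC_eq H1); rewrite mul0r addr0 /ext_section -/S.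
  transitivity (eta0 (realpt (qC A)) * ((0 +i* c) * cexp (0 +i* (- S)))).
    by congr (_ * ((0 +i* _) * cexp (0 +i* _))); rewrite /= ?mul0r ?addr0 ?mul1r ?add0r.
  by rewrite mulrCA [X in _ * X]mulrC.
split; first exact: is_deriveC_derivable H.
rewrite /nabla (is_deriveC_val H) omega_line -mulrBl.
have -> : (0 +i* c) - (0 +i* (- (kap * dot (qC A) p) / 2)) = 0 :> R[i].
  by apply: complex_ext => /=; rewrite /c; field.
by rewrite mul0r.
Qed.

(** Any section that [Ext] may choose is determined by transport along P_tau. From the real point
    over q to Q_tau it acquires the inverse of rho at the real point, which cancels the factor rho
    in [etaE]. *)
Lemma Ext_ptQ eta0 (G : R[i]) q : eta0 (realpt q) = rho (realpt q, 0) * G ->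
  Ext ip T k s tau eta0 (ptQ T k s tau q) = G.
Proof.
move=> etaE; rewrite /Ext; case: xgetP => [phi _ [sphi phiE]|/(_ (ext_section eta0))[]]; last first.
  by split; [exact: ext_section_polarised|exact: ext_section_real].
(* The displacement along P_tau from the real point to the point of Q_tau with the same q. *)
pose p : tup := [tuple - tnth (preal q) i | i < r + r].
have qE : qC (realpt q, 0) = q by rewrite realptE (qC_pt hT hk).
have H := polarised_section_line (realpt q, 0) p sphi.
have ptE : (realpt q, 0) + ptP T tau p = ptQ T k s tau q :> AC.
  rewrite realptE /pt addrAC /ptP -big_split big1 ?add0r// => i _ /=.
  by rewrite [tnth p i]tnth_mktuple scaleNr subrr.
rewrite ptE phiE etaE qE in H.
rewrite (rhoE hT hk s t0) realptE (pC_pt hT hk)// (qC_pt hT hk)// in H.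
have dE : dot q p = - dot (preal q) q.
  by rewrite /dot -sumrN; apply: eq_bigr => i _; rewrite [tnth p i]tnth_mktuple mulrN mulrC.
rewrite dE mulrN in H.
have C := cexp_imN (kap / 2 * dot (preal q) q).
move: H C; move: (cexp _) (cexp (0 +i* (kap / 2 * dot (preal q) q))) => a b H C.
rewrite -[LHS]mul1r -[RHS]mul1r -C -!mulrA; congr (_ * _); exact: H.
Qed.

End Extension.

(** * Intertwining *)

Section LadderParts.
Context {R : realType} {E : normedModType R} (ip : {dot E for idfun}).
Context {r : nat} (T : 'I_r -> E) (hT : euclidean_basis ip T).
Context (k : nat) (hk : (0 < k)%N) (s : R).
Context (eta : R) (heta : eta = 1 \/ eta = -1) (tau : R * R) (t0 : teich tau).
Local Notation AC := (formsC E).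
Local Notation tup := ((r + r).-tuple R).
Local Notation kap := (abs_level k s).
Local Notation pC := (pC ip T tau).
Local Notation qC := (qC ip T k s tau).
Local Notation tr := (tr ip T k s tau).
Local Notation ei := (0 +i* eta : R[i]).
Local Notation teta := (k%:R +i* (eta * s) : R[i]).
Local Notation "j '.l'" := (lshift r j) (at level 2, format "j .l").
Local Notation "j '.r'" := (rshift r j) (at level 2, format "j .r").
Context (f : tup -> R[i]) (d : 'I_(r + r) -> tup -> R[i])
  (dd : 'I_(r + r) -> 'I_(r + r) -> tup -> R[i]).
Context
  (df : forall i q (a : R), is_deriveC a 1 (fun b => f (upd q i b)) (d i (upd q i a)))
  (ddf : forall i l q (a : R), is_deriveC a 1 (fun b => d i (upd q l b)) (dd i l (upd q l a)))
  (cdd : forall i l q, continuousC (fun b : R => dd i l (upd q l b)))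
  (Lf : L2 f) (Lqf : forall i, L2 (mulq f i)) (Lqqf : forall i l, L2 (mulq (mulq f i) l))
  (Ld : forall i, L2 (d i)) (Lqd : forall i l, L2 (mulq (d i) l))
  (Ldd : forall i l, L2 (dd i l)).

Lemma tr_add g h A : L2 g -> L2 h -> tr (fun q => g q + h q) A = tr g A + tr h A.
Proof. by move=> Lg Lh; exact: (Phi_add _ (kap_gt0 hk s)). Qed.

Lemma tr_scale c g A : L2 g -> tr (fun q => c * g q) A = c * tr g A.
Proof. by move=> Lg; exact: (Phi_scale _ (kap_gt0 hk s)). Qed.

Lemma tr_sum (I : Type) (l : seq I) (F : I -> tup -> R[i]) A : (forall i, L2 (F i)) ->
  tr (fun q => \sum_(i <- l) F i q) A = \sum_(i <- l) tr (F i) A.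
Proof. by move=> LF; exact: (Phi_sum _ (kap_gt0 hk s)). Qed.

Local Notation b A i := (tnth (qC A) i +i* (- tnth (pC A) i) : R[i]).

Lemma tr_by_parts (i : 'I_(r + r)) g h A :
  (forall q (a : R), is_deriveC a 1 (fun b => g (upd q i b)) (h (upd q i a))) ->
  (forall q, continuousC (fun b : R => h (upd q i b))) ->
  L2 g -> L2 h -> L2 (mulq g i) ->
  tr h A = kap%:C * (tr (mulq g i) A - b A i * tr g A).
Proof.
move=> dg ch Lg Lh Lqg.
rewrite /tr (Phi_by_parts _ (kap_gt0 hk s) (pC A) (qC A) dg ch Lg Lh Lqg) mulrBr mulrA; congr (_ - _ * _).
by apply: complex_ext => /=; ring.
Qed.

Lemma coord_derive (i l : 'I_(r + r)) (q : tup) (a : R) :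
  is_deriveC a 1 (fun x : R => (tnth (upd q i x) l)%:C) (l == i)%:R%:C.
Proof.
apply: is_deriveC_real.
rewrite (_ : (fun x => _) = if l == i then id else fun=> tnth q l); last first.
  by apply: funext => x; rewrite tnth_upd; case: eqP.
by case: eqP => _; [exact: is_derive_id|exact: is_derive_cstf].
Qed.

Lemma tr_d i A : tr (d i) A = kap%:C * (tr (mulq f i) A - b A i * tr f A).
Proof.
apply: tr_by_parts => //.
by move=> q; exact: is_deriveC_continuous (ddf i i q).
Qed.

(** Integrate by parts the function q_l f, whose i-th derivative is delta_il f + q_l d_i. *)
Lemma tr_qd i l A : tr (mulq (d i) l) A =
  kap%:C * (tr (mulq (mulq f l) i) A - b A i * tr (mulq f l) A) - (l == i)%:R%:C * tr f A.
Proof.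
rewrite -(@tr_by_parts i (mulq f l) (fun q => (l == i)%:R%:C * f q + mulq (d i) l q) A) //.
- by rewrite tr_add ?tr_scale//; [ring|exact: L2_scale].
- by move=> q a; exact: (is_deriveC_mul (coord_derive i l q a) (df i q a)).
- move=> q; apply: continuousC_add; apply: continuousC_mul.
  + exact: is_deriveC_continuous (fun a : R => is_deriveC_cst a 1 _).
  + exact: is_deriveC_continuous (df i q).
  + exact: is_deriveC_continuous (coord_derive i l q).
  + exact: is_deriveC_continuous (ddf i i q).
- by apply: L2_add => //; exact: L2_scale.
Qed.

Lemma tr_dd i l A : tr (dd i l) A = kap%:C * (tr (mulq (d i) l) A - b A l * tr (d i) A).
Proof. by apply: tr_by_parts. Qed.

Definition hw_fun (j : 'I_r) (q : tup) : R[i] :=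
  let q1 := (tnth q j.l)%:C in let q2 := (tnth q j.r)%:C in
  ((4 * tau.2)^-1)%:C * (q1 * d j.r q - q2 * d j.l q
   + 'i * teta * (((2 * kap ^+ 2)^-1)%:C *
      (dd j.l j.l q + ei * (dd j.l j.r q + dd j.r j.l q) - dd j.r j.r q)
      + 2^-1 * (q1 + ei * q2) ^+ 2 * f q)).

(** Writes [hw_fun] as a linear combination of functions known to be square integrable, over which
    [tr] distributes. *)
Lemma hw_fun_expand j : hw_fun j = fun q => ((4 * tau.2)^-1)%:C *
  ((mulq (d j.r) j.l q + (-1) * mulq (d j.l) j.r q) +
   ('i * teta) * ((((2 * kap ^+ 2)^-1)%:C * ((dd j.l j.l q + ei * (dd j.l j.r q + dd j.r j.l q)) + (-1) * dd j.r j.r q)) +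
    2^-1 * ((mulq (mulq f j.l) j.l q + ei * (mulq (mulq f j.l) j.r q + mulq (mulq f j.r) j.l q)) +
     (-1) * mulq (mulq f j.r) j.r q))).
Proof.
apply: funext => q; rewrite /hw_fun /mulq.
have e2 : ei * ei = -1.
  by case: heta => ->; apply: complex_ext => /=; ring.
congr (_ * (_ + _ * (_ + _))); first by ring.
  by ring.
move: (_%:C) ((tnth q j.r)%:C) (f q) ei e2 => q1 q2 f0 e e2.
transitivity (2^-1 * (q1 * q1 + e * (q1 * q2 + q1 * q2) + (e * e) * (q2 * q2)) * f0); first by ring.
by rewrite e2; ring.
Qed.

Ltac L2tac := repeat first [exact: Lf | exact: Lqf | exact: Lqqf | exact: Ld | exact: Lqd | exact: Ldd
  | apply: L2_add | apply: L2_scale].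

Lemma L2_hw_fun j : L2 (hw_fun j).
Proof. by rewrite hw_fun_expand; L2tac. Qed.

Lemma tr_comb (m tt n h e : R[i]) (X1 X2 a1 a2 a3 a4 b1 b2 b3 b4 : tup -> R[i]) A :
  L2 X1 -> L2 X2 -> L2 a1 -> L2 a2 -> L2 a3 -> L2 a4 -> L2 b1 -> L2 b2 -> L2 b3 -> L2 b4 ->
  tr (fun q => m * ((X1 q + (-1) * X2 q) +
     tt * (n * ((a1 q + e * (a2 q + a3 q)) + (-1) * a4 q) + h * ((b1 q + e * (b2 q + b3 q)) + (-1) * b4 q)))) A =
  m * ((tr X1 A + (-1) * tr X2 A) + tt * (n * ((tr a1 A + e * (tr a2 A + tr a3 A)) + (-1) * tr a4 A) +
      h * ((tr b1 A + e * (tr b2 A + tr b3 A)) + (-1) * tr b4 A))).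
Proof.
move=> LX1 LX2 La1 La2 La3 La4 Lb1 Lb2 Lb3 Lb4.
have quad (c1 c2 c3 c4 : tup -> R[i]) : L2 c1 -> L2 c2 -> L2 c3 -> L2 c4 ->
    L2 (fun q => (c1 q + e * (c2 q + c3 q)) + (-1) * c4 q) /\
    tr (fun q => (c1 q + e * (c2 q + c3 q)) + (-1) * c4 q) A =
    (tr c1 A + e * (tr c2 A + tr c3 A)) + (-1) * tr c4 A.
  move=> L1 L2' L3 L4.
  have L23 := L2_add L2' L3; have Le23 := L2_scale e L23; have L123 := L2_add L1 Le23.
  have L4' := L2_scale (-1) L4; split; first exact: L2_add L123 L4'.
  by rewrite (tr_add _ L123 L4') (tr_add _ L1 Le23) (tr_scale _ _ L23) (tr_add _ L2' L3) (tr_scale _ _ L4).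
have [La aE] := quad _ _ _ _ La1 La2 La3 La4.
have [Lb bE] := quad _ _ _ _ Lb1 Lb2 Lb3 Lb4.
have Lna := L2_scale n La; have Lhb := L2_scale h Lb; have Lab := L2_add Lna Lhb.
have Lt := L2_scale tt Lab; have LX2' := L2_scale (-1) LX2; have LX := L2_add LX1 LX2'.
rewrite (tr_scale _ _ (L2_add LX Lt)) (tr_add _ LX Lt) (tr_add _ LX1 LX2') (tr_scale _ _ LX2).
by rewrite (tr_scale _ _ Lab) (tr_add _ Lna Lhb) (tr_scale _ _ La) (tr_scale _ _ Lb) aE bE.
Qed.

(** Each derivative becomes multiplication minus [b], up to the factor |t|. The Kronecker terms of
    [tr_qd] occur only in the two pure second derivatives, which have opposite signs, so they
    cancel. The halves from differentiation and from multiplication add up to the full second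
    moments. *)
Lemma tr_hw_fun j A : tr (hw_fun j) A = ladder_term ip T k s eta tau f A j.
Proof.
have K0 := kap_neq0 hk s.
rewrite hw_fun_expand.
rewrite tr_comb//.
rewrite !tr_dd !tr_qd !tr_d !eqxx !eq_lrshift !eq_rlshift.
have sym : tr (mulq (mulq f j.r) j.l) A = tr (mulq (mulq f j.l) j.r) A.
  by congr (tr _ A); apply: funext => q; rewrite /mulq; ring.
rewrite /ladder_term !sym.
move: (tr (mulq (mulq f j.l) j.l) A) (tr (mulq (mulq f j.l) j.r) A) (tr (mulq (mulq f j.r) j.r) A)
  (tr (mulq f j.l) A) (tr (mulq f j.r) A) (tr f A) => f11 f12 f22 f1 f2 f0.
have e2 : ei * ei = -1.
  by case: heta => ->; apply: complex_ext => /=; ring.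
have nK : ((2 * kap ^+ 2)^-1)%:C * (kap%:C * kap%:C) = 2^-1 :> R[i].
  by apply: complex_ext => /=; field; rewrite K0.
move: (tnth (qC A) j.l +i* _) (tnth (qC A) j.r +i* _) => b1 b2.
move: (((2 * kap ^+ 2)^-1)%:C) (kap%:C) (((4 * tau.2)^-1)%:C) ('i * _) ei nK e2 => n K m tt e nK e2.
rewrite !mulr1n !mulr0n.
transitivity (m * (K * (b1 * f2 - b2 * f1) + tt * ((n * (K * K)) *
   (f11 - 2 * b1 * f1 + b1 * b1 * f0 + e * (2 * f12 - 2 * b2 * f1 - 2 * b1 * f2 + 2 * b1 * b2 * f0)
     - (f22 - 2 * b2 * f2 + b2 * b2 * f0)) + 2^-1 * (f11 + e * (f12 + f12) - f22)))).
  by rewrite -[(1%:C)]/(1 : R[i]) -[(0%:C)]/(0 : R[i]); ring.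
rewrite nK; congr (_ * (_ + _ * _)).
transitivity (f11 + e * (f12 + f12) - f22 - (b1 * f1 + e * (b2 * f1 + b1 * f2) + (e * e) * (b2 * f2))
  + 2^-1 * (b1 * b1 + e * (2 * b1 * b2) + (e * e) * (b2 * b2)) * f0); last by ring.
by rewrite e2; field.
Qed.

End LadderParts.

(** * Assembly of the intertwining identity *)

Section Intertwining.
Context {R : realType} {E : normedModType R} (ip : {dot E for idfun}).
Context {r : nat} (T : 'I_r -> E) (hT : euclidean_basis ip T).
Context (k : nat) (hk : (0 < k)%N) (s : R).
Context (eta : R) (heta : eta = 1 \/ eta = -1).
Local Notation A0 := (forms E).
Local Notation AC := (formsC E).
Local Notation tup := ((r + r).-tuple R).
Local Notation kap := (abs_level k s).
Local Notation V := (d_eta eta).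
Context (U : set (R * R)) (psi : R * R -> AC -> R[i]).
Context (oU : open U) (Ut : U `<=` teich).
Context (spsi : smooth_on (U `*` setT) (fun x : (R * R) * AC => psi x.1 x.2)).
Context (ppsi : forall tau, U tau -> polarised T tau (psi tau)).
Context (tau : R * R) (Utau : U tau).
Context (La : forall w : seq ('I_(r + r) + 'I_(r + r)), (size w <= 2)%N ->
  L2Q T k s tau (foldr (ladder T k s tau) (psi tau) w)).
Context (Lb : L2Q T k s tau (delta T k s V psi tau)).
Context (dB : forall A : AC, differentiableC
  (fun x : (R * R) * AC => bargmann T k s x.1 (psi x.1) x.2) (tau, A)).
Context (deltaB : bargmann T k s tau (delta T k s V psi tau) =
  delta T k s V (fun sigma => bargmann T k s sigma (psi sigma)) tau).

Let t0 : teich tau := Ut Utau.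
Local Notation Q := (ptQ T k s tau).
Local Notation Y := (frameY T k s tau).
Local Notation P := (psi tau).

Lemma ptQ_pt q : Q q = pt T k s tau (@Defs.tuple0 R (r + r)) q.
Proof.
rewrite /pt /ptP big1 ?add0r// => i _.
by rewrite tnth_mktuple scale0r.
Qed.

Lemma ptQ_upd q i (b : R) : Q (upd q i b) = b *: Y i + Q (upd q i 0).
Proof.
rewrite /ptQ (bigD1 i)//= [in RHS](bigD1 i)//= !tnth_upd eqxx scale0r add0r; congr (_ + _).
by apply: eq_bigr => j ji; rewrite !tnth_upd (negbTE ji).
Qed.

Lemma smooth_upd (F : AC -> R[i]) i q (a : R) : (forall A, differentiableC F A) ->
  is_deriveC a 1 (fun b => F (Q (upd q i b))) (deriveC (Y i) F (Q (upd q i a))).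
Proof.
move=> dF.
rewrite (_ : (fun b => _) = fun b : R => F (b *: Y i + Q (upd q i 0))); last first.
  by apply: funext => b; rewrite ptQ_upd.
rewrite [Q (upd q i a)]ptQ_upd; have H := differentiableC_is_deriveC (Y i) (dF (a *: Y i + Q (upd q i 0))).
exact: (is_deriveC_line_at H).
Qed.

Lemma polarised_pt F p q : polarised T tau F -> F (pt T k s tau p q) = F (Q q).
Proof. by move=> pF; rewrite /pt addrC pF. Qed.

(** The functions psi(sigma, .) are polarised for all sigma near tau, since U is open; so the family
    being differentiated does not involve p. *)
Lemma delta_pt p q : delta T k s V psi tau (pt T k s tau p q) = delta T k s V psi tau (Q q).
Proof.
have c1 p' : coords T k s tau (pt T k s tau p' q) = (pC ip T tau (pt T k s tau p' q), q).
  by rewrite (coordsE hT hk s _ t0) (qC_pt hT hk s p' q t0).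
rewrite ptQ_pt /delta !c1 /=; move: (pC _ _ _ _) (pC _ _ _ _) => p1 p2.
apply: near_eq_Dtau; apply: filterS (open_nbhs_nbhs (conj oU Utau)) => sg Usg.
by rewrite [ptP T sg p1 + _]addrC [ptP T sg p2 + _]addrC !ppsi.
Qed.

Lemma intertwining : let lhs := Ext ip T k s tau
    (hitchin_witten ip T k s V (fun sigma A => psi sigma (A, 0) * rho T k s sigma (A, 0)) tau) in
  L2Q T k s tau lhs /\
  bargmann T k s tau lhs
  = hitchin_complexified ip T k s V (fun sigma => bargmann T k s sigma (psi sigma)) tau.
Proof.
move=> lhs.
have sP : smooth_on setT P by exact: smooth_on_pairr spsi Utau.
have pP := ppsi Utau.
have dpsi A : differentiableC (fun x : (R * R) * AC => psi x.1 x.2) (tau, A).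
  by apply: smooth_on_differentiable spsi _.
have dP A : differentiableC P A := smooth_on_differentiable sP I.
have sD i : smooth_on setT (deriveC (Y i) P) := smooth_on_deriveC (Y i) sP.
have dDP i A : differentiableC (deriveC (Y i) P) A := smooth_on_differentiable (sD i) I.
have dDDP i l A : differentiableC (deriveC (Y l) (deriveC (Y i) P)) A :=
  smooth_on_differentiable (smooth_on_deriveC (Y l) (sD i)) I.
pose f q := P (Q q).
pose d i q := deriveC (Y i) P (Q q).
pose dd i l q := deriveC (Y l) (deriveC (Y i) P) (Q q).
have qCQ q : (coords T k s tau (Q q)).2 = q.
  by rewrite (coordsE hT hk s _ t0) ptQ_pt (qC_pt hT hk).
have Lf : L2 f by exact: (La (w := [::])).
have Lqf i : L2 (mulq f i).
  have := La (w := [:: inl i]) isT; rewrite /L2Q /=.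
  by under eq_fun do rewrite qCQ.
have Lqqf i l : L2 (mulq (mulq f i) l).
  have := La (w := [:: inl l; inl i]) isT; rewrite /L2Q /=.
  by under eq_fun do rewrite qCQ.
have Ld i : L2 (d i) by exact: (La (w := [:: inr i]) isT).
have Lqd i l : L2 (mulq (d i) l).
  have := La (w := [:: inl l; inr i]) isT; rewrite /L2Q /=.
  by under eq_fun do rewrite qCQ.
have Ldd i l : L2 (dd i l) by exact: (La (w := [:: inr l; inr i]) isT).
have df i q (a : R) : is_deriveC a 1 (fun b => f (upd q i b)) (d i (upd q i a)).
  exact: smooth_upd.
have ddf i l q (a : R) : is_deriveC a 1 (fun b => d i (upd q l b)) (dd i l (upd q l a)).
  exact: (smooth_upd _ _ _ (dDP i)).
have cdd i l q : continuousC (fun b : R => dd i l (upd q l b)).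
  exact: is_deriveC_continuous (fun a => smooth_upd l q a (dDDP i l)).
have lhsE : (fun q => lhs (Q q)) = fun q => delta T k s V psi tau (Q q) +
    \sum_j hw_fun k s eta tau f d dd j q.
  (* It remains to evaluate the covariant derivative at the real point over q. There it is rho times
     an expression that polarisation lets one evaluate on Q_tau. *)
  apply: funext => q; apply: (Ext_ptQ hT hk t0).
  have hwE p j : hw_term ip T k s eta tau P (pt T k s tau p q) j = hw_fun k s eta tau f d dd j q.
    have pE F : polarised T tau F -> F (pt T k s tau p q) = F (Q q) by exact: polarised_pt.
    have pD i := polarised_deriveC (Y i) pP.
    have pDD i l := polarised_deriveC (Y l) (pD i).
    by rewrite /hw_term (qC_pt hT hk s p q t0) !(pE _ (pDD _ _)) !(pE _ (pD _)) (pE _ pP).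
  rewrite (hitchin_wittenE hT hk heta t0 (realpt T k s tau q) pP dpsi dDP) (realptE hT hk s t0).
  have sE p : \sum_j hw_term ip T k s eta tau P (pt T k s tau p q) j =
      \sum_j hw_fun k s eta tau f d dd j q.
    by apply: eq_bigr => j _; exact: hwE.
  exact: (congr2 (fun a b => rho T k s tau (pt T k s tau (preal k s q) q) * (a + b)) (delta_pt _ q) (sE _)).
have Lhw j : L2 (hw_fun k s eta tau f d dd j) by exact: L2_hw_fun.
have Lsum := L2_sum (index_enum 'I_r) Lhw.
split; first by rewrite /L2Q lhsE; exact: L2_add Lb Lsum.
apply: funext => A.
rewrite (hitchin_complexifiedE hT hk heta t0 (dB A) Lf Lqf Lqqf) -deltaB.
rewrite !(bargmann_tr hT hk s t0) lhsE (tr_add ip T hk s tau A Lb Lsum); congr (_ + _).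
rewrite (tr_sum ip T hk s tau _ A Lhw); apply: eq_bigr => j _.
exact: tr_hw_fun.
Qed.

End Intertwining.

(** * Mapping class group equivariance *)

Section MappingClassGroup.
Context {R : realType} {E : normedModType R} (ip : {dot E for idfun}).
Context {r : nat} (T : 'I_r -> E) (hT : euclidean_basis ip T).
Context (k : nat) (hk : (0 < k)%N) (s : R).
Local Notation AC := (formsC E).
Local Notation tup := ((r + r).-tuple R).
Local Notation kap := (abs_level k s).

(** The kernel depends on p, q, q' only through inner products, which a simultaneous rotation
    preserves. *)
Lemma kernel_rotation (C0 k0 c z : R) (p q q' : tup) : c ^+ 2 + z ^+ 2 = 1 ->
  kernel C0 k0 (rotation c z p) (rotation c z q) (rotation c z q') = kernel C0 k0 p q q'.
Proof.
move=> cz.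
have E1 : \sum_j (tnth (rotation c z q) j - tnth (rotation c z q') j) ^+ 2 =
    \sum_j (tnth q j - tnth q' j) ^+ 2.
  rewrite !big_split_ord /= -!big_split; apply: eq_bigr => j _ /=.
  rewrite !tnth_rotation_l !tnth_rotation_r.
  transitivity ((c ^+ 2 + z ^+ 2) * ((tnth q (lshift r j) - tnth q' (lshift r j)) ^+ 2
    + (tnth q (rshift r j) - tnth q' (rshift r j)) ^+ 2)); first by ring.
  by rewrite cz mul1r.
have E2 : \sum_j tnth (rotation c z p) j * (2 * tnth (rotation c z q') j - tnth (rotation c z q) j) =
    \sum_j tnth p j * (2 * tnth q' j - tnth q j).
  rewrite !big_split_ord /= -!big_split; apply: eq_bigr => j _ /=.
  rewrite !tnth_rotation_l !tnth_rotation_r.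
  transitivity ((c ^+ 2 + z ^+ 2) * (tnth p (lshift r j) * (2 * tnth q' (lshift r j) - tnth q (lshift r j))
    + tnth p (rshift r j) * (2 * tnth q' (rshift r j) - tnth q (rshift r j)))); first by ring.
  by rewrite cz mul1r.
by rewrite /kernel E1 E2.
Qed.

Lemma det2_int (f : 'M[int]_2) : \det f = 1 ->
  f 0 0 * f 1 1 - f 0 1 * f 1 0 = 1 /\
  forall i j, invmx f i j = if i == 0 then if j == 0 then f 1 1 else - f 0 1
                            else if j == 0 then - f 1 0 else f 0 0.
Proof.
move=> df.
have dE : f 0 0 * f 1 1 - f 0 1 * f 1 0 = 1.
  rewrite -df (expand_det_row _ 0) big_ord_recl big_ord1 /cofactor !det_mx11 !mxE /=.
  have fE (i j i' j' : 'I_2) : i = i' :> nat -> j = j' :> nat -> f i j = f i' j'.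
    by move=> /val_inj -> /val_inj ->.
  set x := f (lift _ _) (lift ord0 _); have -> : x = f 1 1 by exact: fE.
  set y := f (lift _ _) (lift (lift _ _) _); have -> : y = f 1 0 by exact: fE.
  set w := f _ (lift _ _); have -> : w = f 0 1 by exact: fE.
  set z := f _ ord0; have -> : z = f 0 0 by exact: fE.
  by rewrite /bump /= addn0 expr0 mul1r add0n expr1 mulN1r mulrN.
split=> //.
pose B : 'M[int]_2 := \matrix_(i, j) if i == 0 then if j == 0 then f 1 1 else - f 0 1
                            else if j == 0 then - f 1 0 else f 0 0.
have two (i : 'I_2) : i = 0 \/ i = 1.
  by case: i => [[|[|//]] ?]; [left|right]; exact: val_inj.
have fB : f *m B = 1%:M.
  apply/matrixP => i j; rewrite !mxE big_ord_recl big_ord1.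
  have -> : lift ord0 (ord0 : 'I_1) = 1 :> 'I_2 by exact: val_inj.
  rewrite !mxE /=.
  case: (two i) => ->; case: (two j) => -> /=; rewrite -?dE; ring.
have [uf _] := mulmx1_unit fB.
have -> : invmx f = B by rewrite -[invmx f]mulmx1 -fB mulKmx.
by move=> i j; rewrite mxE.
Qed.

(** * The action of one element of SL(2, Z) *)

Section Moebius.
Context (f : 'M[int]_2) (df : \det f = 1) (tau : R * R) (t0 : teich tau).
Local Notation a := ((f 0 0)%:~R : R).
Local Notation b := ((f 0 1)%:~R : R).
Local Notation c := ((f 1 0)%:~R : R).
Local Notation d := ((f 1 1)%:~R : R).

Let detR : a * d - b * c = 1.
Proof.
have [dE _] := det2_int df.
by rewrite -!intrM -intrB dE.
Qed.

Definition modulus : R := (d - c * tau.1) ^+ 2 + (c * tau.2) ^+ 2.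

Lemma modulus_gt0 : 0 < modulus.
Proof.
have t2 : tau.2 != 0 by rewrite gt_eqF.
rewrite lt_def addr_ge0 ?sqr_ge0// andbT paddr_eq0 ?sqr_ge0// !sqrf_eq0 mulf_eq0 (negbTE t2) orbF.
apply/negP => /andP[/eqP h /eqP c0]; move: detR h; rewrite c0 mul0r subr0 mulr0 subr0 => h d0.
by move: h; rewrite d0 mulr0 => /eqP; rewrite eq_sym oner_eq0.
Qed.

(** Real and imaginary part of (a tau - b) / (d - c tau), with [modulus] = |d - c tau|^2. *)
Definition moebius : R * R :=
  (((a * d + b * c) * tau.1 - a * c * (tau.1 ^+ 2 + tau.2 ^+ 2) - b * d) / modulus,
   tau.2 / modulus).

Lemma teich_moebius : teich moebius.
Proof. by rewrite /teich /= divr_gt0// modulus_gt0. Qed.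

Lemma hodge_moebius (A : R * R) : hodge (U := R^o) moebius A =
  pullback (invmx f) (hodge (U := R^o) tau (pullback f A)).
Proof.
have t2 : tau.2 != 0 by rewrite gt_eqF.
have m0 : modulus != 0 by rewrite gt_eqF// modulus_gt0.
have [_ iE] := det2_int df.
have i00 : invmx f 0 0 = f 1 1 := iE 0 0.
have i01 : invmx f 0 1 = - f 0 1 := iE 0 1.
have i10 : invmx f 1 0 = - f 1 0 := iE 1 0.
have i11 : invmx f 1 1 = f 0 0 := iE 1 1.
have pE (g : 'M[int]_2) (X : R * R) : pullback (U := R^o) g X =
    (X.1 * (g 0 0)%:~R + X.2 * (g 1 0)%:~R, X.1 * (g 0 1)%:~R + X.2 * (g 1 1)%:~R).
  by rewrite !mulrzr.
have hE sg (X : R * R) : hodge (U := R^o) sg X =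
  (sg.2^-1 * (sg.1 * X.1 - X.2), sg.2^-1 * ((sg.1 ^+ 2 + sg.2 ^+ 2) * X.1 - sg.1 * X.2)) by [].
rewrite !pE i00 i01 i10 i11 !hE !rmorphN /moebius /=.
move: m0 detR t2; rewrite /modulus.
move: a b c d (tau.1) (tau.2) => {}a {}b {}c {}d x y m0 dR y0.
congr pair.
  by field; rewrite y0 m0.
have key : ((a * d + b * c) * x - a * c * (x ^+ 2 + y ^+ 2) - b * d) ^+ 2 + y ^+ 2 =
    ((a * x - b) ^+ 2 + (a * y) ^+ 2) * ((d - c * x) ^+ 2 + (c * y) ^+ 2).
  transitivity (((a * d + b * c) * x - a * c * (x ^+ 2 + y ^+ 2) - b * d) ^+ 2 + (y * (a * d - b * c)) ^+ 2).
    by rewrite dR mulr1.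
  by ring.
rewrite expr_div_n expr_div_n -mulrDl key.
by field; rewrite y0 m0.
Qed.

(** The star of dy is -(dx + sigma_1 dy) / sigma_2, so the Hodge star determines the point sigma;
    [hodge_moebius] supplies existence. *)
Lemma mcg_actE : mcg_act f tau = moebius.
Proof.
rewrite /mcg_act; case: xgetP => [sg _ [sg0 sgE]|/(_ moebius)[]]; last first.
  by split; [exact: teich_moebius|exact: hodge_moebius].
have hE (u : R * R) : hodge (U := R^o) u (0, 1) = (- u.2^-1, - (u.1 / u.2)).
  rewrite /hodge /= /GRing.scale /= !mulr0 !mulr1 !sub0r; congr pair; ring.
have : hodge (U := R^o) sg (0, 1) = hodge (U := R^o) moebius (0, 1).
  by rewrite hodge_moebius sgE.
rewrite !hE => -[/oppr_inj/invr_inj e2 /oppr_inj e1].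
have n0 : moebius.2 != 0 by rewrite gt_eqF// teich_moebius.
move: e1; rewrite e2 => /(mulIf (invr_neq0 n0)) e1.
by apply/eqP; rewrite -pair_eqE /pair_eq /= e1 e2 !eqxx.
Qed.

(** [rotc] + i [rots] = (d - c conj(tau)) / |d - c tau|, the phase by which f^* acts on
    coordinates. *)
Definition rotc : R := (d - c * tau.1) / Num.sqrt modulus.
Definition rots : R := c * tau.2 / Num.sqrt modulus.

Lemma rot_sqr : rotc ^+ 2 + rots ^+ 2 = 1.
Proof.
rewrite !expr_div_n -mulrDl sqr_sqrtr ?ltW ?modulus_gt0//.
by rewrite divff// gt_eqF// modulus_gt0.
Qed.

(** With sigma = [moebius] one has f^* dzeta_sigma = dzeta_tau / (d - c tau). The change of
    normalisation of the frame contributes |d - c tau|, leaving a pure phase; the identities are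
    real and imaginary parts of this. *)
Lemma moebius_rot : [/\ nrm moebius = nrm tau * Num.sqrt modulus,
  Num.sqrt modulus * (a + c * moebius.1) = rotc,
  Num.sqrt modulus * (c * moebius.2) = rots,
  Num.sqrt modulus * (b + d * moebius.1) = rotc * tau.1 - rots * tau.2 &
  Num.sqrt modulus * (d * moebius.2) = rots * tau.1 + rotc * tau.2].
Proof.
have n0 : Num.sqrt modulus != 0 by rewrite gt_eqF// sqrtr_gt0 modulus_gt0.
have nn : Num.sqrt modulus ^+ 2 = modulus by rewrite sqr_sqrtr// ltW// modulus_gt0.
have -> : nrm moebius = nrm tau * Num.sqrt modulus.
  rewrite /nrm /moebius /= mulrA sqrtrM ?mulr_ge0 ?ltW// sqrtrV ?ltW ?modulus_gt0//.
  by rewrite invfM invrK.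
rewrite /rotc /rots /moebius /=; move: n0 nn detR; rewrite /modulus.
move: (Num.sqrt _) => n.
move: a b c d (tau.1) (tau.2) => {}a {}b {}c {}d x y n0 nn dR.
set n1 := _ - b * d; rewrite -nn; split=> //; last by field.
- transitivity ((a * n ^+ 2 + c * n1) / n); first by field.
  congr (_ / n); rewrite nn /n1 -[RHS](eq1_mul _ dR); ring.
- by field.
- transitivity ((b * n ^+ 2 + d * n1) / n); first by field.
  transitivity (((d - c * x) * x - c * y * y) / n); last by field.
  congr (_ / n); rewrite nn /n1 -[RHS](eq1_mul _ dR); ring.
Qed.

(** W is multiplied by the phase of [moebius_rot]. The coefficient alpha conj(Z) of dzetabar is
    multiplied by the conjugate phase, so Z turns by the same angle as W. *)
Lemma pullbackC_pt p q : pullbackC f (pt T k s moebius p q) =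
  pt T k s tau (rotation rotc rots p) (rotation rotc rots q).
Proof.
have [nE r1 r2 r3 r4] := moebius_rot.
have K0 := kap_neq0 hk s.
rewrite !(pt_compE hT hk s)//; last exact: teich_moebius.
have b1 j : bt1 k s (rotation rotc rots q) j = rotc * bt1 k s q j + rots * bt2 k s q j.
  by rewrite /bt1 /bt2 tnth_rotation_l tnth_rotation_r; field.
have b2 j : bt2 k s (rotation rotc rots q) j = rotc * bt2 k s q j - rots * bt1 k s q j.
  by rewrite /bt1 /bt2 tnth_rotation_l tnth_rotation_r; field.
have ipM x n (y : E) : ip (x *~ n) y = n%:~R * ip x y by rewrite -scaler_int ipZl.
move: moebius nE r1 r2 r3 r4 => sg nE r1 r2 r3 r4.
apply: (eq_AC hT) => j; rewrite /pullbackC /pullback /pt_comp /=.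
rewrite !ipDl !ipM !(ip_comb hT) b1 b2 tnth_rotation_l tnth_rotation_r nE.
move: (bt1 k s q j) (bt2 k s q j) (tnth p (lshift r j)) (tnth p (rshift r j)) (nrm tau)
  => x1 x2 p1 p2 N.
move: r1 r2 r3 r4; move: (Num.sqrt _) (sg.1) (sg.2) rotc rots a b c d (tau.1) (tau.2)
  => n m1 m2 C S {}a {}b {}c {}d t1 t2 r1 r2 r3 r4.
split.
- transitivity (N * ((p1 + x1) * (n * (a + c * m1)) + (x2 - p2) * (n * (c * m2)))); first by ring.
  by rewrite r1 r2; ring.
- transitivity (N * ((p1 + x1) * (n * (b + d * m1)) + (x2 - p2) * (n * (d * m2)))); first by ring.
  by rewrite r3 r4; ring.
- transitivity (N * ((p2 + x2) * (n * (a + c * m1)) + (p1 - x1) * (n * (c * m2)))); first by ring.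
  by rewrite r1 r2; ring.
- transitivity (N * ((p2 + x2) * (n * (b + d * m1)) + (p1 - x1) * (n * (d * m2)))); first by ring.
  by rewrite r3 r4; ring.
Qed.

Lemma act_fun_ptQ (psi : AC -> R[i]) q : act_fun f psi (ptQ T k s moebius q) =
  psi (ptQ T k s tau (rotation rotc rots q)).
Proof.
have z0 u q' : ptQ T k s u q' = pt T k s u (@Defs.tuple0 R (r + r)) q'.
  by rewrite /pt /ptP big1 ?add0r// => i _; rewrite tnth_mktuple scale0r.
rewrite /act_fun !z0 pullbackC_pt; congr (psi (pt _ _ _ _ _ _)).
by apply: eq_tuple_split => j; rewrite ?tnth_rotation_l ?tnth_rotation_r !tnth_mktuple; ring.
Qed.

(** Substitute the rotated variable in the integral: the kernel is invariant when p, q and q' are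
    all rotated, and the rotation preserves Lebesgue measure. *)
Lemma bargmann_equivariant (psi : AC -> R[i]) : L2Q T k s tau psi ->
  L2Q T k s (mcg_act f tau) (act_fun f psi) /\
  bargmann T k s (mcg_act f tau) (act_fun f psi) = act_fun f (bargmann T k s tau psi).
Proof.
move=> Lpsi; rewrite mcg_actE; have pR := preserving_rotation (r := r) rot_sqr.
have LE : (fun q => act_fun f psi (ptQ T k s moebius q)) =
    fun q => psi (ptQ T k s tau (rotation rotc rots q)).
  by apply: funext => q; exact: act_fun_ptQ.
split; first by rewrite /L2Q LE; exact: preserving_L2 pR Lpsi.
have BE p q : bargmann T k s tau psi (pt T k s tau p q) =
    Phi (@bconst R r k s) kap (fun q' => psi (ptQ T k s tau q')) p q.
  by rewrite (bargmannE hT hk s _ _ t0) (pC_pt hT hk s p q t0) (qC_pt hT hk s p q t0).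
apply: funext => A; rewrite (bargmannE hT hk s _ A teich_moebius) LE.
rewrite /act_fun -[in RHS](pt_pCqC hT hk s A teich_moebius) pullbackC_pt.
rewrite BE.
set p := pC _ _ _ _; set q := qC _ _ _ _ _ _.
pose F q' := psi (ptQ T k s tau q') *
  kernel (@bconst R r k s) kap (rotation rotc rots p) (rotation rotc rots q) q'.
have [/L2P[mpsi _] /L2P[mK _]] := (Lpsi, L2_kernel (@bconst R r k s) (kap_gt0 hk s)
  (rotation rotc rots p) (rotation rotc rots q)).
have [mR mI] := measurableC_mul mpsi mK.
rewrite -[RHS](preserving_integralC (f := F) pR mR mI) /Phi; congr integralC.
by apply: funext => q'; rewrite /F kernel_rotation// rot_sqr.
Qed.

End Moebius.
End MappingClassGroup.

Theorem theorem2 (R : realType) (E : normedModType R) (ip : {dot E for idfun})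
    (r : nat) (T : 'I_r -> E) (hT : euclidean_basis ip T)
    (k : nat) (hk : (0 < k)%N) (s : R) :
  (forall (U : set (R * R)) (psi : R * R -> formsC E -> R[i]),
    open U -> U `<=` teich ->
    smooth_on (U `*` [set: formsC E])
      (fun x : (R * R) * formsC E => psi x.1 x.2) ->
    (forall tau, U tau -> polarised T tau (psi tau)) ->
    (* (a) *)
    (forall tau, U tau ->
      forall w : seq ('I_(r + r) + 'I_(r + r)), (size w <= 2)%N ->
      L2Q T k s tau (foldr (ladder T k s tau) (psi tau) w)) ->
    (* (b) *)
    (forall tau, U tau -> forall V, V = d_tau \/ V = d_taubar ->
      L2Q T k s tau (delta T k s V psi tau)) ->
    (forall tau, U tau -> forall A : formsC E,
      differentiableC (fun x : (R * R) * formsC E =>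
        bargmann T k s x.1 (psi x.1) x.2) (tau, A)) ->
    (forall tau, U tau -> forall V, V = d_tau \/ V = d_taubar ->
      bargmann T k s tau (delta T k s V psi tau)
      = delta T k s V (fun sigma => bargmann T k s sigma (psi sigma)) tau) ->
    forall tau, U tau -> forall V, V = d_tau \/ V = d_taubar ->
      let lhs := Ext ip T k s tau
        (hitchin_witten ip T k s V
          (fun sigma A => psi sigma (A, 0) * rho T k s sigma (A, 0)) tau) in
      L2Q T k s tau lhs /\
      bargmann T k s tau lhs
      = hitchin_complexified ip T k s V
          (fun sigma => bargmann T k s sigma (psi sigma)) tau)
  /\
  (forall f : 'M[int]_2, \det f = 1 ->
    forall tau, teich tau -> forall psi : formsC E -> R[i],
      L2Q T k s tau psi ->
      L2Q T k s (mcg_act f tau) (act_fun f psi) /\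
      bargmann T k s (mcg_act f tau) (act_fun f psi)
      = act_fun f (bargmann T k s tau psi)).
Proof.
split=> [U psi oU Ut spsi ppsi La Lb dB deltaB tau Utau V dV | f df tau t0 psi Lpsi]; last first.
  exact: (bargmann_equivariant hT hk df t0 Lpsi).
have [eta [heta VE]] : exists eta : R, (eta = 1 \/ eta = -1) /\ V = d_eta eta.
  by case: dV => ->; [exists 1|exists (-1)]; rewrite ?d_tauE ?d_taubarE; split=> //; [left|right].
rewrite VE; apply: (intertwining hT hk heta oU Ut spsi ppsi Utau (La _ Utau)).
- by apply: Lb => //; rewrite -VE.
- exact: dB.
- by apply: deltaB => //; rewrite -VE.
Qed.
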